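(* Let $A=(KQ/\mathcal{I},\leqslant)$ be a (basic) 1-quasi-hereditary algebra. Then: (1) $Q$ is the double of the quiver of the incidence algebra corresponding to $\leqslant$; that is, for vertices $i,j\in Q_0$ there is an arrow between $i$ and $j$ if and only if $i$ and $j$ are neighbours with respect to $\leqslant$, and in that case there is exactly one arrow $i\to j$ and exactly one arrow $j\to i$. (2) $\mathcal{I}$ is generated by relations of the form $p-\sum_{i\in Q_0:\ j,k\leqslant i} c_i\cdot p(j,i,k)$, where $j,k\in Q_0$, $c_i\in K$, $p=(j\to\cdots\to k)$ is a path in $Q$ from $j$ to $k$, and each $p(j,i,k)$ is a path in $Q$ of the form $(j=j_1\to\cdots\to j_m\to i\to k_1\to\cdots\to k_r=k)$ with $j_1<\cdots<j_m<i>k_1>\cdots>k_r$ (the increasing part is trivial if $j=i$, and the decreasing part is trivial if $k=i$). (3) For every $i\in Q_0$, the $\Delta$-good filtrations of the projective indecomposable module $P(i)$ are in one-to-one correspondence with the sequences $(i_1,\ldots,i_r)$, $r=|\{j\in Q_0\mid j\geqslant i\}|$, of vertices $i_m\geqslant i$ such that $i_k\not\geqslant i_t$ for all $1\leq k<t\leq r$.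
   Context: $K$ is an algebraically closed field, $Q$ is a finite quiver with vertex set $Q_0$ and arrow set $Q_1$, and $KQ/\mathcal{I}$ is a finite-dimensional bound quiver algebra ($\mathcal{I}$ an admissible ideal). Modules are finite-dimensional left modules. For $i\in Q_0$, $S(i)$, $P(i)$, $I(i)$ denote the simple, projective indecomposable and injective indecomposable module at $i$; $[M:S(i)]$ is the Jordan-Hölder multiplicity. Let $\leqslant$ be a partial order on $Q_0$. The standard module $\Delta(i)$ is the largest factor module of $P(i)$ with $[\Delta(i):S(j)]=0$ for all $j\not\leqslant i$; the costandard module $\nabla(i)$ is the largest submodule of $I(i)$ with $[\nabla(i):S(j)]=0$ for all $j\not\leqslant i$. A $\Delta$-good filtration of a module is a chain of submodules from $0$ to the module, all of whose subquotients are isomorphic to standard modules; a module having one is $\Delta$-good, and $(M:\Delta(i))$ denotes the (well-defined) number of subquotients isomorphic to $\Delta(i)$. $(KQ/\mathcal{I},\leqslant)$ is quasi-hereditary if for all $i,j\in Q_0$: $[\Delta(i):S(i)]=1$, and $P(i)$ is $\Delta$-good with $(P(i):\Delta(j))=0$ for $j\not\geqslant i$ and $(P(i):\Delta(i))=1$. A quasi-hereditary algebra $A=(KQ/\mathcal{I},\leqslant)$ is 1-quasi-hereditary if for all $i,j\in Q_0=\{1,\ldots,n\}$: (1) there is a smallest and a largest element with respect to $\leqslant$, denoted $1$ and $n$ respectively; (2) $[\Delta(i):S(j)]=(P(j):\Delta(i))=1$ for $j\leqslant i$; (3) $\operatorname{soc}P(j)\cong\operatorname{top}I(j)\cong S(1)$;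 (4) there are an injection $\Delta(i)\hookrightarrow\Delta(n)$ and a surjection $\nabla(n)\twoheadrightarrow\nabla(i)$. Two distinct vertices are neighbours with respect to $\leqslant$ if they are comparable and no vertex lies strictly between them. *)

(* Defs.v *)
From HB Require Import structures.
From mathcomp Require Import all_boot all_order all_algebra all_field.
From mathcomp Require Import finmap monalg.
From mathcomp Require Import boolp classical_sets functions.

Set Implicit Arguments.
Unset Strict Implicit.
Unset Printing Implicit Defensive.

Import GRing.Theory.

Local Open Scope classical_set_scope.
Local Open Scope ring_scope.

Record quiver (Q0 : finType) := Quiver {
  arrow : finType;
  source : arrow -> Q0;
  target : arrow -> Q0 }.

Section Paths.
Variables (Q0 : finType) (Q : quiver Q0).

Fixpoint walk (i : Q0) (s : seq (arrow Q)) : bool :=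
  if s is a :: s' then (source a == i) && walk (target a) s' else true.

Definition walk_end (i : Q0) (s : seq (arrow Q)) : Q0 :=
  last i (map (@target _ Q) s).

(* The arrows are listed in the order in which they are travelled.  The start
   vertex is recorded because it is not determined by an empty list. *)
Record qpath := QPath {
  pdata : Q0 * seq (arrow Q);
  pdata_walk : walk pdata.1 pdata.2 }.

HB.instance Definition _ := [isSub for pdata].
HB.instance Definition _ := [Choice of qpath by <:].

Definition pstart (p : qpath) : Q0 := (pdata p).1.
Definition parrows (p : qpath) : seq (arrow Q) := (pdata p).2.
Definition pend (p : qpath) : Q0 := walk_end (pstart p) (parrows p).

Definition trivial_path (i : Q0) : qpath := @QPath (i, [::]) isT.

Lemma arrow_walk (a : arrow Q) : walk (source a) [:: a].
Proof. by rewrite /= eqxx. Qed.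

Definition arrow_path (a : arrow Q) : qpath :=
  @QPath (source a, [:: a]) (arrow_walk a).

Lemma walk_cat i s t : walk i (s ++ t) = walk i s && walk (walk_end i s) t.
Proof.
by elim: s i => [|a s IHs] i //=; rewrite IHs -andbA.
Qed.

Lemma walk_end_cat i s t : walk_end i (s ++ t) = walk_end (walk_end i s) t.
Proof. by rewrite /walk_end map_cat last_cat. Qed.

Lemma concat_walk (p q : qpath) (h : pend p = pstart q) :
  walk (pstart p) (parrows p ++ parrows q).
Proof. by rewrite walk_cat [walk _ _]pdata_walk -/(pend p) h [walk _ _]pdata_walk. Qed.

(* First p, then q. *)
Definition concat (p q : qpath) (h : pend p = pstart q) : qpath :=
  @QPath (pstart p, parrows p ++ parrows q) (concat_walk h).

Lemma qpath_eq (p q : qpath) :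
  pstart p = pstart q -> parrows p = parrows q -> p = q.
Proof.
move=> hs ha; apply: val_inj => /=; rewrite [LHS]surjective_pairing.
by rewrite [RHS]surjective_pairing; congr pair.
Qed.

End Paths.

Definition pathAlgebra (K : fieldType) (Q0 : finType) (Q : quiver Q0) : Type :=
  {malg K[qpath Q]}.

HB.instance Definition _ (K : fieldType) (Q0 : finType) (Q : quiver Q0) :=
  GRing.Lmodule.copy (pathAlgebra K Q) {malg K[qpath Q]}.

Section PathAlgebra.
Variables (K : fieldType) (Q0 : finType) (Q : quiver Q0).
Local Notation KQ := (pathAlgebra K Q).
Local Notation path := (qpath Q).

Definition path_elt (p : path) : KQ := mkmalgU p 1.

(* Paths compose like functions: x * y is "first y, then x", so that left
   modules are the representations of Q. *)
Definition path_mul (x y : path) : KQ :=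
  if pselect (pend y = pstart x) is left h then path_elt (concat h) else 0.

Definition kq_mul (x y : KQ) : KQ :=
  \sum_(p <- msupp x) \sum_(q <- msupp y)
    (mcoeff p x * mcoeff q y) *: path_mul p q.

Definition kq_one : KQ := \sum_(i : Q0) path_elt (trivial_path Q i).

Let lext (V : lmodType K) (F : path -> V) (x : KQ) : V :=
  \sum_(p <- msupp x) mcoeff p x *: F p.

Let lextw (V : lmodType K) (F : path -> V) (x : KQ) (d : {fset path}) :
  (msupp x `<=` d)%fset -> lext F x = \sum_(p <- d) mcoeff p x *: F p.
Proof.
move=> le; rewrite /lext (big_fset_incl _ le) // => p _ /mcoeff_outdom ->.
by rewrite scale0r.
Qed.

Let lext_lin (V : lmodType K) (F : path -> V) c x y :
  lext F (c *: x + y) = c *: lext F x + lext F y.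
Proof.
pose d := (msupp x `|` msupp y `|` msupp (c *: x + y))%fset.
rewrite (@lextw V F x d) ?(@lextw V F y d) ?(@lextw V F (c *: x + y) d).
- rewrite scaler_sumr -big_split; apply: eq_bigr => p _ /=.
  by rewrite mcoeffD mcoeffZ scalerDl scalerA.
- by rewrite /d fsubsetUr.
- by rewrite /d -fsetUA fsetUCA fsubsetUl.
by rewrite /d -fsetUA fsubsetUl.
Qed.

Let lext_elt (V : lmodType K) (F : path -> V) p : lext F (path_elt p) = F p.
Proof.
rewrite (@lextw V F _ [fset p]%fset) ?msuppU_le //.
by rewrite big_seq_fset1 mcoeffUU scale1r.
Qed.

Let kq_mulE x y : kq_mul x y = lext (fun p => lext (path_mul p) y) x.
Proof.
apply: eq_bigr => p _; rewrite scaler_sumr; apply: eq_bigr => q _.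
by rewrite scalerA.
Qed.

Lemma kq_mul_linl c x y z : kq_mul (c *: x + y) z = c *: kq_mul x z + kq_mul y z.
Proof. by rewrite !kq_mulE lext_lin. Qed.

Lemma kq_mul_linr c x y z : kq_mul z (c *: x + y) = c *: kq_mul z x + kq_mul z y.
Proof.
rewrite !kq_mulE /lext scaler_sumr -big_split; apply: eq_bigr => p _ /=.
by rewrite -!/(lext _ _) lext_lin scalerDr !scalerA mulrC.
Qed.

Lemma kq_ind (P : KQ -> Prop) : P 0 ->
  (forall c p x, P x -> P (c *: path_elt p + x)) -> forall x, P x.
Proof.
move=> P0 PS x; rewrite [x]monalgE.
elim: (enum_fset _) => [|p s IHs]; rewrite ?big_nil ?big_cons //.
suff -> : mkmalgU p (mcoeff p x) = mcoeff p x *: path_elt p :> KQ by apply: PS.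
by apply/malgP => q; rewrite mcoeffZ !mcoeffU mulr_natr.
Qed.

Lemma kq_mul_elt p q : kq_mul (path_elt p) (path_elt q) = path_mul p q.
Proof. by rewrite kq_mulE !lext_elt. Qed.

Lemma kq_mul0l x : kq_mul 0 x = 0.
Proof. by have := kq_mul_linl (-1) 0 0 x; rewrite !scaleN1r oppr0 addr0 addNr. Qed.

Lemma kq_mul0r x : kq_mul x 0 = 0.
Proof. by have := kq_mul_linr (-1) 0 0 x; rewrite !scaleN1r oppr0 addr0 addNr. Qed.

Lemma kq_mulDl : left_distributive kq_mul +%R.
Proof. by move=> x y z; have := kq_mul_linl 1 x y z; rewrite !scale1r. Qed.

Lemma kq_mulDr : right_distributive kq_mul +%R.
Proof. by move=> z x y; have := kq_mul_linr 1 x y z; rewrite !scale1r. Qed.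

Lemma path_mulA p q r :
  kq_mul (path_elt p) (path_mul q r) = kq_mul (path_mul p q) (path_elt r).
Proof.
rewrite /path_mul; case: pselect => [h|h]; case: pselect => [h'|h'];
  rewrite ?kq_mul_elt ?kq_mul0l ?kq_mul0r //; rewrite /path_mul.
- case: pselect => [h1|h1]; last by case: h1; rewrite /pend walk_end_cat -/(pend r) h.
  case: pselect => [h2|h2]; last by case: h2.
  by congr path_elt; apply: qpath_eq => //=; rewrite /parrows /= catA.
- case: pselect => [h1|//].
  by case: h'; rewrite -h1 /pend walk_end_cat -/(pend r) h.
- case: pselect => [h2|//].
  by case: h; rewrite h2.
Qed.

Let kq_eq (f g : KQ -> KQ) :
  (forall c x y, f (c *: x + y) = c *: f x + f y) ->
  (forall c x y, g (c *: x + y) = c *: g x + g y) ->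
  (forall p, f (path_elt p) = g (path_elt p)) -> forall x, f x = g x.
Proof.
have lin0 (h : KQ -> KQ) :
    (forall c x y, h (c *: x + y) = c *: h x + h y) -> h 0 = 0.
  by move=> hl; have := hl (-1) 0 0; rewrite !scaleN1r oppr0 addr0 addNr.
move=> fl gl fg; apply: kq_ind; first by rewrite (lin0 f fl) (lin0 g gl).
by move=> c p x IHx; rewrite fl gl fg IHx.
Qed.

Let kq_mulEl c u v w z : u = c *: v + w -> kq_mul u z = c *: kq_mul v z + kq_mul w z.
Proof. by move=> ->; apply: kq_mul_linl. Qed.

Let kq_mulEr c u v w z : u = c *: v + w -> kq_mul z u = c *: kq_mul z v + kq_mul z w.
Proof. by move=> ->; apply: kq_mul_linr. Qed.

Lemma kq_mulA : associative kq_mul.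
Proof.
move=> x y z; move: x; apply: kq_eq => [c x x'|c x x'|p].
- exact: kq_mul_linl.
- by apply: kq_mulEl; apply: kq_mul_linl.
move: y; apply: kq_eq => [c x x'|c x x'|q].
- by apply: kq_mulEr; apply: kq_mul_linl.
- by apply: kq_mulEl; apply: kq_mul_linr.
move: z; apply: kq_eq => [c x x'|c x x'|r].
- by apply: kq_mulEr; apply: kq_mul_linr.
- exact: kq_mul_linr.
by rewrite (kq_mul_elt p q) (kq_mul_elt q r) path_mulA.
Qed.

Lemma kq_mul1l : left_id kq_one kq_mul.
Proof.
apply: kq_eq => [c x y|//|p]; first exact: kq_mul_linr.
have suml (I : finType) (F : I -> KQ) y :
    kq_mul (\sum_i F i) y = \sum_i kq_mul (F i) y.
  by apply: (big_morph (kq_mul^~ y) (fun a b => kq_mulDl a b y)); rewrite kq_mul0l.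
rewrite suml (bigD1 (pend p)) //= big1 ?addr0 => [|i ip]; rewrite kq_mul_elt /path_mul.
  case: pselect => [h|[]//]; congr path_elt; apply: qpath_eq => //=.
  by rewrite /parrows /= cats0.
by case: pselect => [h|//]; rewrite h eqxx in ip.
Qed.

Lemma kq_mul1r : right_id kq_one kq_mul.
Proof.
apply: kq_eq => [c x y|//|p]; first exact: kq_mul_linl.
have sumr (I : finType) (F : I -> KQ) y :
    kq_mul y (\sum_i F i) = \sum_i kq_mul y (F i).
  by apply: (big_morph (kq_mul y) (fun a b => kq_mulDr y a b)); rewrite kq_mul0r.
rewrite sumr (bigD1 (pstart p)) //= big1 ?addr0 => [|i ip]; rewrite kq_mul_elt /path_mul.
  by case: pselect => [h|[]//]; congr path_elt; apply: qpath_eq.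
by case: pselect => [h|//]; rewrite -h eqxx in ip.
Qed.

HB.instance Definition _ := GRing.Zmodule_isPzRing.Build KQ
  kq_mulA kq_mul1l kq_mul1r kq_mulDl kq_mulDr.

Definition is_ideal (I : set KQ) : Prop :=
  [/\ I 0,
      forall x y, I x -> I y -> I (x + y),
      forall a x, I x -> I (a * x)
    & forall a x, I x -> I (x * a)].

Definition ideal_gen (X : set KQ) : set KQ :=
  [set x | forall I, is_ideal I -> X `<=` I -> I x].

Definition ideal_mul (I J : set KQ) : set KQ :=
  ideal_gen [set z | exists x y, [/\ I x, J y & z = x * y]].

Definition arrow_ideal : set KQ :=
  ideal_gen [set x | exists a : arrow Q, x = path_elt (arrow_path a)].

Definition arrow_ideal_pow (m : nat) : set KQ :=
  iter m (ideal_mul arrow_ideal) setT.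

Definition admissible (I : set KQ) : Prop :=
  is_ideal I /\
  exists m, [/\ (2 <= m)%N, arrow_ideal_pow m `<=` I & I `<=` arrow_ideal_pow 2].

End PathAlgebra.

(* The algebra KQ/I, given as a finite-dimensional algebra together with a
   surjective K-algebra morphism from KQ whose kernel is the admissible ideal I. *)
Record boundQuiverAlgebra (K : fieldType) (Q0 : finType) (Q : quiver Q0) :=
  BoundQuiverAlgebra {
    bqa_ideal : set (pathAlgebra K Q);
    bqa_admissible : admissible bqa_ideal;
    bqa_alg :> falgType K;
    bqa_proj : {rmorphism pathAlgebra K Q -> bqa_alg};
    bqa_projZ : forall (c : K) x, bqa_proj (c *: x) = c *: bqa_proj x;
    bqa_proj_surj : forall a, exists x, bqa_proj x = a;
    bqa_proj_ker : forall x, bqa_proj x = 0 <-> bqa_ideal x }.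

Record module (K : fieldType) (A : falgType K) := Module {
  mcarrier :> vectType K;
  mact : A -> mcarrier -> mcarrier;
  mact_linl : forall v, linear (mact^~ v);
  mact_linr : forall a, linear (mact a);
  mact1 : forall v, mact 1 v = v;
  mactM : forall a b v, mact (a * b) v = mact a (mact b v) }.

Section Modules.
Variables (K : fieldType) (A : falgType K).
Local Notation module := (module A).
Implicit Types M N : module.

Definition is_hom M N (f : 'Hom(M, N)) : Prop :=
  forall a v, f (mact a v) = mact a (f v).

Definition injects M N : Prop :=
  exists f : 'Hom(M, N), is_hom f /\ lker f = 0%VS.

Definition surjects M N : Prop :=
  exists f : 'Hom(M, N), is_hom f /\ limg f = fullv.

Definition isomorphic M N : Prop :=
  exists f : 'Hom(M, N), [/\ is_hom f, lker f = 0%VS & limg f = fullv].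

(* Closure under the action is made boolean so that submodules are equal as soon
   as their underlying subspaces are. *)
Record submodule M := Submodule {
  sm_vspace :> {vspace M};
  sm_closed : `[< forall a v, v \in sm_vspace -> mact a v \in sm_vspace >] }.

HB.instance Definition _ M := [isSub for @sm_vspace M].
HB.instance Definition _ M := [Choice of submodule M by <:].

Lemma smP M (U : submodule M) a v : v \in (U : {vspace M}) -> mact a v \in (U : {vspace M}).
Proof. by move/asboolP: (sm_closed U); apply. Qed.

Lemma mact0 M a : mact a (0 : M) = 0.
Proof. by have := @mact_linr _ _ M a (-1) 0 0; rewrite !scaleN1r oppr0 addr0 addNr. Qed.

Lemma sm_zero_closed M :
  `[< forall a (v : M), v \in 0%VS -> mact a v \in 0%VS >].
Proof. by apply/asboolP => a v; rewrite !memv0 => /eqP ->; rewrite mact0. Qed.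

Lemma sm_full_closed M :
  `[< forall a (v : M), v \in fullv -> mact a v \in fullv >].
Proof. by apply/asboolP => a v _; rewrite memvf. Qed.

Definition sm_zero M : submodule M := Submodule (sm_zero_closed M).
Definition sm_full M : submodule M := Submodule (sm_full_closed M).

Section SubmoduleModule.
Variables (M : module) (U : submodule M).
Let V : vectType K := subvs_of U.

Let act (a : A) (x : V) : V := Subvs (smP a (subvsP x)).

Let act_linl x : linear (act^~ x).
Proof. by move=> c a b; apply: val_inj; rewrite /= mact_linl. Qed.
Let act_linr a : linear (act a).
Proof. by move=> c x y; apply: val_inj; rewrite /= mact_linr. Qed.
Let act1 x : act 1 x = x.
Proof. by apply: val_inj; rewrite /= mact1. Qed.
Let actM a b x : act (a * b) x = act a (act b x).
Proof. by apply: val_inj; rewrite /= mactM. Qed.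

Definition sm_module : module := Module act_linl act_linr act1 actM.
End SubmoduleModule.

Section QuotientModule.
Variables (M : module) (U : submodule M).
(* Cosets of U are represented by their elements in the complement U^C. *)
Let V : vectType K := subvs_of (U^C)%VS.

Definition quo_pi (v : M) : V := vsproj (U^C)%VS (daddv_pi (U^C)%VS U v).

Let capCU : (U^C :&: U = 0)%VS.
Proof. by rewrite capvC capv_compl. Qed.

Let quo_pi_lin : linear quo_pi.
Proof. by move=> c x y; rewrite /quo_pi !linearP. Qed.

Lemma val_quo_pi v : v - vsval (quo_pi v) \in (U : {vspace M}).
Proof.
rewrite /quo_pi vsprojK ?memv_pi //.
have {1}<- := @daddv_pi_add _ _ (U^C)%VS U v capCU.
  by rewrite addrAC subrr add0r memv_pi.
by rewrite addvC addv_complf memvf.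
Qed.

Lemma quo_pi_eq0 v : (quo_pi v == 0) = (v \in (U : {vspace M})).
Proof.
apply/eqP/idP => [h|vU]; first by have := val_quo_pi v; rewrite h subr0.
apply: val_inj => /=.
have hU : vsval (quo_pi v) \in (U : {vspace M}).
  by rewrite -[vsval _](subKr v) memvB // val_quo_pi.
by apply/eqP; rewrite -memv0 -capCU memv_cap subvsP hU.
Qed.

Lemma quo_piK x : quo_pi (vsval x) = x.
Proof. by rewrite /quo_pi daddv_pi_id ?subvsP // vsvalK. Qed.

Let act (a : A) (x : V) : V := quo_pi (mact a (vsval x)).

Lemma quo_pi_act a v : quo_pi (mact a v) = act a (quo_pi v).
Proof.
apply/eqP; rewrite -subr_eq0 /act.
have -> : quo_pi (mact a v) - quo_pi (mact a (vsval (quo_pi v))) =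
          quo_pi (mact a (v - vsval (quo_pi v))).
  have -> : v - vsval (quo_pi v) = -1 *: vsval (quo_pi v) + v.
    by rewrite scaleN1r addrC.
  by rewrite mact_linr quo_pi_lin scaleN1r addrC.
by rewrite quo_pi_eq0 smP // val_quo_pi.
Qed.

Let act_linl x : linear (act^~ x).
Proof. by move=> c a b; rewrite /act mact_linl quo_pi_lin. Qed.
Let act_linr a : linear (act a).
Proof. by move=> c x y; rewrite /act linearP mact_linr quo_pi_lin. Qed.
Let act1 x : act 1 x = x.
Proof. by rewrite /act mact1 quo_piK. Qed.
Let actM a b x : act (a * b) x = act a (act b x).
Proof. by rewrite /act mactM quo_pi_act. Qed.

Definition quotient : module := Module act_linl act_linr act1 actM.
End QuotientModule.

Lemma sm_inside_closed M (V U : submodule M) :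
  `[< forall a (x : sm_module V), x \in (linfun vsval @^-1: U)%VS ->
      mact a x \in (linfun vsval @^-1: U)%VS >].
Proof.
have E (y : subvs_of V) :
    (y \in (linfun vsval @^-1: U)%VS) = (vsval y \in (U : {vspace M})).
  by rewrite -memv_preim lfunE.
by apply/asboolP => a x xU; rewrite E; apply: smP; rewrite -E.
Qed.

Definition sm_inside M (V U : submodule M) : submodule (sm_module V) :=
  Submodule (sm_inside_closed V U).

(* V / (U :&: V), i.e. V/U when U is contained in V. *)
Definition subquotient M (U V : submodule M) : module :=
  quotient (sm_inside V U).

Lemma vspace_of_set (V : vectType K) (X : set V) :
  X 0 -> (forall c x y, X x -> X y -> X (c *: x + y)) ->
  exists U : {vspace V}, forall v, v \in U <-> X v.
Proof.
move=> X0 XD.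
pose P n := `[< exists2 U : {vspace V}, \dim U = n & forall v, v \in U -> X v >].
have exP : exists n, P n.
  by exists 0%N; apply/asboolP; exists 0%VS; rewrite ?dimv0 // => v; rewrite memv0 => /eqP ->.
have ubP n : P n -> (n <= \dim {:V})%N.
  by case/asboolP => U <- _; rewrite dimvS // subvf.
case: (ex_maxnP exP ubP) => n /asboolP[U dU UX] nmax.
exists U => v; split=> [|Xv]; first exact: UX.
have : P (\dim (U + <[v]>)%VS).
  apply/asboolP; exists (U + <[v]>)%VS => // w /memv_addP[u Uu [_ /vlineP[c ->] ->]].
  by rewrite addrC; apply: XD => //; apply: UX.
move/nmax; rewrite -dU => le.
have /eqP -> : U == (U + <[v]>)%VS by rewrite eqEdim addvSl.
by rewrite memvE addvSr.
Qed.

Lemma sm_bigcap_ex M (P : set (submodule M)) :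
  exists W : submodule M, forall v, v \in (W : {vspace M}) <->
    (forall U, P U -> v \in (U : {vspace M})).
Proof.
have [||W WP] := @vspace_of_set M
    (fun v => forall U : submodule M, P U -> v \in (U : {vspace M})).
- by move=> U _; rewrite mem0v.
- by move=> c x y hx hy U PU; rewrite memvD ?memvZ ?hx ?hy.
have cl : `[< forall a v, v \in W -> mact a v \in W >].
  by apply/asboolP => a v /WP h; apply/WP => U PU; apply/smP/h.
by exists (Submodule cl).
Qed.

Definition sm_bigcap M (P : set (submodule M)) : submodule M :=
  projT1 (cid (sm_bigcap_ex P)).

Lemma sm_bigcapP M (P : set (submodule M)) v :
  v \in (sm_bigcap P : {vspace M}) <-> (forall U, P U -> v \in (U : {vspace M})).
Proof. exact: (projT2 (cid (sm_bigcap_ex P))). Qed.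

(* The sum of a family is the smallest submodule containing all its members. *)
Definition sm_bigsum M (P : set (submodule M)) : submodule M :=
  sm_bigcap [set W | forall U, P U -> (U <= W)%VS].

Definition is_least M (P : set (submodule M)) (U : submodule M) : Prop :=
  P U /\ forall W, P W -> (U <= W)%VS.

Definition is_greatest M (P : set (submodule M)) (U : submodule M) : Prop :=
  P U /\ forall W, P W -> (W <= U)%VS.

Definition simple M : Prop :=
  (fullv : {vspace M}) <> 0%VS /\
  forall U : submodule M, U = sm_zero M \/ U = sm_full M.

Definition maximal_submodule M (U : submodule M) : Prop :=
  U <> sm_full M /\
  forall W : submodule M, (U <= W)%VS -> W = U \/ W = sm_full M.

Definition rad M : submodule M := sm_bigcap [set U | maximal_submodule U].
Definition top M : module := quotient (rad M).
Definition soc M : module :=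
  sm_module (sm_bigsum [set U : submodule M | simple (sm_module U)]).

(* The list [:: M_1; ...; M_r] encodes the chain 0 = M_0 <= M_1 <= ... <= M_r. *)
Definition factors M (s : seq (submodule M)) : seq module :=
  pairmap (@subquotient M) (sm_zero M) s.

Definition filtration (C : module -> Prop) M (s : seq (submodule M)) : Prop :=
  [/\ path (fun U V : submodule M => (U <= V)%VS) (sm_zero M) s,
      last (sm_zero M) s = sm_full M
    & all (fun N => `[< C N >]) (factors s)].

Definition factor_count M (s : seq (submodule M)) N : nat :=
  count (fun L => `[< isomorphic L N >]) (factors s).

(* The Jordan-Hoelder multiplicity [M : S]: the number of factors isomorphic to S
   in a composition series of M. *)
Definition jh_mult M (S : module) : nat :=
  xget 0%N [set m | exists2 s, @filtration simple M s & factor_count s S = m].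

End Modules.

Section BoundQuiverModules.
Variables (K : fieldType) (Q0 : finType) (Q : quiver Q0).
Variable A : boundQuiverAlgebra K Q.
Local Notation module := (module A).

Definition videm (i : Q0) : A := bqa_proj A (path_elt K (trivial_path Q i)).

Let reg_act (a x : A) : A := a * x.
Let reg_linl x : linear (reg_act^~ x).
Proof. by move=> c a b; rewrite /reg_act mulrDl scalerAl. Qed.
Let reg_linr a : linear (reg_act a).
Proof. by move=> c x y; rewrite /reg_act mulrDr scalerAr. Qed.
Let reg_act1 x : reg_act 1 x = x. Proof. exact: mul1r. Qed.
Let reg_actM a b x : reg_act (a * b) x = reg_act a (reg_act b x).
Proof. by rewrite /reg_act mulrA. Qed.

Definition regular : module := @Module K A A reg_act reg_linl reg_linr reg_act1 reg_actM.

Lemma projective_closed i :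
  `[< forall a (x : regular), x \in limg (amulr (videm i)) ->
      mact a x \in limg (amulr (videm i)) >].
Proof.
apply/asboolP => a x /memv_imgP[y _ ->]; apply/memv_imgP; exists (a * y).
  exact: memvf.
by rewrite !lfunE /= /reg_act mulrA.
Qed.

(* P(i) = A e_i *)
Definition projective (i : Q0) : module :=
  sm_module (@Submodule _ _ regular _ (projective_closed i)).

(* S(i), the simple factor module of P(i) *)
Definition simple_at (i : Q0) : module := top (projective i).

(* I(i) = Hom_K(e_i A, K), with (a f)(x) = f (x a) *)

Section Injective.
Variable i : Q0.
Let W : {vspace A} := limg (amull (videm i)).

Let rmul (a : A) (x : subvs_of W) : subvs_of W := vsproj W (vsval x * a).

Let val_rmul a x : vsval (rmul a x) = vsval x * a.
Proof.
rewrite vsprojK //; have /memv_imgP[y _ ->] := subvsP x; apply/memv_imgP.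
by exists (y * a); rewrite ?memvf // !lfunE /= mulrA.
Qed.

Let rmul_lin a : linear (rmul a).
Proof.
move=> c x y; apply: val_inj.
by rewrite /= !val_rmul /= mulrDl scalerAl.
Qed.

HB.instance Definition _ a := GRing.isSemilinear.Build K _ _ _ (rmul a)
  (GRing.semilinear_linear (@rmul_lin a)).

Let V : vectType K := 'Hom(subvs_of W, K^o).
Let act (a : A) (f : V) : V := (f \o linfun (rmul a))%VF.

Let actE a f x : act a f x = f (rmul a x).
Proof. by rewrite comp_lfunE lfunE. Qed.

Let act_linl f : linear (act^~ f).
Proof.
move=> c a b; apply/lfunP => x; rewrite add_lfunE scale_lfunE !actE -linearP.
congr (f _); apply: val_inj => /=.
by rewrite !val_rmul /= mulrDr scalerAr.
Qed.
Let act_linr a : linear (act a).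
Proof. by move=> c f g; apply/lfunP => x; rewrite !(actE, add_lfunE, scale_lfunE). Qed.
Let act1 f : act 1 f = f.
Proof.
by apply/lfunP => x; rewrite actE; congr (f _); apply: val_inj; rewrite /= val_rmul mulr1.
Qed.
Let actM a b f : act (a * b) f = act a (act b f).
Proof.
apply/lfunP => x; rewrite !actE; congr (f _); apply: val_inj.
by rewrite /= !val_rmul mulrA.
Qed.

Definition injective_at : module := Module act_linl act_linr act1 actM.
End Injective.

End BoundQuiverModules.

Section QuasiHereditary.
Variables (K : fieldType) (d : Order.disp_t) (Q0 : finPOrderType d).
Variables (Q : quiver Q0) (A : boundQuiverAlgebra K Q).
Local Notation module := (module A).
Implicit Types (i j : Q0) (M : module).

Definition supported_below i M : Prop :=
  forall j, ~~ (j <= i)%O -> jh_mult M (simple_at A j) = 0%N.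

(* Delta(i) is P(i)/U for the least U such that P(i)/U has no composition factor
   S(j) with j not <= i, and nabla(i) is the greatest such submodule of I(i).  Both
   exist, so the default values of xget are not used. *)
Definition standard i : module :=
  quotient (xget (sm_full (projective A i))
    [set U | is_least [set W | supported_below i (quotient W)] U]).

Definition costandard i : module :=
  sm_module (xget (sm_zero (injective_at A i))
    [set U | is_greatest [set W | supported_below i (sm_module W)] U]).

Definition good_filtration M (s : seq (submodule M)) : Prop :=
  filtration (fun N => exists j, isomorphic N (standard j)) s.

Definition good M : Prop := exists s, @good_filtration M s.

(* (M : Delta(i)), meaningful only when M is good. *)
Definition good_mult M i : nat :=
  xget 0%N [set m | exists2 s, @good_filtration M s &
                               factor_count s (standard i) = m].

Definition quasi_hereditary : Prop :=
  forall i j,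
    [/\ jh_mult (standard i) (simple_at A i) = 1%N,
        good (projective A i),
        ~~ (i <= j)%O -> good_mult (projective A i) j = 0%N
      & good_mult (projective A i) i = 1%N].

Definition one_quasi_hereditary : Prop :=
  quasi_hereditary /\
  exists bot top_ : Q0,
    [/\ forall i, (bot <= i <= top_)%O,
        forall i j, (j <= i)%O ->
          jh_mult (standard i) (simple_at A j) = 1%N /\
          good_mult (projective A j) i = 1%N,
        forall j, isomorphic (soc (projective A j)) (simple_at A bot) /\
                  isomorphic (top (injective_at A j)) (simple_at A bot)
      & forall i, injects (standard i) (standard top_) /\
                  surjects (costandard top_) (costandard i)].

Definition neighbours i j : Prop :=
  [/\ i <> j, (i >=< j)%O & forall k, ~~ (i < k < j)%O /\ ~~ (j < k < i)%O].

Definition arrows_from_to i j : {set arrow Q} :=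
  [set a | (source a == i) && (target a == j)].

(* p = (j = j_1 -> ... -> j_m -> i -> k_1 -> ... -> k_r = k) with
   j_1 < ... < j_m < i > k_1 > ... > k_r *)
Definition up_down_path j i k (p : qpath Q) : Prop :=
  exists u v : qpath Q,
    [/\ pstart u = j /\ pend u = i, pstart v = i /\ pend v = k,
        all (fun a => (source a < target a)%O) (parrows u),
        all (fun a => (target a < source a)%O) (parrows v)
      & pstart p = j /\ parrows p = parrows u ++ parrows v].

(* upd j i k is the path p(j,i,k). *)
Definition up_down_relations (upd : Q0 -> Q0 -> Q0 -> qpath Q) :
    set (pathAlgebra K Q) :=
  [set x | exists (p : qpath Q) (c : Q0 -> K),
     let j := pstart p in let k := pend p in
     x = path_elt K p -
         \sum_(i : Q0 | (j <= i)%O && (k <= i)%O) c i *: path_elt K (upd j i k)].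

Definition filtration_sequences i : set (seq Q0) :=
  [set t | [/\ size t = #|[pred j : Q0 | (i <= j)%O]|,
               all (fun j => (i <= j)%O) t
             & pairwise (fun x y => ~~ (y <= x)%O) t]].

(* (i_1, ..., i_r) lists the factors of a filtration from top to bottom:
   M_r/M_(r-1) ~ Delta(i_1), ..., M_1/M_0 ~ Delta(i_r). *)
Definition factor_labels M (s : seq (submodule M)) (t : seq Q0) : Prop :=
  all2 (fun N j => `[< isomorphic N (standard j) >]) (rev (factors s)) t.

End QuasiHereditary.

(* Main.v *)
(* Let n be the largest vertex and let T_t be the ideal generated by the e_l with
   l > t.  Going through a good filtration of P(j) layer by layer shows that
   e_k A e_t / T_t is zero unless k <= t and at most a line then, and likewise for
   e_t A e_j / T_t and j <= t.  Representatives a_kt and b_tj of these lines give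
   products a_kt b_tj, t >= j, k, which span e_k A e_j, and by comparing dimensions
   they form a basis.
   An embedding of Delta(t) into Delta(n) = P(n) is a vector v_t in e_t A e_n with
   e_k A v_t <> 0 iff k <= t; a surjection of nabla(n) = I(n) onto nabla(t) is, by
   duality, a vector w_t in e_n A e_t with w_t A e_k <> 0 iff k <= t.  The spaces
   e_k A e_n and e_n A e_k are lines, and T_t v_t = w_t T_t = 0.  Hence a product of
   arrows none of which kills the relevant v (or w) represents a_kt (or b_tj), and
   each covering relation carries such an arrow in either direction.  So a_kt and
   b_tj can be taken to be monotone paths in one fixed arrow per covering pair and
   direction.  The basis expresses any path through the paths b_tj followed by a_kt,
   which gives (2); as the ideal lies in the square of the arrow ideal, applying
   this to an arrow shows that it is one of the fixed arrows, which gives (1).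
   In (3), the submodule of P(i) with label set F is the trace of the P(l), l in F.
   These traces are good by the basis, and the vectors w_t exclude all orderings of
   the labels in which some x > y sits above y. *)

From HB Require Import structures.
From mathcomp Require Import all_boot all_order all_algebra all_field.
From mathcomp Require Import finmap monalg.
From mathcomp Require Import boolp classical_sets functions.
Require Import Defs.

Set Implicit Arguments.
Unset Strict Implicit.
Unset Printing Implicit Defensive.

Import Order.POrderTheory GRing.Theory.
Local Open Scope ring_scope.

(** * Bound quiver algebras *)

(** Whether a product survives modulo $T_t$ cannot be decided factor by factor, since a product of
    nonzero classes may vanish. The vectors $v_t$ repair this: left multiplication by an arrow sends
    the line $e_kAe_n$ at its source to the line at its target, hence acts by a scalar, and a path
    acts by the product of its scalars. Not killing $v_t$ is stronger than lying outside $T_t$, but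
    it is multiplicative along paths. Any representative with this property is as good as any other;
    this freedom allows monotone paths and, in (3), representatives routed through a prescribed
    vertex. The two sides are not symmetric, because modules are left modules: $v_t$ is simply the
    image of a generator, while $w_t$ has to be extracted from a map between spaces of functionals.
    To see that $w_t$ does not kill $e_tAe_k$ for $k\le t$, a functional vanishing on $T_t$ but not
    on $e_tAe_k$ is needed, so it must be known beforehand that $e_tAe_k$ is not contained in $T_t$;
    this comes from counting dimensions in $e_kAe_k$. *)

Section PathLength.
Variables (K : fieldType) (Q0 : finType) (Q : quiver Q0).
Local Notation KQ := (pathAlgebra K Q).
Local Notation path := (qpath Q).
Implicit Types (x y z : KQ) (p q : path).

Definition plen p := size (parrows p).

(** A coefficientwise description of the $k$-th power of the arrow ideal, which itself is only given
    as an iterated intersection of ideals. *)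
Definition min_length (k : nat) (x : KQ) := forall p, (plen p < k)%N -> mcoeff p x = 0.

Lemma mcoeff_path p q : mcoeff q (path_elt K p) = (p == q)%:R.
Proof. by rewrite mcoeffU. Qed.

Lemma kq_sum x : x = \sum_(p <- msupp x) mcoeff p x *: path_elt K p.
Proof.
rewrite [LHS]monalgE; apply: eq_bigr => p _.
apply/(malgP (mkmalgU p (mcoeff p x) : {malg K[qpath Q]})) => q.
by rewrite mcoeffU mcoeffZ mcoeff_path mulr_natr.
Qed.

Lemma kq_mul_sum x y : x * y = \sum_(p <- msupp x) \sum_(q <- msupp y)
    (mcoeff p x * mcoeff q y) *: path_mul K p q.
Proof. by []. Qed.

Lemma path_mul_concat p q (h : pend q = pstart p) :
  path_mul K p q = path_elt K (concat h).
Proof.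
rewrite /path_mul; case: pselect => [h'|//].
by congr path_elt; apply: qpath_eq.
Qed.

Lemma path_mul_eq0 p q : pend q <> pstart p -> path_mul K p q = 0.
Proof. by rewrite /path_mul; case: pselect. Qed.

Lemma path_eltM p q : path_elt K p * path_elt K q = path_mul K p q.
Proof. exact: kq_mul_elt. Qed.

Lemma min_length0 k : min_length k 0.
Proof. by move=> p _; rewrite mcoeff0. Qed.

Lemma min_lengthD k x y : min_length k x -> min_length k y -> min_length k (x + y).
Proof. by move=> hx hy p lp; rewrite mcoeffD hx ?hy ?addr0. Qed.

Lemma min_lengthZ k c x : min_length k x -> min_length k (c *: x).
Proof. by move=> hx p lp; rewrite mcoeffZ hx ?mulr0. Qed.

Lemma min_length_sum k (I : Type) (r : seq I) (P : pred I) (F : I -> KQ) :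
  (forall i, P i -> min_length k (F i)) -> min_length k (\sum_(i <- r | P i) F i).
Proof. by move=> h; elim/big_rec: _ => [|i x Pi hx]; [exact: min_length0 | apply: min_lengthD; auto]. Qed.

Lemma min_length_supp k x p : min_length k x -> p \in msupp x -> (k <= plen p)%N.
Proof.
by move=> hx; rewrite -mcoeff_neq0 leqNgt; apply: contraNN => /hx ->; rewrite eqxx.
Qed.

Lemma min_length_path p : min_length (plen p) (path_elt K p).
Proof.
move=> q lq; rewrite mcoeff_path; case: eqP => // e.
by rewrite e ltnn in lq.
Qed.

Lemma min_length_le k l x : (l <= k)%N -> min_length k x -> min_length l x.
Proof. by move=> lk h p hp; apply: h; apply: leq_trans lk. Qed.

Lemma min_lengthM k l x y : min_length k x -> min_length l y -> min_length (k + l) (x * y).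
Proof.
move=> hx hy; rewrite kq_mul_sum big_seq; apply: min_length_sum => p /(min_length_supp hx) px.
rewrite big_seq; apply: min_length_sum => q /(min_length_supp hy) qy; apply: min_lengthZ.
case: (pselect (pend q = pstart p)) => [h|h]; last by rewrite path_mul_eq0 //; apply: min_length0.
rewrite path_mul_concat; apply: min_length_le (@min_length_path _).
by rewrite /plen /parrows /= size_cat addnC leq_add.
Qed.

Lemma min_length_ideal k : is_ideal (min_length k).
Proof.
split=> [|x y|a x hx|a x hx]; [exact: min_length0 | exact: min_lengthD | |].
  by rewrite -[k]add0n; apply: min_lengthM.
by rewrite -[k]addn0; apply: min_lengthM.
Qed.

Lemma ideal_gen_sub (X I : classical_sets.set KQ) :
  is_ideal I -> (X `<=` I)%classic -> (ideal_gen X `<=` I)%classic.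
Proof. by move=> hI hX x /(_ I hI hX). Qed.

Lemma ideal_gen_ideal (X : classical_sets.set KQ) : is_ideal (ideal_gen X).
Proof.
split=> [|x y hx hy|a x hx|a x hx] I hI sub; case: (hI) => h0 hD hl hr //.
- by apply: hD; [apply: hx | apply: hy].
- by apply: hl; apply: hx.
- by apply: hr; apply: hx.
Qed.

Lemma ideal_gen_in (X : classical_sets.set KQ) x : X x -> ideal_gen X x.
Proof. by move=> Xx I _; apply. Qed.

Lemma arrow_ideal_min_length x : arrow_ideal x -> min_length 1 x.
Proof.
apply: (ideal_gen_sub (min_length_ideal 1)) => y [a ->].
exact: (@min_length_path (arrow_path a)).
Qed.

Lemma arrow_ideal_pow_min_length m x : arrow_ideal_pow m x -> min_length m x.
Proof.
elim: m x => [|m IH] x; first by move=> _ p.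
apply: (ideal_gen_sub (min_length_ideal m.+1)) => y [a] [b] [ha hb ->].
by rewrite -add1n; apply: min_lengthM; [apply: arrow_ideal_min_length | apply: IH].
Qed.

Lemma arrow_ideal_pow_path m p : (m <= plen p)%N -> arrow_ideal_pow m (path_elt K p).
Proof.
elim: m p => [|m IH] p; first by [].
case: p => [[i s] hs]; rewrite /plen /parrows /=.
(* The new factor of a power stands on the left, and left factors are travelled last; so it is the
   last arrow that is split off. *)
case: (lastP s) hs => [//|t a] hs; rewrite size_rcons ltnS => mt.
have : walk i (t ++ [:: a]) by rewrite cats1.
rewrite walk_cat => /andP[ht]; rewrite /= andbT => /eqP ha.
pose q := @QPath _ Q (i, t) ht.
have h : pend q = pstart (arrow_path a) by rewrite /pend /pstart /= ha.
have -> : path_elt K (QPath hs) = path_elt K (arrow_path a) * path_elt K q.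
  rewrite path_eltM path_mul_concat; congr path_elt; apply: qpath_eq => //.
  by rewrite /parrows /= -cats1.
apply: ideal_gen_in; exists (path_elt K (arrow_path a)), (path_elt K q); split=> //.
  by apply: ideal_gen_in; exists a.
exact: (IH q).
Qed.

(** [is_ideal] does not mention scalars; they act through multiples of the unit. *)
Lemma idealZ (I : classical_sets.set KQ) c x : is_ideal I -> I x -> I (c *: x).
Proof.
case=> _ _ hl _ Ix; have -> : c *: x = kq_mul (c *: kq_one K Q) x; last exact: hl.
by rewrite -[c *: kq_one K Q]addr0 kq_mul_linl kq_mul1l kq_mul0l addr0.
Qed.

Lemma ideal_sum (I : classical_sets.set KQ) (T : Type) (r : seq T) (P : pred T) (F : T -> KQ) :
  is_ideal I -> (forall i, P i -> I (F i)) -> I (\sum_(i <- r | P i) F i).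
Proof. by case=> h0 hD _ _ h; elim/big_rec: _ => // i x Pi hx; apply: hD => //; apply: h. Qed.

End PathLength.

Section BoundQuiver.
Variables (K : fieldType) (Q0 : finType) (Q : quiver Q0).
Variable A : boundQuiverAlgebra K Q.
Local Notation KQ := (pathAlgebra K Q).
Local Notation path := (qpath Q).
Local Notation e := (@videm K Q0 Q A).
Implicit Types (p q : path) (a x y z : A).

Definition path_image p : A := bqa_proj A (path_elt K p).

Lemma videmE i : e i = path_image (trivial_path Q i). Proof. by []. Qed.

Lemma path_image_concat p q (h : pend q = pstart p) : path_image (concat h) = path_image p * path_image q.
Proof. by rewrite /path_image -rmorphM path_eltM path_mul_concat. Qed.

Lemma path_imageM0 p q : pend q <> pstart p -> path_image p * path_image q = 0.
Proof. by move=> h; rewrite /path_image -rmorphM path_eltM path_mul_eq0 // rmorph0. Qed.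

Lemma videm_path_image i p : e i * path_image p = (pend p == i)%:R *: path_image p.
Proof.
case: eqP => [h|h]; last by rewrite scale0r videmE path_imageM0.
rewrite scale1r videmE -(@path_image_concat (trivial_path Q i) p h); congr path_image.
by apply: qpath_eq; rewrite // /parrows /= cats0.
Qed.

Lemma path_image_videm i p : path_image p * e i = (pstart p == i)%:R *: path_image p.
Proof.
case: eqP => [h|h]; last by rewrite scale0r videmE path_imageM0 // => /esym.
rewrite scale1r videmE -(@path_image_concat p (trivial_path Q i) (esym h)); congr path_image.
exact: qpath_eq.
Qed.

Lemma pend_path_image p : e (pend p) * path_image p = path_image p.
Proof. by rewrite videm_path_image eqxx scale1r. Qed.

Lemma path_image_pstart p : path_image p * e (pstart p) = path_image p.
Proof. by rewrite path_image_videm eqxx scale1r. Qed.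

Lemma videmM i j : e i * e j = (i == j)%:R *: e i.
Proof. by rewrite {1}videmE path_image_videm. Qed.

Lemma videmM0 i j : i != j -> e i * e j = 0.
Proof. by move=> ij; rewrite videmM (negPf ij) scale0r. Qed.

Lemma videm_idem i : e i * e i = e i.
Proof. by rewrite videmM eqxx scale1r. Qed.

Lemma videm_sum : \sum_i e i = 1.
Proof. by rewrite -(rmorph1 (bqa_proj A)) rmorph_sum. Qed.

Lemma alg_ind (P : A -> Prop) : P 0 ->
  (forall c p x, P x -> P (c *: path_image p + x)) -> forall x, P x.
Proof.
move=> P0 PS x; have [u <-] := bqa_proj_surj x; move: u.
apply: kq_ind => [|c p u Pu]; first by rewrite rmorph0.
by rewrite rmorphD bqa_projZ; apply: PS.
Qed.

Lemma alg_mem (U : {vspace A}) : (forall p, path_image p \in U) -> U = fullv.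
Proof.
move=> h; apply/vspaceP => x; rewrite memvf; move: x.
by apply: alg_ind => [|c p x xU]; rewrite ?mem0v // memvD ?memvZ.
Qed.

(** The image of the arrow ideal, that is, the Jacobson radical of the algebra. *)
Definition arrow_rad (x : A) := exists2 u : KQ, min_length 1 u & x = bqa_proj A u.

Lemma arrow_rad0 : arrow_rad 0.
Proof. by exists 0; [exact: min_length0 | rewrite rmorph0]. Qed.

Lemma arrow_radD x y : arrow_rad x -> arrow_rad y -> arrow_rad (x + y).
Proof.
by case=> u lu -> [v lv ->]; exists (u + v); [exact: min_lengthD | rewrite rmorphD].
Qed.

Lemma arrow_radZ c x : arrow_rad x -> arrow_rad (c *: x).
Proof. by case=> u lu ->; exists (c *: u); [exact: min_lengthZ | rewrite bqa_projZ]. Qed.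

Lemma arrow_radMl x y : arrow_rad x -> arrow_rad (y * x).
Proof.
case=> u lu ->; have [v <-] := bqa_proj_surj y.
exists (v * u); last by rewrite rmorphM.
by case: (min_length_ideal K Q 1) => _ _ h _; apply: h.
Qed.

Lemma arrow_radMr x y : arrow_rad x -> arrow_rad (x * y).
Proof.
case=> u lu ->; have [v <-] := bqa_proj_surj y.
exists (u * v); last by rewrite rmorphM.
by case: (min_length_ideal K Q 1) => _ _ _ h; apply: h.
Qed.

Lemma arrow_rad_path_image p : (0 < plen p)%N -> arrow_rad (path_image p).
Proof. by move=> h; exists (path_elt K p) => //; apply: min_length_le (@min_length_path _ _ _ p). Qed.

Lemma min_length_proj0 : exists m, forall u : KQ, min_length m u -> bqa_proj A u = 0.
Proof.
have [hI [m [_ hm _]]] := bqa_admissible A.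
exists m => u lu; apply/bqa_proj_ker; rewrite [u]kq_sum big_seq.
apply: ideal_sum => // p /(min_length_supp lu) px.
by apply: idealZ => //; apply/hm/arrow_ideal_pow_path.
Qed.

Lemma path_image_long0 : exists m, forall p, (m <= plen p)%N -> path_image p = 0.
Proof.
have [m hm] := min_length_proj0; exists m => p lp; apply: hm.
exact: min_length_le (@min_length_path _ _ _ p).
Qed.

Lemma arrow_rad_nilp x : arrow_rad x -> exists m, x ^+ m = 0.
Proof.
case=> u lu ->; have [m hm] := min_length_proj0; exists m.
have h k : exists2 v : KQ, min_length k v & bqa_proj A u ^+ k = bqa_proj A v.
  elim: k => [|k [v lv E]]; first by exists 1; rewrite ?rmorph1 ?expr0.
  exists (u * v); first by rewrite -add1n; apply: min_lengthM.
  by rewrite exprS E rmorphM.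
by have [v lv ->] := h m; apply: hm.
Qed.

(** The upper bound in admissibility: no relation involves a vertex or a single arrow. It keeps the
    idempotents out of the radical and later decides which arrows exist. *)
Lemma ker_min_length2 (u : KQ) : bqa_proj A u = 0 -> min_length 2 u.
Proof.
have [_ [m [_ _ hm]]] := bqa_admissible A.
by move/bqa_proj_ker/hm/arrow_ideal_pow_min_length.
Qed.

Lemma videm_notin_arrow_rad i c : arrow_rad (c *: e i) -> c = 0.
Proof.
case=> u lu E.
have : min_length 2 (c *: path_elt K (trivial_path Q i) - u).
  by apply: ker_min_length2; rewrite rmorphB bqa_projZ -E subrr.
move/(_ (trivial_path Q i) isT).
rewrite mcoeffB mcoeffZ mcoeff_path eqxx mulr1 (lu (trivial_path Q i)) //.
by rewrite subr0.
Qed.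

(** Only trivial paths survive modulo the radical, and only the one at [i] lies in this corner; so
    $e_iAe_i$ is local with residue field $K$. *)
Lemma corner_local i x : exists c, arrow_rad (e i * x * e i - c *: e i).
Proof.
move: x; apply: alg_ind => [|c p x [c' IH]].
  by exists 0; rewrite mulr0 mul0r scale0r subrr; exact: arrow_rad0.
have [h|h] := posnP (plen p); last first.
  exists c'; rewrite mulrDr mulrDl -addrA; apply: arrow_radD => //.
  by apply: arrow_radMr; apply: arrow_radMl; apply: arrow_radZ; apply: arrow_rad_path_image.
have -> : path_image p = e (pstart p) by rewrite videmE; congr path_image; apply: qpath_eq => //; exact: size0nil.
rewrite mulrDr mulrDl -scalerAr -scalerAl.
have [->|ne] := eqVneq (pstart p) i.
  exists (c + c'); rewrite !videm_idem scalerDl opprD addrACA subrr.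
  by apply: arrow_radD => //; exact: arrow_rad0.
by exists c'; rewrite videmM0 1?eq_sym // mul0r scaler0 add0r.
Qed.

Lemma corner_arrow_rad i j x : i != j -> arrow_rad (e i * x * e j).
Proof.
move=> ij; move: x; apply: alg_ind => [|c p x IH]; first by rewrite mulr0 mul0r; exact: arrow_rad0.
rewrite mulrDr mulrDl; apply: arrow_radD => //.
have [h|h] := posnP (plen p); last first.
  by apply: arrow_radMr; apply: arrow_radMl; apply: arrow_radZ; apply: arrow_rad_path_image.
have -> : path_image p = e (pstart p) by rewrite videmE; congr path_image; apply: qpath_eq => //; exact: size0nil.
rewrite -scalerAr -scalerAl; apply: arrow_radZ.
have [<-|ne] := eqVneq i (pstart p); last by rewrite videmM0 // mul0r; exact: arrow_rad0.
by rewrite videm_idem videmM0 //; exact: arrow_rad0.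
Qed.

(* Geometric series for a nilpotent perturbation of the identity of e_i A e_i. *)
Lemma corner_inv i x c : c != 0 -> e i * x * e i = x -> arrow_rad (x - c *: e i) ->
  exists y, y * x = e i.
Proof.
move=> c0 hx /(@arrow_radZ (- c^-1)); rewrite scalerBr !scaleNr opprK scalerA mulVf //.
rewrite scale1r addrC; set r := _ - _ => jr.
have xE : c^-1 *: x = e i - r by rewrite /r opprB addrC subrK.
have rE : e i * r = r.
  rewrite /r mulrBr videm_idem -scalerAr; congr (_ - _ *: _).
  by rewrite -{1}hx !mulrA videm_idem hx.
have rE' : r * e i = r.
  rewrite /r mulrBl videm_idem -scalerAl; congr (_ - _ *: _).
  by rewrite -{1}hx -!mulrA videm_idem !mulrA hx.
have [m rm] := arrow_rad_nilp jr.
exists (c^-1 *: \sum_(k < m) r ^+ k).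
rewrite -scalerAl scalerAr xE -{2}rE' -[X in X - _]mul1r -mulrBl mulrA.
suff -> : (\sum_(k < m) r ^+ k) * (1 - r) = 1 by rewrite mul1r.
rewrite -opprB mulrN mulr_suml -[RHS]subr0 -[X in _ = _ - X]rm -[RHS]opprB; congr (- _).
rewrite subrX1 mulr_sumr; apply: eq_bigr => k _.
by rewrite mulrBl mulrBr mulr1 mul1r -exprS -exprSr.
Qed.

End BoundQuiver.

(* Otherwise unification unfolds these when comparing distinct idempotents. *)
Opaque videm path_image.

HB.instance Definition _ (K : fieldType) (A : falgType K) (M : module A) a :=
  GRing.isSemilinear.Build K M M _ (@mact K A M a)
    (GRing.semilinear_linear (@mact_linr K A M a)).

Definition hom_of (K : fieldType) (U V : vectType K) (f : U -> V) (fl : linear f) : 'Hom(U, V) :=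
  linfun (HB.pack_for {linear U -> V} f (GRing.isLinear.Build K U V _ f fl)).

Lemma hom_ofE (K : fieldType) (U V : vectType K) (f : U -> V) (fl : linear f) x :
  hom_of fl x = f x.
Proof. by rewrite lfunE. Qed.

(** * Modules, layers and chains *)

Section ModuleBasics.
Variables (K : fieldType) (A : falgType K).
Local Notation module := (module A).
Implicit Types (M N : module) (a b : A).

Lemma mactDl M a b (v : M) : mact (a + b) v = mact a v + mact b v.
Proof. by have := @mact_linl _ _ M v 1 a b; rewrite !scale1r. Qed.

Lemma mact0l M (v : M) : mact 0 v = 0.
Proof. by have := @mact_linl _ _ M v (-1) 0 0; rewrite !scaleN1r oppr0 addr0 addNr. Qed.

Lemma mactZl M c a (v : M) : mact (c *: a) v = c *: mact a v.
Proof. by have := @mact_linl _ _ M v c a 0; rewrite !addr0 mact0l addr0. Qed.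

Lemma mact_suml M (I : Type) (r : seq I) (P : pred I) (F : I -> A) (v : M) :
  mact (\sum_(i <- r | P i) F i) v = \sum_(i <- r | P i) mact (F i) v.
Proof. by apply: (big_morph (fun a => mact a v)) => [a b|]; rewrite ?mactDl ?mact0l. Qed.

Lemma sm_eq M (U V : submodule M) : (U <= V)%VS -> (V <= U)%VS -> U = V.
Proof. by move=> h h'; apply: val_inj; apply/eqP; rewrite eqEsubv h. Qed.

Definition mk_submodule M (U : {vspace M}) (h : forall a v, v \in U -> mact a v \in U) :
  submodule M := Submodule (introT (asboolP _) h).

Lemma quo_pi_linear M (U : submodule M) : linear (quo_pi U).
Proof. by move=> c x y; rewrite /quo_pi !linearP. Qed.

HB.instance Definition _ M (U : submodule M) :=
  GRing.isSemilinear.Build K M (subvs_of (U^C)%VS) _ (quo_pi U)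
    (GRing.semilinear_linear (quo_pi_linear U)).

Lemma quo_act M (U : submodule M) a (v : M) :
  quo_pi U (mact a v) = mact a (quo_pi U v : quotient U).
Proof. exact: quo_pi_act. Qed.

Lemma mem_inside M (V U : submodule M) (x : sm_module V) :
  (x \in (sm_inside V U : {vspace _})) = (vsval x \in (U : {vspace M})).
Proof. by rewrite -memv_preim lfunE. Qed.

Lemma val_act M (V : submodule M) a (x : sm_module V) :
  vsval (mact a x : sm_module V) = mact a (vsval x).
Proof. by []. Qed.

(* [V / W] is isomorphic to [N], phrased inside the ambient module. *)
Definition layer M (W V : submodule M) N :=
  exists phi : 'Hom(M, N),
    [/\ forall v, v \in (V : {vspace M}) -> (phi v == 0) = (v \in (W : {vspace M})),
        forall a v, v \in (V : {vspace M}) -> phi (mact a v) = mact a (phi v)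
      & forall n, exists2 v, v \in (V : {vspace M}) & phi v = n].

Lemma iso_layer M (W V : submodule M) N :
  isomorphic (subquotient W V) N -> layer W V N.
Proof.
case=> f [fh /eqP/lker0P f0 fT].
pose psi := linfun (quo_pi (sm_inside V W)).
(* The projection extends the isomorphism to all of [M]; its values outside [V] are irrelevant. *)
pose pr : 'Hom(M, sm_module V) := linfun (vsproj V).
have prE v (vV : v \in (V : {vspace M})) : pr v = Subvs vV.
  by rewrite /pr lfunE /=; apply: val_inj; rewrite /= vsprojK.
exists (f \o psi \o pr)%VF; split=> [v vV|a v vV|n].
- rewrite !comp_lfunE prE /psi lfunE /=.
  by rewrite -(linear0 f) (inj_eq f0) quo_pi_eq0 mem_inside.
- rewrite !comp_lfunE !prE ?smP // => avV.
  by rewrite /psi !lfunE /= -fh -quo_act; congr (f (quo_pi _ _)); apply: val_inj.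
- have : n \in limg f by rewrite fT memvf.
  case/memv_imgP => x _ ->; exists (vsval (vsval x)); first exact: subvsP.
  rewrite !comp_lfunE /pr /psi !lfunE /= vsvalK; congr (f _).
  exact: (quo_piK x).
Qed.

Lemma layer_iso M (W V : submodule M) N :
  layer W V N -> isomorphic (subquotient W V) N.
Proof.
case=> phi [ph0 pha phs].
pose g0 (x : subquotient W V) := phi (vsval (vsval x)).
have g0l : linear g0 by move=> c x y; rewrite /g0 !linearP.
pose g := hom_of g0l.
have gE x : g x = phi (vsval (vsval x)) by rewrite hom_ofE.
have qE (y : sm_module V) : g (quo_pi (sm_inside V W) y) = phi (vsval y).
  rewrite gE; apply/esym/eqP; rewrite -subr_eq0 -linearB /= ph0.
    by have := val_quo_pi (sm_inside V W) y; rewrite mem_inside.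
  by rewrite memvB ?subvsP.
exists g; split.
- move=> a x; rewrite -[in RHS](quo_piK x) -[in LHS](quo_piK x) -quo_act qE val_act.
  by rewrite pha ?subvsP // -qE.
- apply/eqP/lker0P => x y /eqP; rewrite -subr_eq0 -linearB /= gE ph0 ?subvsP //.
  rewrite -mem_inside -quo_pi_eq0 quo_piK => /eqP.
  by move/eqP; rewrite subr_eq0 => /eqP.
- apply/vspaceP => n; rewrite memvf; have [v vV <-] := phs n.
  by rewrite -[v]/(vsval (Subvs vV)) -qE memv_img ?memvf.
Qed.

(** The arbitrary start [W] allows induction and cutting; explicit labels, from bottom to top,
    replace isomorphism classes of factors. *)
Fixpoint chain (T : Type) (D : T -> module) M (W : submodule M)
    (s : seq (submodule M)) (lb : seq T) : Prop :=
  match s, lb with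
  | V :: s', l :: lb' => [/\ (W <= V)%VS, layer W V (D l) & chain D V s' lb']
  | [::], [::] => True
  | _, _ => False
  end.

Lemma chainP (T : Type) (D : T -> module) M (W : submodule M) s lb :
  chain D W s lb <->
  path (fun U V : submodule M => (U <= V)%VS) W s /\
  all2 (fun N j => `[< isomorphic N (D j) >]) (pairmap (@subquotient K A M) W s) lb.
Proof.
elim: s W lb => [|V s IH] W [|l lb] //=.
- by split=> // -[].
- by split=> // -[].
- split.
    case=> WV lay /IH[pa al]; rewrite WV pa al; split=> //; rewrite andbT.
    by apply/asboolP/layer_iso.
  case=> /andP[WV pa] /andP[/asboolP is_ al]; split=> //; first exact: iso_layer.
  exact/IH.
Qed.

Lemma chain_exists (T : Type) (D : T -> module) (C : module -> Prop) M (W : submodule M) s :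
  (forall N, C N -> exists l, isomorphic N (D l)) ->
  path (fun U V : submodule M => (U <= V)%VS) W s ->
  all (fun N => `[< C N >]) (pairmap (@subquotient K A M) W s) ->
  exists lb, chain D W s lb.
Proof.
move=> hC; elim: s W => [|V s IH] W /=; first by exists [::].
case/andP=> WV pa /andP[/asboolP/hC[l il] al].
have [lb hlb] := IH _ pa al; exists (l :: lb); split=> //; exact: iso_layer.
Qed.

Lemma chain_cat (T : Type) (D : T -> module) M (W : submodule M) s1 s2 l1 l2 :
  size s1 = size l1 ->
  chain D W (s1 ++ s2) (l1 ++ l2) <-> chain D W s1 l1 /\ chain D (last W s1) s2 l2.
Proof.
elim: s1 W l1 => [|V s1 IH] W [|l l1] //=; first by move=> _; split=> // -[].
case=> sz; split; first by case=> h1 h2 /(IH _ _ sz)[h3 h4].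
by case=> -[h1 h2 h3] h4; split=> //; apply/IH.
Qed.

Lemma chain_size (T : Type) (D : T -> module) M (W : submodule M) s lb :
  chain D W s lb -> size s = size lb.
Proof. by elim: s W lb => [|V s IH] W [|l lb] //= -[_ _ /IH ->]. Qed.

End ModuleBasics.

(** * Dimension vectors and composition series *)

Section Idempotents.
Variables (K : fieldType) (Q0 : finType) (Q : quiver Q0).
Variable A : boundQuiverAlgebra K Q.
Local Notation module := (module A).
Local Notation e := (@videm K Q0 Q A).
Implicit Types (M N : module) (i j k : Q0) (a b : A).

Definition idem_act M k : 'End(M) := linfun (mact (e k)).

Lemma idem_actE M k (v : M) : idem_act M k v = mact (e k) v.
Proof. by rewrite lfunE. Qed.

(** The dimension vector of a subspace. For a whole module its entries turn out to be the
    composition multiplicities, see [jh_multE]. *)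
Definition subdim_at M (U : {vspace M}) k : nat := \dim (idem_act M k @: U).
Definition dim_at M k : nat := @subdim_at M fullv k.

Lemma act_videm_sum M (v : M) : \sum_k mact (e k) v = v.
Proof. by rewrite -mact_suml videm_sum mact1. Qed.

Lemma act_idem M k (v : M) : mact (e k) (mact (e k) v) = mact (e k) v.
Proof. by rewrite -mactM videm_idem. Qed.

Lemma act_videm0 M k j (v : M) : k != j -> mact (e j) v = v -> mact (e k) v = 0.
Proof. by move=> kj <-; rewrite -mactM videmM0 // mact0l. Qed.

Lemma mem_idem_act M (U : submodule M) k (v : M) :
  v \in (idem_act M k @: U)%VS <-> v \in (U : {vspace M}) /\ mact (e k) v = v.
Proof.
split=> [/memv_imgP[w wU ->]|[vU <-]]; last by rewrite -idem_actE memv_img.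
by rewrite idem_actE act_idem smP.
Qed.

Lemma mem_idem_actf M k (v : M) : v \in limg (idem_act M k) <-> mact (e k) v = v.
Proof. by rewrite (mem_idem_act (sm_full M)) /= memvf; split=> [[]|]. Qed.

(** Rank and nullity of the layer map restricted to $e_kV$: its kernel is $e_kW$ and its image is
    $e_kN$. *)
Lemma layer_subdim M (W V : submodule M) N k :
  (W <= V)%VS -> layer W V N -> subdim_at V k = (subdim_at W k + dim_at N k)%N.
Proof.
move=> /subvP WV [phi [ph0 pha phs]].
rewrite /subdim_at -(limg_ker_dim phi); congr (_ + _)%N; congr (\dim _); apply/vspaceP => v.
  apply/idP/idP; rewrite memv_cap memv_ker.
    case/andP=> /mem_idem_act[vV ev] /eqP v0; apply/mem_idem_act; split=> //.
    by rewrite -ph0 // v0 eqxx.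
  case/mem_idem_act => vW ev; rewrite ph0 ?WV // vW andbT.
  by apply/mem_idem_act; split=> //; apply: WV.
apply/idP/idP => [/memv_imgP[w /mem_idem_act[wV ew] ->]|].
  by apply/mem_idem_actf; rewrite -pha // ew.
move/mem_idem_actf => ev; have [w wV pw] := phs v.
apply/memv_imgP; exists (mact (e k) w); last by rewrite pha // pw ev.
by apply/mem_idem_act; rewrite smP // act_idem.
Qed.

Lemma iso_dim_at M N k : isomorphic M N -> dim_at M k = dim_at N k.
Proof.
case=> f [fh f0 fT]; rewrite /dim_at /subdim_at -(limg_dim_eq (f := f)); last by rewrite f0 capv0.
congr (\dim _); apply/vspaceP => v; apply/idP/idP.
  by case/memv_imgP=> w /mem_idem_actf ew ->; apply/mem_idem_actf; rewrite -fh ew.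
move/mem_idem_actf => ev; have : v \in limg f by rewrite fT memvf.
case/memv_imgP => w _ wv; apply/memv_imgP; exists (mact (e k) w); last by rewrite fh -wv ev.
by apply/mem_idem_actf; rewrite act_idem.
Qed.

Lemma chain_subdim (T : Type) (D : T -> module) M (W : submodule M) s lb k :
  chain D W s lb -> subdim_at (last W s) k = (subdim_at W k + \sum_(l <- lb) dim_at (D l) k)%N.
Proof.
elim: s W lb => [|V s IH] W [|l lb] //=; first by rewrite big_nil addn0.
by case=> WV lay /IH ->; rewrite big_cons addnA (layer_subdim k WV lay).
Qed.

Lemma subdim_at0 M k : @subdim_at M 0%VS k = 0%N.
Proof. by rewrite /subdim_at limg0 dimv0. Qed.

Lemma subdim_at_eq0 M (U : submodule M) k :
  subdim_at U k = 0%N <-> forall v, v \in (U : {vspace M}) -> mact (e k) v = 0.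
Proof.
split=> [/eqP|h].
  rewrite dimv_eq0 => /eqP h v vU; apply/eqP; rewrite -memv0 -h.
  by rewrite -idem_actE memv_img.
apply/eqP; rewrite dimv_eq0 -subv0; apply/subvP => v /mem_idem_act[vU <-].
by rewrite h // mem0v.
Qed.

Lemma dim_at_eq0 M k : dim_at M k = 0%N <-> forall v : M, mact (e k) v = 0.
Proof.
rewrite /dim_at (subdim_at_eq0 (sm_full M)); split=> h v; last by move=> _; apply: h.
by apply: h; apply: memvf.
Qed.

Definition onedim N i :=
  exists g : N, [/\ g != 0, mact (e i) g = g, forall a, arrow_rad a -> mact a g = 0
                  & fullv = <[g]>%VS].

Lemma onedim_dim_at N i k : onedim N i -> dim_at N k = (k == i).
Proof.
case=> g [g0 eg _ gT]; have [->|ki] := eqVneq k i; last first.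
  apply/dim_at_eq0 => v; have : v \in <[g]>%VS by rewrite -gT memvf.
  by case/vlineP=> c ->; rewrite linearZ /= (act_videm0 ki) // scaler0.
rewrite /dim_at /subdim_at gT limg_line dim_vline idem_actE eg g0 //.
Qed.

Lemma onedim_simple N i : onedim N i -> simple N.
Proof.
case=> g [g0 _ _ gT]; split; first by rewrite gT => /eqP; rewrite -dimv_eq0 dim_vline g0.
move=> U; have [gU|gU] := boolP (g \in (U : {vspace N})).
  by right; apply: sm_eq; rewrite ?subvf //= gT -memvE.
left; apply: sm_eq; rewrite ?sub0v //; apply/subvP => v vU.
have : v \in <[g]>%VS by rewrite -gT memvf.
case/vlineP=> c vc; rewrite memv0 vc scaler_eq0.
have [//|c0] := eqVneq c 0; case/negP: gU.
by rewrite -[g](scalerK c0) -vc memvZ.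
Qed.

Lemma onedim_act N i (g : N) a : mact (e i) g = g ->
  (forall a, arrow_rad a -> mact a g = 0) -> forall c, arrow_rad (e i * a * e i - c *: e i) ->
  mact a g = c *: g.
Proof.
move=> eg jg c jc.
rewrite -{1}(act_videm_sum (mact a g)) (bigD1 i) //= big1 ?addr0 => [|k ki].
  rewrite -{1}eg -!mactM.
  by rewrite -[_ * _](subrK (c *: e i)) mactDl jg // add0r mactZl eg.
by rewrite -{1}eg -!mactM jg //; apply: corner_arrow_rad.
Qed.

Lemma onedim_iso N N' i : onedim N i -> onedim N' i -> isomorphic N N'.
Proof.
case=> g [g0 eg jg gT] [g' [g0' eg' jg' gT']].
have fr : basis_of fullv [tuple of [:: g]] by rewrite gT; apply: seq1_basis.
pose f0 (v : N) : N' := coord [tuple of [:: g]] ord0 v *: g'.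
have f0l : linear f0 by move=> c x y; rewrite /f0 linearP scalerDl scalerA.
pose f := hom_of f0l.
have fE c : f (c *: g) = c *: g'.
  rewrite linearZ /= hom_ofE /f0; congr (_ *: _); rewrite -[RHS]scale1r; congr (_ *: _).
  by have := coord_free ord0 ord0 (basis_free fr); rewrite /= => ->.
have vE (v : N) : exists c, v = c *: g.
  by apply/vlineP; rewrite -gT memvf.
exists f; split.
- move=> a v; have [c ->] := vE v; have [d jd] := corner_local i a.
  rewrite linearZ /= (onedim_act eg jg jd) fE scalerA fE.
  by rewrite linearZ /= (onedim_act eg' jg' jd) scalerA.
- apply/eqP/lker0P => x y; have [c ->] := vE x; have [d ->] := vE y.
  rewrite !fE => /eqP; rewrite -subr_eq0 -scalerBl scaler_eq0 (negPf g0') orbF.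
  by rewrite subr_eq0 => /eqP ->.
- apply/vspaceP => v; rewrite memvf.
  have : v \in <[g']>%VS by rewrite -gT' memvf.
  by case/vlineP=> c ->; rewrite -fE memv_img // memvf.
Qed.

(* Act on a vector outside [U] by a path of maximal length that does not send
   it into [U]. *)
Lemma simple_ext M (U : submodule M) : U <> sm_full M ->
  exists (U' : submodule M) i v, [/\ v \notin (U : {vspace M}), mact (e i) v = v,
    forall a, arrow_rad a -> mact a v \in (U : {vspace M})
    & U' = (U + <[v]>)%VS :> {vspace M}].
Proof.
move=> UT; have [w wU] : exists w, w \notin (U : {vspace M}).
  apply: contrapT => h; apply: UT; apply: sm_eq; rewrite ?subvf //.
  by apply/subvP => w _; apply/negPn/negP => wU; apply: h; exists w.
have [m hm] := path_image_long0 A.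
pose P n := `[< exists2 p : qpath Q, plen p = n & mact (path_image A p) w \notin (U : {vspace M}) >].
have exP : exists n, P n.
  exists 0%N; apply/asboolP; apply: contrapT => h; case/negP: wU.
  rewrite -(act_videm_sum w); apply: memv_suml => i _; apply/negPn/negP => wU.
  by apply: h; exists (trivial_path Q i).
have ubP n : P n -> (n <= m)%N.
  case/asboolP=> p <- h; rewrite leqNgt; apply: contraNN h => h.
  by rewrite hm 1?ltnW // mact0l mem0v.
case: (ex_maxnP exP ubP) => n /asboolP[p pn pU] nmax.
pose v := mact (path_image A p) w; pose i := pend p.
have ev : mact (e i) v = v by rewrite -mactM videm_path_image eqxx scale1r.
have qv q : (0 < plen q)%N -> mact (path_image A q) v \in (U : {vspace M}).
  move=> q0; rewrite -mactM; case: (pselect (pend p = pstart q)) => [h|h]; last first.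
    by rewrite path_imageM0 // mact0l mem0v.
  rewrite -(path_image_concat _ h); apply/negPn/negP => h'.
  have : P (plen (concat h)) by apply/asboolP; exists (concat h).
  by move/nmax; rewrite /plen /parrows /= size_cat -/(plen p) pn leqNgt -addn1 leq_add2l q0.
have jv a : arrow_rad a -> mact a v \in (U : {vspace M}).
  case=> u lu ->; rewrite [u]kq_sum rmorph_sum mact_suml big_seq; apply: memv_suml => q.
  by move/(min_length_supp lu) => q0; rewrite bqa_projZ mactZl memvZ // qv.
have cl a u : u \in (U + <[v]>)%VS -> mact a u \in (U + <[v]>)%VS.
  case/memv_addP => u1 u1U [_ /vlineP[c ->] ->]; rewrite linearD linearZ /=.
  rewrite memvD //; first by apply: (subvP (addvSl _ _)); apply: smP.
  rewrite memvZ //; move: a; apply: alg_ind => [|d q a IH]; first by rewrite mact0l mem0v.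
  rewrite mactDl mactZl memvD // memvZ //; have [h|h] := posnP (plen q); last first.
    by apply: (subvP (addvSl _ _)); apply: qv.
  have -> : path_image A q = e (pstart q) by rewrite videmE; congr path_image; apply: qpath_eq => //; exact: size0nil.
  have [->|ne] := eqVneq (pstart q) i; last by rewrite (act_videm0 ne) // mem0v.
  by rewrite ev; apply: (subvP (addvSr _ _)); apply: memv_line.
by exists (mk_submodule cl), i, v.
Qed.

Lemma onedim_ext M (U U' : submodule M) i v :
  v \notin (U : {vspace M}) -> mact (e i) v = v ->
  (forall a, arrow_rad a -> mact a v \in (U : {vspace M})) ->
  U' = (U + <[v]>)%VS :> {vspace M} -> onedim (subquotient U U') i.
Proof.
move=> vU ev jv UE.
have vU' : v \in (U' : {vspace M}) by rewrite UE; apply: (subvP (addvSr _ _)); apply: memv_line.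
pose x : sm_module U' := Subvs vU'.
exists (quo_pi (sm_inside U' U) x); split.
- by rewrite quo_pi_eq0 mem_inside.
- by rewrite -quo_act; congr quo_pi; apply: val_inj.
- by move=> a ja; rewrite -quo_act; apply/eqP; rewrite quo_pi_eq0 mem_inside val_act jv.
- apply/vspaceP => y; rewrite memvf; apply/esym/vlineP.
  have := subvsP (vsval y : sm_module U'); rewrite {2}UE.
  case/memv_addP => u uU [_ /vlineP[c ->] yE]; exists c.
  have /eqP : quo_pi (sm_inside U' U) (vsval y - c *: x) == 0.
    by rewrite quo_pi_eq0 mem_inside linearB linearZ /= yE /x /= scalerN addrK.
  rewrite linearB linearZ /= quo_piK => /eqP; rewrite subr_eq0 => /eqP ->.
  by [].
Qed.

(** Extending the zero submodule by one vector as in [simple_ext] already fills a simple module. *)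
Lemma simple_onedim N : simple N -> exists i, onedim N i.
Proof.
case=> N0 hN; have [|U' [i [v [v0 ev jv UE]]]] := @simple_ext N (sm_zero N).
  by move=> h; apply: N0; rewrite -[RHS]/(sm_vspace (sm_zero N)) h.
move: UE jv v0; rewrite /= add0v memv0 => UE jv v0.
exists i, v; split=> //; first by move=> a /jv; rewrite memv0 => /eqP.
have vU' : v \in (U' : {vspace N}) by rewrite UE memv_line.
have [h|h] := hN U'; last by rewrite -UE h.
by move: v0; rewrite -memv0; move: vU'; rewrite h /= => ->.
Qed.

Lemma comp_series M (U : submodule M) : exists s : seq (submodule M),
  [/\ path (fun U V : submodule M => (U <= V)%VS) U s, last U s = sm_full M
    & all (fun N => `[< simple N >]) (pairmap (@subquotient K A M) U s)].
Proof.
have [n] := ubnP (\dim (fullv : {vspace M}) - \dim U); elim: n U => // n IH U dU.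
case: (pselect (U = sm_full M)) => [->|UT]; first by exists [::].
have [U' [i [v [vU ev jv UE]]]] := simple_ext UT.
have sUU' : (U <= U')%VS by rewrite UE addvSl.
have [|s [pa la al]] := IH U'.
  rewrite -ltnS; apply: leq_trans dU; rewrite ltnS ltn_sub2l //.
    rewrite ltn_neqAle dimvS ?subvf // andbT; apply/eqP => h; apply: UT; apply: sm_eq; rewrite ?subvf //.
    by have /eqP -> : (U : {vspace M}) == fullv by rewrite eqEdim subvf h leqnn.
  rewrite ltn_neqAle dimvS // andbT; apply/eqP => h; case/negP: vU.
  have -> : (U : {vspace M}) = U' by apply/eqP; rewrite eqEdim sUU' h leqnn.
  by rewrite UE; apply: (subvP (addvSr _ _)); apply: memv_line.
exists (U' :: s); split=> //=; first by rewrite sUU'.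
by rewrite al andbT; apply/asboolP/(@onedim_simple _ i)/(onedim_ext vU ev jv UE).
Qed.

End Idempotents.

(** * Projective indecomposables and Jordan-Hölder multiplicities *)

Section Projectives.
Variables (K : fieldType) (Q0 : finType) (Q : quiver Q0).
Variable A : boundQuiverAlgebra K Q.
Local Notation module := (module A).
Local Notation e := (@videm K Q0 Q A).
Local Notation P := (projective A).
Implicit Types (M N : module) (i j k : Q0) (a b : A).

Definition pval i (x : P i) : A := vsval x.

Lemma pval_linear i : linear (@pval i).
Proof. by []. Qed.

HB.instance Definition _ i :=
  GRing.isSemilinear.Build K (P i) A _ (@pval i)
    (GRing.semilinear_linear (@pval_linear i)).

Lemma pvalB i (x y : P i) : pval (x - y) = pval x - pval y.
Proof. by []. Qed.

Lemma pval_inj i : injective (@pval i).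
Proof. exact: val_inj. Qed.

Lemma pval_act i a (x : P i) : pval (mact a x) = a * pval x.
Proof. by []. Qed.

Lemma pval_e i (x : P i) : pval x * e i = pval x.
Proof.
have /memv_imgP[y _ yE] := subvsP x; rewrite /pval yE lfunE /=.
by rewrite -mulrA videm_idem.
Qed.

Lemma pgen_in i : e i \in limg (amulr (e i)).
Proof. by apply/memv_imgP; exists (e i); rewrite ?memvf // lfunE /= videm_idem. Qed.

Definition pgen i : P i := Subvs (pgen_in i).

Lemma pval_gen i : pval (pgen i) = e i. Proof. by []. Qed.

Lemma pvalK i (x : P i) : mact (pval x) (pgen i) = x.
Proof. by apply: pval_inj; rewrite pval_act pval_gen pval_e. Qed.

Lemma pgenE i : mact (e i) (pgen i) = pgen i.
Proof. by apply: pval_inj; rewrite pval_act pval_gen videm_idem. Qed.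

Lemma right_corner i a : exists c, arrow_rad (a * e i - c *: e i).
Proof.
have [c jc] := corner_local i a; exists c.
have -> : a * e i = \sum_k e k * a * e i by rewrite -!mulr_suml videm_sum mul1r.
rewrite (bigD1 i) //= addrAC; apply: arrow_radD => //.
apply: (big_ind (@arrow_rad _ _ _ A)); [exact: arrow_rad0 | exact: arrow_radD |].
by move=> k ki; apply: corner_arrow_rad.
Qed.

(** Modulo the radical [x] is a nonzero multiple of $e_i$, so $e_ix$ has a left inverse in the local
    ring $e_iAe_i$. *)
Lemma gen_of_notarrow_rad i (x : P i) : ~ arrow_rad (pval x) -> exists a, mact a x = pgen i.
Proof.
move=> nj; have [c jc] := right_corner i (pval x).
have c0 : c != 0 by apply/eqP => h; apply: nj; move: jc; rewrite h scale0r subr0 pval_e.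
have [||y yE] := @corner_inv _ _ _ A i (e i * pval x * e i) c c0.
- by rewrite -!mulrA videm_idem !mulrA videm_idem.
- have := arrow_radMl (e i) jc; rewrite mulrBr -scalerAr videm_idem mulrA.
  by [].
exists (y * e i); apply: pval_inj; rewrite pval_act pval_gen.
by rewrite -[RHS]yE -!mulrA pval_e.
Qed.

(** A proper submodule contains no generator, so it lies in the image of the arrow ideal; this image
    is therefore the only maximal submodule. *)
Lemma radP i (x : P i) : x \in (rad (P i) : {vspace _}) <-> arrow_rad (pval x).
Proof.
have [||R RP] := @vspace_of_set _ (P i) (fun x => arrow_rad (pval x)).
- by rewrite linear0; exact: arrow_rad0.
- by move=> c y z hy hz; rewrite linearP; apply: arrow_radD => //; apply: arrow_radZ.
have cl a y : y \in R -> mact a y \in R.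
  by move/RP => h; apply/RP; rewrite pval_act; apply: arrow_radMl.
pose RR := mk_submodule cl.
have prop (U : submodule (P i)) : U <> sm_full _ -> (U <= RR)%VS.
  move=> UT; apply/subvP => y yU; apply/RP; apply: contrapT => /gen_of_notarrow_rad[a aE].
  apply: UT; apply: sm_eq; rewrite ?subvf //; apply/subvP => z _.
  by rewrite -(pvalK z) smP // -aE smP.
have RT : RR <> sm_full _.
  move=> h; have : pgen i \in (RR : {vspace _}) by rewrite h memvf.
  move/RP; rewrite pval_gen -[e i]scale1r => /videm_notin_arrow_rad /eqP.
  by rewrite oner_eq0.
have Rmax : maximal_submodule RR.
  split=> // W RW; case: (pselect (W = sm_full _)) => [|WT]; first by right.
  by left; apply: sm_eq => //; apply: prop.
split=> [/sm_bigcapP h|h]; first by apply/RP; apply: (h RR).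
apply/sm_bigcapP => U [UT Umax]; have UR := prop _ UT.
by have [<-|/RT[]] := Umax _ UR; apply/RP.
Qed.

Lemma simple_at_onedim i : onedim (simple_at A i) i.
Proof.
exists (quo_pi (rad (P i)) (pgen i)); split.
- rewrite quo_pi_eq0; apply/negP => /radP; rewrite pval_gen -[e i]scale1r.
  by move=> /videm_notin_arrow_rad /eqP; rewrite oner_eq0.
- by rewrite -quo_act pgenE.
- move=> a ja; rewrite -quo_act; apply/eqP; rewrite quo_pi_eq0; apply/radP.
  by rewrite pval_act; apply: arrow_radMr.
- apply/vspaceP => y; rewrite memvf; apply/esym/vlineP.
  have [c jc] := right_corner i (pval (vsval y)); exists c.
  have /eqP : quo_pi (rad (P i)) (vsval y - c *: pgen i) == 0.
    rewrite quo_pi_eq0; apply/radP.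
    suff -> : pval (vsval y - c *: pgen i) = pval (vsval y) * e i - c *: e i by [].
    by rewrite pval_e.
  by rewrite linearB linearZ /= quo_piK => /eqP; rewrite subr_eq0 => /eqP ->.
Qed.

Lemma dim_at_simple i k : dim_at (simple_at A i) k = (k == i).
Proof. exact/onedim_dim_at/simple_at_onedim. Qed.

(* Isomorphism types are told apart by their dimension vectors. *)
Lemma factor_count_chain (T : eqType) (D : T -> module) M s lb (j : T) :
  (forall l l', (forall k, dim_at (D l) k = dim_at (D l') k) -> l = l') ->
  chain D (sm_zero M) s lb -> factor_count s (D j) = count_mem j lb.
Proof.
move=> hD /chainP[_]; rewrite /factor_count /factors.
elim: (pairmap _ _ _) lb => [|L t IH] [|l lb] //= /andP[/asboolP il /IH ->].
congr (_ + _)%N; congr nat_of_bool; apply/asboolP/eqP => [ij|<- //].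
by apply: hD => k; rewrite -(iso_dim_at k il) (iso_dim_at k ij).
Qed.

Lemma chain_dim_at (T : Type) (D : T -> module) M s lb k :
  last (sm_zero M) s = sm_full M -> chain D (sm_zero M) s lb ->
  dim_at M k = (\sum_(l <- lb) dim_at (D l) k)%N.
Proof. by move=> la /(chain_subdim k); rewrite la /= subdim_at0. Qed.

(** Every composition factor is a line at one vertex, so the factors isomorphic to [simple_at A j]
    add up to $\dim e_jM$. The count is the same for all composition series, and the choice made by
    [xget] is harmless. *)
Lemma jh_multE M j : jh_mult M (simple_at A j) = dim_at M j.
Proof.
have [s [pa la al]] := comp_series (sm_zero M).
rewrite /jh_mult; case: xgetP => [m _ [s' [pa' la' al']] <-|/(_ (factor_count s (simple_at A j))) []];
  last by exists s.
have [|lb hlb] := chain_exists (D := simple_at A) _ pa' al'.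
  by move=> N /simple_onedim[i hi]; exists i; apply: onedim_iso hi (simple_at_onedim i).
rewrite (factor_count_chain _ _ hlb); last first.
  by move=> l l' /(_ l); rewrite !dim_at_simple eqxx; case: eqP.
rewrite (chain_dim_at j la' hlb) -sum1_count [RHS](eq_bigr (fun l => nat_of_bool (pred1 j l))).
  by rewrite big_mkcond.
by move=> l _; rewrite dim_at_simple eq_sym.
Qed.

End Projectives.

Lemma count_gt (d : Order.disp_t) (T : finPOrderType d) (l : T) lb :
  count (fun x => l < x)%O lb = (\sum_(m : T | (l < m)%O) count_mem m lb)%N.
Proof.
elim: lb => [|x lb IH] /=; first by rewrite big1.
rewrite big_split /= -IH; congr (_ + _)%N.
rewrite big_mkcond (bigD1 x) //= eqxx big1 ?addn0 => [|m mx]; first by case: ifP.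
by rewrite eq_sym (negPf mx); case: ifP.
Qed.

Lemma count_ge (d : Order.disp_t) (T : finPOrderType d) (l : T) lb :
  count (fun x => l <= x)%O lb = (count_mem l lb + count (fun x => l < x)%O lb)%N.
Proof.
rewrite -[in RHS]count_predUI [X in (_ + X)%N](eq_count (a2 := pred0)).
  rewrite count_pred0 addn0; apply: eq_count => x /=.
  by rewrite le_eqVlt eq_sym.
move=> x /=; apply/negP => /andP[/eqP ->]; by rewrite ltxx.
Qed.

(** Triangular inversion, descending from the maximal elements: once the labels above [l] are known,
    the count at [l] leaves the multiplicity of [l]. Thus a dimension vector determines the
    multiplicities of standard factors. *)
Lemma count_ge_inj (d : Order.disp_t) (T : finPOrderType d) (lb lb' : seq T) :
  (forall l, count (fun x => l <= x)%O lb = count (fun x => l <= x)%O lb') ->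
  forall l, count_mem l lb = count_mem l lb'.
Proof.
move=> h l; have [n] := ubnP #|[pred m : T | (l < m)%O]|; elim: n l => // n IH l ln.
have E : count (fun x => l < x)%O lb = count (fun x => l < x)%O lb'.
  rewrite !count_gt; apply: eq_bigr => m lm; apply: IH.
  rewrite -ltnS; apply: leq_trans ln; rewrite ltnS; apply: proper_card; apply/properP; split.
    by apply/fintype.subsetP => x; rewrite !inE; apply: lt_trans.
  by exists m; rewrite !inE ?ltxx.
by have := h l; rewrite !count_ge E => /addIn.
Qed.

(** * Standard modules *)

Section Standard.
Variables (K : fieldType) (d : Order.disp_t) (Q0 : finPOrderType d).
Variables (Q : quiver Q0) (A : boundQuiverAlgebra K Q).
Local Notation module := (module A).
Local Notation e := (@videm K Q0 Q A).
Local Notation P := (projective A).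
Local Notation D := (@standard K d Q0 Q A).
Implicit Types (M N : module) (i j k l : Q0) (a b : A).

Lemma supported_belowP i M :
  supported_below i M <-> forall k (v : M), ~~ (k <= i)%O -> mact (e k) v = 0.
Proof.
split=> [h k v ki|h k ki]; first by have := h k ki; rewrite jh_multE => /dim_at_eq0; apply.
by rewrite jh_multE; apply/dim_at_eq0 => v; apply: h.
Qed.

Lemma supported_quotient i M (W : submodule M) : supported_below i (quotient W) <->
  forall k (v : M), ~~ (k <= i)%O -> mact (e k) v \in (W : {vspace M}).
Proof.
rewrite supported_belowP; split=> [h k v ki|h k v ki].
  by rewrite -quo_pi_eq0 quo_act h.
by rewrite -(quo_piK v) -quo_act; apply/eqP; rewrite quo_pi_eq0 h.
Qed.

Lemma standardP i : exists U : submodule (P i), [/\ D i = quotient U,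
  forall k x, ~~ (k <= i)%O -> mact (e k) x \in (U : {vspace _}) &
  forall W : submodule (P i), (forall k x, ~~ (k <= i)%O -> mact (e k) x \in (W : {vspace _})) ->
    (U <= W)%VS].
Proof.
rewrite /standard; set X := (X in xget _ X); exists (xget (sm_full (P i)) X).
have [U|no] := xgetP.
  move=> _ [/supported_quotient hU min]; split=> // W hW.
  by apply: min; apply/supported_quotient.
exfalso; pose Y := ([set W | supported_below i (quotient W)] : classical_sets.set (submodule (P i)))%classic.
apply: (no (sm_bigcap Y)); split.
  apply/supported_quotient => k v ki; apply/sm_bigcapP => W /supported_quotient; exact.
by move=> W hW; apply/subvP => x /sm_bigcapP; apply.
Qed.

(** The vector [g'] defines a map from $P(i)$ to [N], and the support of [N] forces the least
    submodule in the definition of $\Delta(i)$ into its kernel. *)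
Lemma standard_univ i : exists g : D i, [/\ mact (e i) g = g,
   forall v, exists a, v = mact a g,
   forall k (v : D i), ~~ (k <= i)%O -> mact (e k) v = 0 &
   forall N (g' : N), mact (e i) g' = g' ->
     (forall k (v : N), ~~ (k <= i)%O -> mact (e k) v = 0) ->
     exists2 f : 'Hom(D i, N), is_hom f & f g = g'].
Proof.
have [U [-> hU min]] := standardP i.
exists (quo_pi U (pgen A i)); split.
- by rewrite -quo_act pgenE.
- by move=> v; exists (pval (vsval v)); rewrite -quo_act pvalK quo_piK.
- by move=> k v ki; rewrite -(quo_piK v) -quo_act; apply/eqP; rewrite quo_pi_eq0 hU.
move=> N g' eg' hN.
have phl : linear (fun x : P i => mact (pval x) g').
  by move=> c x y; rewrite linearP mactDl mactZl.
pose ph := hom_of phl.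
have phE x : ph x = mact (pval x) g' by rewrite hom_ofE.
have cl a x : x \in lker ph -> mact a x \in lker ph.
  by rewrite !memv_ker !phE pval_act mactM => /eqP ->; rewrite linear0.
have UK : (U <= lker ph)%VS.
  apply: (min (mk_submodule cl)) => k x ki; rewrite memv_ker phE pval_act mactM.
  by rewrite hN.
have fl : linear (fun v : quotient U => ph (vsval v)) by move=> c x y; rewrite !linearP.
pose f := hom_of fl.
have fE x : f (quo_pi U x) = ph x.
  rewrite hom_ofE; apply/esym/eqP; rewrite -subr_eq0 -linearB -memv_ker.
  exact: (subvP UK _ (val_quo_pi U x)).
exists f; last by rewrite fE phE pval_gen.
by move=> a v; rewrite -(quo_piK v) -quo_act !fE !phE pval_act mactM.
Qed.

(** The universal map $\Delta(i)\to N$ is onto because [g'] generates [N]; the dimensions, compared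
    vertex by vertex, leave no room for a kernel. *)
Lemma standard_char i N (g' : N) : (forall k, (dim_at (D i) k <= dim_at N k)%N) ->
  mact (e i) g' = g' -> (forall v, exists a, v = mact a g') ->
  (forall k (v : N), ~~ (k <= i)%O -> mact (e k) v = 0) -> isomorphic N (D i).
Proof.
move=> hd eg' gN hN; have [g [eg gen z univ]] := standard_univ i.
have [f fh fg] := univ N g' eg' hN.
have fT : limg f = fullv.
  apply/vspaceP => v; rewrite memvf; have [a ->] := gN v.
  by rewrite -fg -fh memv_img ?memvf.
have fker : lker f = 0%VS.
  apply/eqP; rewrite -subv0; apply/subvP => v; rewrite memv_ker => /eqP fv.
  rewrite -(act_videm_sum v); apply: memv_suml => k _.
  have fk : (f @: limg (idem_act (D i) k) = limg (idem_act N k))%VS.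
    apply/vspaceP => w; apply/idP/idP.
      by case/memv_imgP=> u /mem_idem_actf eu ->; apply/mem_idem_actf; rewrite -fh eu.
    move/mem_idem_actf => ew; have : w \in limg f by rewrite fT memvf.
    case/memv_imgP => u _ wu; apply/memv_imgP; exists (mact (e k) u); last by rewrite fh -wu ew.
    by apply/mem_idem_actf; rewrite act_idem.
  have := limg_ker_dim f (limg (idem_act (D i) k)); rewrite fk => dE.
  have : \dim (limg (idem_act (D i) k) :&: lker f) == 0%N.
    by rewrite -leqn0 -(leq_add2r (\dim (limg (idem_act N k)))) dE add0n; apply: hd.
  rewrite dimv_eq0 => /eqP <-; rewrite memv_cap memv_ker fh fv linear0 eqxx andbT.
  by apply/mem_idem_actf; rewrite act_idem.
exists (f^-1)%VF; have f0 : lker f == 0%VS by rewrite fker.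
have finj : injective f by apply/lker0P.
have fi w : f ((f^-1)%VF w) = w by apply: limg_lfunVK; rewrite fT memvf.
split.
- by move=> a w; apply: finj; rewrite fh !fi.
- by apply/eqP/lker0P => x y h; rewrite -(fi x) h fi.
- apply/vspaceP => v; rewrite memvf; apply/memv_imgP; exists (f v); rewrite ?memvf //.
  by rewrite lker0_lfunK.
Qed.

Hypothesis hA : one_quasi_hereditary A.

Lemma dim_at_standard i k : dim_at (D i) k = (k <= i)%O.
Proof.
have [_ [bot [top_ [_ h _ _]]]] := hA.
have [ki|ki] := boolP (k <= i)%O; first by have [h1 _] := h i k ki; rewrite -jh_multE.
by apply/dim_at_eq0 => v; have [g [_ _ z _]] := standard_univ i; apply: z.
Qed.

Lemma standard_inj l l' : (forall k, dim_at (D l) k = dim_at (D l') k) -> l = l'.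
Proof.
move=> h; apply/eqP; rewrite eq_le.
have := etrans (esym (dim_at_standard l l')) (etrans (h l') (dim_at_standard l' l')).
have := etrans (esym (dim_at_standard l l)) (etrans (h l) (dim_at_standard l' l)).
rewrite (lexx l) (lexx l').
by case: (l <= l')%O; case: (l' <= l)%O.
Qed.

Lemma good_chain M (s : seq (submodule M)) : good_filtration s <->
  exists lb, [/\ chain D (sm_zero M) s lb & last (sm_zero M) s = sm_full M].
Proof.
split=> [[pa la al]|[lb [/chainP[pa al] la]]].
  by have [|lb hlb] := chain_exists (D := D) _ pa al; [|exists lb].
split=> //; rewrite /factors; elim: (pairmap _ _ _) lb al => [|L t IH] [|l lb] //=.
by case/andP=> /asboolP hl /IH ->; rewrite andbT; apply/asboolP; exists l.
Qed.

Lemma chain_count M (s : seq (submodule M)) lb k :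
  last (sm_zero M) s = sm_full M -> chain D (sm_zero M) s lb ->
  dim_at M k = count (fun l => k <= l)%O lb.
Proof.
move=> la /(chain_dim_at k la) ->; rewrite -sum1_count [RHS]big_mkcond.
by apply: eq_bigr => l _; rewrite dim_at_standard; case: (k <= l)%O.
Qed.

Lemma good_projective j : exists s, good_filtration (s : seq (submodule (P j))).
Proof. by have [qh _] := hA; have [_ h _ _] := qh j j. Qed.

(** All good filtrations of $P(j)$ have the same label multiplicities, by [count_ge_inj]; for the
    filtration picked by [good_mult] the axioms say that they are 1 or 0. *)
Lemma chain_labels j (s : seq (submodule (P j))) lb :
  last (sm_zero _) s = sm_full _ -> chain D (sm_zero _) s lb ->
  uniq lb /\ lb =i [pred l | (j <= l)%O].
Proof.
move=> la ch.
have cnt l : count_mem l lb = (j <= l)%O.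
  have := good_projective j; rewrite /good_mult => -[s0 hs0].
  have : good_mult (P j) l = (j <= l)%O.
    have [qh [bot [top_ [_ h _ _]]]] := hA.
    have [jl|jl] := boolP (j <= l)%O; first by have [_ ->] := h l j jl.
    by have [_ _ ->] := qh j l.
  rewrite /good_mult; case: xgetP => [m _ [s' hs' <-] <-|/(_ (factor_count s0 (D l))) []]; last by exists s0.
  have /good_chain[lb' [ch' la']] := hs'.
  rewrite (factor_count_chain l standard_inj ch'); apply: count_ge_inj => k.
  by rewrite -(chain_count k la ch) -(chain_count k la' ch').
split; last by move=> l; rewrite !inE -has_pred1 has_count cnt lt0b.
by apply: count_mem_uniq => l; rewrite cnt -has_pred1 has_count cnt; case: (j <= l)%O.
Qed.

Lemma dim_at_projective j k : dim_at (P j) k = #|[pred l : Q0 | (j <= l)%O && (k <= l)%O]|.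
Proof.
have [s /good_chain[lb [ch la]]] := good_projective j.
have [un mem] := chain_labels la ch.
rewrite (chain_count k la ch) cardE -size_filter; apply: perm_size; apply: uniq_perm.
- exact: filter_uniq.
- exact: enum_uniq.
by move=> l; rewrite mem_filter mem_enum !inE mem inE andbC.
Qed.

End Standard.

Lemma span_le1 (K : fieldType) (V : vectType K) (B : seq V) (T : {vspace V}) a x :
  (size B <= 1)%N -> a \in (<<B>> + T)%VS -> x \in (<<B>> + T)%VS -> a \notin T ->
  exists c, x - c *: a \in T.
Proof.
case: B => [|b [|//]] _; first by rewrite span_nil add0v => ->.
rewrite span_seq1 => /memv_addP[_ /vlineP[c ->] [t tT ->]].
move=> /memv_addP[_ /vlineP[c' ->] [t' tT' ->]] aT.
have c0 : c != 0 by apply: contraNneq aT => ->; rewrite scale0r add0r.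
exists (c' / c); rewrite scalerDr scalerA divfK // opprD addrACA subrr add0r.
by rewrite memvB ?memvZ.
Qed.

(** * Corners of the algebra *)

Section Ideals.
Variables (K : fieldType) (Q0 : finType) (Q : quiver Q0).
Variable A : boundQuiverAlgebra K Q.
Local Notation e := (@videm K Q0 Q A).
Local Notation P := (projective A).
Implicit Types (i j k l : Q0) (a b x y : A) (F : pred Q0).

Lemma mulr_videmK k x : x * e k * e k = x * e k.
Proof. by rewrite -mulrA (videm_idem A k). Qed.

Lemma videm_mulK k x : e k * (e k * x) = e k * x.
Proof. by rewrite mulrA (videm_idem A k). Qed.

Definition vertex_ideal F : {vspace A} := (\sum_(l | F l) (fullv * <[e l]> * fullv))%VS.

Lemma vertex_ideal_gen F l a b : F l -> a * e l * b \in vertex_ideal F.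
Proof.
move=> Fl; apply: (subvP (sumv_sup l Fl (subvv _))).
by rewrite !memv_mul ?memvf // memv_line.
Qed.

Lemma vertex_ideal_sub F (U : {vspace A}) :
  (forall l a b, F l -> a * e l * b \in U) -> (vertex_ideal F <= U)%VS.
Proof.
move=> h; apply/subv_sumP => l Fl; apply/prodvP => u v uU _.
have : u \in (lfun_preim (amulr v) U)%VS; last by rewrite -memv_preim lfunE.
apply: (subvP _ _ uU); apply/prodvP => a _ _ /vlineP[c ->].
by rewrite -memv_preim lfunE /= -scalerAr -scalerAl memvZ // h.
Qed.

Lemma vertex_ideal_mull F a x : x \in vertex_ideal F -> a * x \in vertex_ideal F.
Proof.
move=> xF; have : x \in (lfun_preim (amull a) (vertex_ideal F))%VS; last by rewrite -memv_preim lfunE.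
apply: (subvP _ _ xF); apply: vertex_ideal_sub => l u v Fl; rewrite -memv_preim lfunE /= !mulrA.
exact: vertex_ideal_gen.
Qed.

Lemma vertex_ideal_mulr F a x : x \in vertex_ideal F -> x * a \in vertex_ideal F.
Proof.
move=> xF; have : x \in (lfun_preim (amulr a) (vertex_ideal F))%VS; last by rewrite -memv_preim lfunE.
apply: (subvP _ _ xF); apply: vertex_ideal_sub => l u v Fl; rewrite -memv_preim lfunE /= -!mulrA mulrA.
exact: vertex_ideal_gen.
Qed.

Lemma vertex_idealS F F' : (forall l, F l -> F' l) -> (vertex_ideal F <= vertex_ideal F')%VS.
Proof. by move=> h; apply: vertex_ideal_sub => l a b /h; apply: vertex_ideal_gen. Qed.

Lemma vertex_ideal_e F l : F l -> e l \in vertex_ideal F.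
Proof. by move=> Fl; rewrite -[e l]mul1r -[1 * _]mulr1; apply: vertex_ideal_gen. Qed.

Definition pvalf i : 'Hom(P i, A) := linfun (@pval K Q0 Q A i).

Lemma pvalfE i (x : P i) : pvalf i x = pval x. Proof. by rewrite lfunE. Qed.

Lemma vertex_submodule_cl F i b (x : P i) :
  x \in (pvalf i @^-1: vertex_ideal F)%VS -> mact b x \in (pvalf i @^-1: vertex_ideal F)%VS.
Proof. by rewrite -!memv_preim !pvalfE pval_act; apply: vertex_ideal_mull. Qed.

(** With [J] the ideal at [F], $J\cap Ae_i=Je_i$; so this is the trace in $P(i)$ of the projectives
    $P(l)$ with [F l]. *)
Definition vertex_submodule F i : submodule (P i) := mk_submodule (@vertex_submodule_cl F i).

Lemma mem_vertex_submodule F i (x : P i) : (x \in (vertex_submodule F i : {vspace _})) = (pval x \in vertex_ideal F).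
Proof. by rewrite -memv_preim pvalfE. Qed.

Definition corner k j : {vspace A} := limg (amulr (e j) \o amull (e k))%VF.

Lemma cornerP k j x : x \in corner k j <-> e k * x = x /\ x * e j = x.
Proof.
split=> [/memv_imgP[y _ ->]|[h1 h2]].
  rewrite comp_lfunE !lfunE /=; split; last by rewrite mulr_videmK.
  by rewrite -!mulrA videm_mulK.
by apply/memv_imgP; exists x; rewrite ?memvf // comp_lfunE !lfunE /= h1 h2.
Qed.

Lemma corner_l0 k k' j x : x \in corner k j -> k' != k -> e k' * x = 0.
Proof. by move=> /cornerP[<- _] kk; rewrite mulrA (videmM0 A kk) mul0r. Qed.

Lemma corner_r0 k j j' x : x \in corner k j -> j != j' -> x * e j' = 0.
Proof. by move=> /cornerP[_ <-] jj; rewrite -mulrA (videmM0 A jj) mulr0. Qed.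

Lemma corner_proj k j x : e k * x * e j \in corner k j.
Proof. by apply/cornerP; rewrite mulr_videmK -!mulrA videm_mulK. Qed.

Lemma corner_split k l j x y : e k * (x * e l * y) * e j = (e k * x * e l) * (e l * y * e j).
Proof. by rewrite -!mulrA videm_mulK. Qed.

Lemma cornerM k l j x y : x \in corner k l -> y \in corner l j -> x * y \in corner k j.
Proof.
by move=> /cornerP[h1 h2] /cornerP[h3 h4]; apply/cornerP; rewrite mulrA h1 -mulrA h4.
Qed.

Lemma corner_e k : e k \in corner k k.
Proof. by apply/cornerP; rewrite (videm_idem A k). Qed.

Lemma corner_path_image (p : qpath Q) : path_image A p \in corner (pend p) (pstart p).
Proof. by apply/cornerP; split; [exact: pend_path_image | exact: path_image_pstart]. Qed.

Lemma dim_corner k j : \dim (corner k j) = dim_at (P j) k.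
Proof.
have inj : lker (pvalf j) == 0%VS by apply/lker0P => x y; rewrite !pvalfE; apply: pval_inj.
rewrite /dim_at /subdim_at -[RHS](limg_dim_eq (f := pvalf j)); last by rewrite (eqP inj) capv0.
congr (\dim _); apply/vspaceP => x; apply/idP/idP.
  move/cornerP => [h1 h2]; apply/memv_imgP; exists (mact x (pgen A j)).
    by apply/mem_idem_actf; rewrite -mactM h1.
  by rewrite pvalfE pval_act pval_gen.
case/memv_imgP => y /mem_idem_actf ey ->; apply/cornerP.
by rewrite pvalfE pval_e -{2}ey pval_act.
Qed.

Section Spanning.
Variables (r : rel Q0) (r_trans : transitive r) (r_refl : reflexive r).
Hypothesis r_anti : antisymmetric r.
Let gt l : pred Q0 := fun t => r l t && (t != l).
Variables (j : Q0) (a : Q0 -> Q0 -> A) (b : Q0 -> A).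
Hypothesis a_corner : forall k t, a k t \in corner k t.
Hypothesis b_corner : forall t, b t \in corner t j.
Hypothesis a_span : forall k t x, x \in corner k t -> x \in (<[a k t]> + vertex_ideal (gt t))%VS.
Hypothesis b_span : forall t y, y \in corner t j -> y \in (<[b t]> + vertex_ideal (gt t))%VS.

Definition cellspan k l : {vspace A} := (\sum_(t | r l t) <[a k t * b t]>)%VS.

(** Induction on the number of vertices strictly above [l]. Modulo the ideal at these vertices the
    product is a multiple of [a k l * b l]; an element of that ideal, cut down to the corner, is a
    sum of products through larger vertices. *)
Lemma cellspan_mul k l x y : x \in corner k l -> y \in corner l j -> x * y \in cellspan k l.
Proof.
have [n] := ubnP #|[pred t | gt l t]|; elim: n l x y => // n IH l x y ln xk yj.
have gtl z : z \in vertex_ideal (gt l) -> e k * z * e j \in cellspan k l.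
  move=> zl; have : z \in ((amulr (e j) \o amull (e k)) @^-1: cellspan k l)%VS.
    apply: (subvP _ _ zl); apply: vertex_ideal_sub => m u v /andP[lm ml].
    rewrite -memv_preim comp_lfunE !lfunE /=.
    rewrite corner_split.
    have -> : (cellspan k l = cellspan k m + cellspan k l)%VS.
      apply/esym/addv_idPr/subv_sumP => t mt; apply: sumv_sup (subvv _).
      exact: r_trans mt.
    apply: (subvP (addvSl _ _)); apply: IH; try exact: corner_proj.
    rewrite -ltnS; apply: leq_trans ln; rewrite ltnS; apply: proper_card; apply/properP; split.
      apply/fintype.subsetP => t; rewrite !inE => /andP[mt tm]; rewrite /gt (r_trans lm mt) /=.
      apply: contraNneq tm => tl; apply/eqP; apply: r_anti; rewrite mt andbT.
      by rewrite tl.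
    by exists m; rewrite !inE /gt ?lm ?ml // eqxx andbF.
  by rewrite -memv_preim comp_lfunE !lfunE.
have /memv_addP[_ /vlineP[c ->] [x' x'T xE]] := a_span xk.
have /memv_addP[_ /vlineP[c' ->] [y' y'T yE]] := b_span yj.
(* The remainders [x'] and [y'] need not lie in a corner, so the error is cut down by $e_k$ and
   $e_j$; the other terms lie in the corner and are not affected. *)
have xyE : x * y = (c * c') *: (a k l * b l) + e k * (c *: a k l * y' + x' * y) * e j.
  have /cornerP[h1 h2] := a_corner k l; have /cornerP[h3 h4] := b_corner l.
  have /cornerP[g1 g2] := xk; have /cornerP[g3 g4] := yj.
  have -> : e k * (c *: a k l * y' + x' * y) * e j = e k * (x * y - (c * c') *: (a k l * b l)) * e j.
    congr (_ * _ * _); have -> : x * y = c *: a k l * y + x' * y by rewrite -mulrDl -xE.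
    rewrite addrAC; congr (_ + _).
    have -> : c *: a k l * y = c *: a k l * (c' *: b l) + c *: a k l * y' by rewrite -mulrDr -yE.
    by rewrite -!scalerAl -scalerAr scalerA addrAC subrr add0r.
  rewrite mulrBr mulrBl -scalerAr -scalerAl !mulrA h1 g1 -!mulrA h4 g4.
  by rewrite addrC subrK.
rewrite xyE memvD //.
  by rewrite memvZ // /cellspan; apply: (subvP (sumv_sup l (r_refl l) (subvv _))); apply: memv_line.
by apply: gtl; apply: memvD; [apply: vertex_ideal_mull | apply: vertex_ideal_mulr].
Qed.

(** Any [x] in the corner is the product $e_k\cdot x$ through the vertex [k]. *)
Lemma corner_cellspan k : (corner k j <= cellspan k k)%VS.
Proof.
apply/subvP => x xk; have /cornerP[ex _] := xk; have := cellspan_mul (corner_e k) xk.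
by rewrite [e k * x]ex.
Qed.

End Spanning.
End Ideals.

(** * Good filtrations of projectives, read off in the corners *)

Section Layers.
Variables (K : fieldType) (d : Order.disp_t) (Q0 : finPOrderType d).
Variables (Q : quiver Q0) (A : boundQuiverAlgebra K Q).
Hypothesis hA : one_quasi_hereditary A.
Local Notation module := (module A).
Local Notation e := (@videm K Q0 Q A).
Local Notation P := (projective A).
Local Notation D := (@standard K d Q0 Q A).
Implicit Types (M N : module) (i j k l t : Q0) (a b : A).

Lemma dim_at_le1 N k (x y : N) : (dim_at N k <= 1)%N -> mact (e k) x = x -> mact (e k) y = y ->
  x != 0 -> exists c, y = c *: x.
Proof.
move=> dN ex ey x0; apply/vlineP.
suff -> : <[x]>%VS = limg (idem_act N k) by apply/mem_idem_actf.
apply/eqP; rewrite eqEdim; apply/andP; split; first by rewrite -memvE; apply/mem_idem_actf.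
by rewrite dim_vline x0; apply: dN.
Qed.

Section OneLayer.
Variables (M : module) (W V : submodule M) (l : Q0).
Hypothesis lay : layer W V (D l).

Lemma layer_zero k v : v \in (V : {vspace M}) -> ~~ (k <= l)%O ->
  mact (e k) v \in (W : {vspace M}).
Proof.
move=> vV kl; have [phi [ph0 pha _]] := lay; rewrite -ph0 ?smP // pha //.
by have [g [_ _ z _]] := standard_univ A l; rewrite z.
Qed.

Lemma layer_vect k : (k <= l)%O ->
  exists v, [/\ v \in (V : {vspace M}), mact (e k) v = v & v \notin (W : {vspace M})].
Proof.
move=> kl; have [phi [ph0 pha phs]] := lay.
have : exists n : D l, mact (e k) n != 0.
  apply: contrapT => h; have := dim_at_standard hA l k; rewrite kl.
  have -> // : dim_at (D l) k = 0%N.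
  by apply/dim_at_eq0 => v; apply/eqP/negPn/negP => hv; apply: h; exists v.
case=> n n0; have [v vV vn] := phs n; exists (mact (e k) v).
by rewrite smP // act_idem -ph0 ?smP // pha // vn.
Qed.

Lemma layer_line k v v' : v \in (V : {vspace M}) -> v' \in (V : {vspace M}) ->
  mact (e k) v = v -> mact (e k) v' = v' -> v \notin (W : {vspace M}) ->
  exists c, v' - c *: v \in (W : {vspace M}).
Proof.
move=> vV vV' ev ev' vW; have [phi [ph0 pha phs]] := lay.
have [||||c cE] := @dim_at_le1 (D l) k (phi v) (phi v').
- by rewrite (dim_at_standard hA l k) leq_b1.
- by rewrite -pha // ev.
- by rewrite -pha // ev'.
- by rewrite ph0.
exists c; rewrite -ph0; last by rewrite memvB ?memvZ.
by rewrite linearB linearZ /= cE subrr.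
Qed.

(** The space $e_l\Delta(l)$ is a line, so the image of [u] is a nonzero multiple of the
    generator. *)
Lemma layer_gen u v : u \in (V : {vspace M}) -> mact (e l) u = u ->
  u \notin (W : {vspace M}) -> v \in (V : {vspace M}) ->
  exists a, v - mact a u \in (W : {vspace M}).
Proof.
move=> uV eu uW vV; have [phi [ph0 pha phs]] := lay.
have [g [eg gen _ _]] := standard_univ A l.
have [||||c cE] := @dim_at_le1 (D l) l (phi u) g.
- by rewrite (dim_at_standard hA l l) leq_b1.
- by rewrite -pha // eu.
- exact: eg.
- by rewrite ph0.
have [a aE] := gen (phi v); exists (c *: a); rewrite -ph0; last by rewrite memvB ?smP.
by rewrite linearB /= pha // aE cE mactZl linearZ /= subrr.
Qed.

End OneLayer.

(** The chain is climbed with [X] holding what has been collected. A label in [F] adds nothing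
    because its generator lies in [T]; a label not above [k] adds nothing because $e_k$ kills its
    layer; any other label adds one vector. *)
Lemma layer_span M (T U : submodule M) (F : pred Q0) k (W : submodule M) s lb
    (X : {vspace M}) :
  (forall l v, F l -> mact (e l) v \in (T : {vspace M})) -> (T <= X)%VS ->
  chain D W s lb ->
  (forall w, w \in (W : {vspace M}) -> mact (e k) w = w -> w \in X) ->
  exists B : seq M, (size B <= count (fun l => ~~ F l && (k <= l)%O) lb)%N /\
    forall v, v \in (last W s : {vspace M}) -> mact (e k) v = v -> v \in (<<B>> + X)%VS.
Proof.
move=> hF; elim: s W lb X => [|V s IH] W [|l lb] X TX //=.
  by move=> _ h; exists [::]; split=> // v vW ev; rewrite span_nil add0v h.
case=> WV lay ch hX.
have eW v u : v - u \in (W : {vspace M}) -> mact (e k) v = v -> v - mact (e k) u \in X.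
  move=> vu ev; rewrite -{1}ev -linearB; apply: hX; rewrite ?smP // act_idem //.
have [Fl|Fl] := boolP (F l).
  rewrite /=; apply: (IH V lb X TX ch) => v vV ev.
  have [g [gV eg gW]] := layer_vect lay (lexx l).
  have [a /eW /(_ ev) vX] := layer_gen lay gV eg gW vV.
  rewrite -[v](subrK (mact (e k) (mact a g))) memvD //.
  by apply: (subvP TX); apply: smP; apply: smP; rewrite -eg hF.
have [kl|kl] := boolP (k <= l)%O; last first.
  rewrite /=; apply: (IH V lb X TX ch) => v vV ev.
  by apply: hX => //; rewrite -ev (layer_zero lay).
have [g [gV eg gW]] := layer_vect lay kl.
have [||B [sB hB]] := IH V lb (<[g]> + X)%VS _ ch.
- exact: subv_trans TX (addvSr _ _).
- move=> v vV ev; have [c vX] := layer_line lay gV vV eg ev gW.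
  have := eW _ _ vX ev; rewrite linearZ /= eg => h.
  by rewrite -[v](subrK (c *: g)) addrC memv_add // memvZ // memv_line.
exists (rcons B g); rewrite size_rcons /= add1n ltnS; split=> // v vl ev.
by rewrite -cats1 span_cat span_seq1 -addvA hB.
Qed.

Definition above t : {vspace A} := vertex_ideal A (fun l => t < l)%O.

(* Only the labels [l >= j, k] not above [t] contribute a vector of [e_k P(j)]
   outside [above t]. *)
Lemma corner_span k j t : exists B : seq A,
  (size B <= #|[pred l | [&& (j <= l)%O, (k <= l)%O & ~~ (t < l)%O]]|)%N /\
  forall x, x \in corner A k j -> x \in (<<B>> + above t)%VS.
Proof.
have [s /good_chain[lb [ch la]]] := good_projective hA j.
have [un mem] := chain_labels hA la ch.
have [|||B [sB hB]] := @layer_span (P j) (vertex_submodule A (fun l => t < l)%O j) (sm_zero _)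
   (fun l => t < l)%O k (sm_zero _) s lb (vertex_submodule A (fun l => t < l)%O j) _ _ ch.
- by move=> l v tl; rewrite mem_vertex_submodule pval_act; apply: vertex_ideal_mulr; apply: vertex_ideal_e.
- exact: subvv.
- by move=> w; rewrite /= memv0 => /eqP ->; rewrite mem0v.
exists (map (@pval _ _ _ A j) B); split.
  rewrite size_map; apply: leq_trans sB _; rewrite cardE -size_filter; apply/eq_leq/perm_size.
  apply: uniq_perm; [exact: filter_uniq | exact: enum_uniq |] => l.
  by rewrite mem_filter mem_enum !inE mem inE andbC [~~ _ && _]andbC.
move=> x xk; have /cornerP[h1 h2] := xk.
have : mact x (pgen A j) \in (<<B>> + vertex_submodule A (fun l => t < l)%O j)%VS.
  by apply: hB; rewrite ?la ?memvf // -mactM h1.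
have pj : pval (mact x (pgen A j)) = x by rewrite pval_act pval_gen.
case/memv_addP => u uB [v vT uv]; rewrite -pj uv linearD memv_add //.
  have -> : map (@pval _ _ _ A j) B = map (pvalf A j) B by apply: eq_map => z; rewrite pvalfE.
  by rewrite -limg_span /= -pvalfE memv_img.
by move: vT; rewrite mem_vertex_submodule.
Qed.

(** In [corner_span] with this [t], a label at or above [t] but not strictly above it is [t] itself,
    and it counts only if $k\le t$. The same observation gives the next three lemmas. *)
Lemma corner_right_zero k t x : ~~ (k <= t)%O -> x \in corner A k t -> x \in above t.
Proof.
move=> kt; have [B [sB hB]] := corner_span k t t.
suff : (size B <= 0)%N by rewrite leqn0 size_eq0 => /eqP B0 /hB; rewrite B0 span_nil add0v.
apply: leq_trans sB _; rewrite leqn0; apply/eqP/eq_card0 => l; rewrite !inE.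
apply/negP => /and3P[tl kl]; rewrite lt_neqAle tl andbT negbK => /eqP tl'.
by rewrite tl' kl in kt.
Qed.

Lemma corner_left_zero t j y : ~~ (j <= t)%O -> y \in corner A t j -> y \in above t.
Proof.
move=> jt; have [B [sB hB]] := corner_span t j t.
suff : (size B <= 0)%N by rewrite leqn0 size_eq0 => /eqP B0 /hB; rewrite B0 span_nil add0v.
apply: leq_trans sB _; rewrite leqn0; apply/eqP/eq_card0 => l; rewrite !inE.
apply/negP => /and3P[jl tl]; rewrite lt_neqAle tl andbT negbK => /eqP tl'.
by rewrite tl' jl in jt.
Qed.

Lemma corner_right_line k t a x : a \in corner A k t -> a \notin above t -> x \in corner A k t ->
  exists c, x - c *: a \in above t.
Proof.
move=> ak aT xk; have [B [sB hB]] := corner_span k t t.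
apply: (@span_le1 _ _ B) => //; try exact: hB.
apply: leq_trans sB _; rewrite -(card1 t); apply/subset_leq_card/fintype.subsetP => l; rewrite !inE.
by case/and3P=> tl kl; rewrite lt_neqAle tl andbT negbK eq_sym.
Qed.

Lemma corner_left_line t j b y : b \in corner A t j -> b \notin above t -> y \in corner A t j ->
  exists c, y - c *: b \in above t.
Proof.
move=> bk bT yk; have [B [sB hB]] := corner_span t j t.
apply: (@span_le1 _ _ B) => //; try exact: hB.
apply: leq_trans sB _; rewrite -(card1 t); apply/subset_leq_card/fintype.subsetP => l; rewrite !inE.
by case/and3P=> jl tl; rewrite lt_neqAle tl andbT negbK eq_sym.
Qed.

Lemma dim_corner_card k j : \dim (corner A k j) = #|[pred l : Q0 | (j <= l)%O && (k <= l)%O]|.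
Proof. by rewrite dim_corner (dim_at_projective hA). Qed.

End Layers.

Lemma linfunE (K : fieldType) (U V : vectType K) (f : U -> V) (fl : linear f) x :
  linfun f x = f x.
Proof. exact: (hom_ofE fl). Qed.

Lemma dual_separates (K : fieldType) (V : vectType K) (U : {vspace V}) b : b \notin U ->
  exists phi : 'Hom(V, K^o), (forall x, x \in U -> phi x = 0) /\ phi b != 0.
Proof.
move=> bU; pose pr := daddv_pi (U^C)%VS U.
have cap : (U^C :&: U = 0)%VS by rewrite capvC capv_compl.
have prU x : x - pr x \in U.
  have {1}<- := @daddv_pi_add _ _ (U^C)%VS U x cap; last by rewrite addvC addv_complf memvf.
  by rewrite addrAC subrr add0r memv_pi.
have pb : pr b != 0 by apply: contraNneq bU => h; have := prU b; rewrite h subr0.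
pose X := vbasis {:V}.
have [i ci] : exists i, coord X i (pr b) != 0.
  apply: contrapT => h; case/eqP: pb; rewrite (coord_vbasis (memvf (pr b))).
  by apply: big1 => i _; case: (eqVneq (coord X i (pr b)) 0) => [->|ne]; [rewrite scale0r | case: h; exists i].
exists (linfun (coord X i : V -> K^o) \o pr)%VF; split; last by rewrite comp_lfunE lfunE.
move=> x xU; rewrite comp_lfunE; suff -> : pr x = 0 by rewrite linear0.
apply/eqP; rewrite -memv0 -cap memv_cap memv_pi /=.
by rewrite -[pr x](subKr x) memvB.
Qed.

Lemma double_dual (K : fieldType) (V : vectType K) (th : 'Hom(V, K^o) -> K^o) :
  linear th -> exists w : V, forall f, th f = f w.
Proof.
move=> thl; pose X := vbasis {:V}.
pose c i : 'Hom(V, K^o) := linfun (coord X i : V -> K^o).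
exists (\sum_(i < \dim {:V}) th (c i) *: X`_i) => f.
have fE : f = \sum_(i < \dim {:V}) f X`_i *: c i.
  apply/lfunP => x; rewrite sum_lfunE {1}(coord_vbasis (memvf x)) linear_sum.
  by apply: eq_bigr => i _; rewrite linearZ scale_lfunE lfunE; apply: mulrC.
rewrite {1}fE -(hom_ofE thl) linear_sum [RHS]linear_sum; apply: eq_bigr => i _.
by rewrite !linearZ /= hom_ofE; apply: mulrC.
Qed.

(** * Costandard modules *)

Section Injectives.
Variables (K : fieldType) (Q0 : finType) (Q : quiver Q0).
Variable A : boundQuiverAlgebra K Q.
Local Notation e := (@videm K Q0 Q A).
Local Notation I := (injective_at A).
Implicit Types (i j k l t : Q0) (a b x : A).

Lemma ev_in t x : e t * x \in limg (amull (e t)).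
Proof. by apply/memv_imgP; exists x; rewrite ?memvf // lfunE. Qed.

(* The value at [e_t x] of a functional on [e_t A]. *)
Definition ev t (f : I t) x : K := (f : 'Hom(subvs_of (limg (amull (e t))), K^o)) (Subvs (ev_in t x)).

Lemma ev_linl t x : linear (fun f : I t => ev f x : K^o).
Proof. by move=> c f g; rewrite /ev add_lfunE scale_lfunE. Qed.

Lemma ev_linr t (f : I t) : linear (ev f : A -> K^o).
Proof.
move=> c x y; rewrite /ev -linearP; congr (_ _); apply: val_inj => /=.
by rewrite mulrDr scalerAr.
Qed.

Lemma ev0l t x : ev (0 : I t) x = 0.
Proof. by rewrite /ev zero_lfunE. Qed.

Lemma ev0r t (f : I t) : ev f 0 = 0.
Proof. by have := ev_linr f (-1) 0 0; rewrite !scaleN1r oppr0 addr0 addNr. Qed.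

Lemma evB t (f : I t) x y : ev f (x - y) = ev f x - ev f y.
Proof. by rewrite addrC -scaleN1r (ev_linr f (-1) y x) scaleN1r addrC. Qed.

Lemma ev_act t (f : I t) a x : ev (mact a f) x = ev f (x * a).
Proof.
rewrite /ev /= comp_lfunE; set W := limg (amull (e t)).
have val_r (y : subvs_of W) : vsval (vsproj W (vsval y * a)) = vsval y * a.
  rewrite vsprojK //; have /memv_imgP[z _ ->] := subvsP y; apply/memv_imgP.
  by exists (z * a); rewrite ?memvf // !lfunE /= mulrA.
rewrite linfunE; last first.
  move=> c y z; apply: val_inj; rewrite [LHS]val_r /= [vsval (vsproj W (vsval y * a))]val_r.
  by rewrite [vsval (vsproj W (vsval z * a))]val_r mulrDl scalerAl.
by congr (f _); apply: val_inj; rewrite [LHS]val_r /= mulrA.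
Qed.

Lemma ev_e t (f : I t) x : ev f (e t * x) = ev f x.
Proof. by congr (f _); apply: val_inj; rewrite /= videm_mulK. Qed.

Lemma ev_ext t (f g : I t) : ev f =1 ev g -> f = g.
Proof.
move=> h; apply/lfunP => y; have /memv_imgP[x _ yE] := subvsP y.
have -> : y = Subvs (ev_in t x) by apply: val_inj; rewrite /= yE lfunE.
exact: h.
Qed.

Lemma ev_fun t (phi : 'Hom(A, K^o)) : exists f : I t, forall x, ev f x = phi (e t * x).
Proof.
exists (phi \o linfun vsval)%VF => x.
by rewrite /ev comp_lfunE lfunE.
Qed.

Lemma ev_sep t x : e t * x = x -> (forall f : I t, ev f x = 0) -> x = 0.
Proof.
move=> ex h; apply/eqP/negPn/negP; rewrite -memv0 => /dual_separates[phi [_]].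
by have [f fE] := ev_fun t phi; rewrite -[x in phi x]ex -fE h eqxx.
Qed.

Lemma ev_rep t (th : I t -> K^o) : linear th ->
  exists w, e t * w = w /\ forall f, th f = ev f w.
Proof.
case/(double_dual (V := subvs_of (limg (amull (e t))))) => y yE.
exists (vsval y); have /memv_imgP[x _ xE] := subvsP y.
have ey : e t * vsval y = vsval y by rewrite xE lfunE /= videm_mulK.
split=> // f; rewrite yE; congr (f _); apply: val_inj; exact: (esym ey).
Qed.

End Injectives.

Section DualGenerators.
Variables (K : fieldType) (d : Order.disp_t) (Q0 : finPOrderType d).
Variables (Q : quiver Q0) (A : boundQuiverAlgebra K Q).
Hypothesis hA : one_quasi_hereditary A.
Local Notation module := (module A).
Local Notation e := (@videm K Q0 Q A).
Local Notation P := (projective A).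
Local Notation I := (injective_at A).
Local Notation D := (@standard K d Q0 Q A).
Implicit Types (M N : module) (i j k l t : Q0) (a b : A).

(** The condition runs over all [mact a f] because the functionals with $e_kf=0$ alone need not form
    a submodule. *)
Lemma costandardP t : exists W : submodule (I t), costandard A t = sm_module W /\
  forall f, f \in (W : {vspace _}) <-> forall k a, ~~ (k <= t)%O -> mact (e k) (mact a f) = 0.
Proof.
have [||W WP] := @vspace_of_set _ (I t)
    (fun f => forall k a, ~~ (k <= t)%O -> mact (e k) (mact a f) = 0).
- by move=> k a _; rewrite !linear0.
- by move=> c f g hf hg k a kt; rewrite mact_linr mact_linr hf // hg // scaler0 addr0.
have cl a f : f \in W -> mact a f \in W.
  by move/WP => h; apply/WP => k b kt; rewrite -(mactM b) h.
have sup (U : submodule (I t)) : supported_below t (sm_module U) ->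
    forall f, f \in (U : {vspace _}) -> f \in W.
  move=> /supported_belowP h f fU; apply/WP => k a kt.
  by have /(congr1 vsval) := h k (Subvs (smP a fU)) kt.
have supW : supported_below t (sm_module (mk_submodule cl)).
  apply/supported_belowP => k f kt; apply: val_inj.
  by have /WP/(_ k 1 kt) := subvsP f; rewrite mact1 => h; apply: h.
rewrite /costandard; set X := (X in xget _ X); exists (xget (sm_zero (I t)) X); split=> //.
move=> f; rewrite -WP; have [U|no] := xgetP.
  move=> _ [supU gr]; split; last by apply: (subvP (gr (mk_submodule cl) supW)).
  exact: sup.
exfalso; apply: (no (mk_submodule cl)); split=> // U supU; apply/subvP => g; exact: sup.
Qed.

(* If [e_t A e_j] were contained in [above t], the products spanning [e_j A e_j]
   would be fewer than its dimension. *)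
Lemma exists_left_line t j : (j <= t)%O -> exists2 b, b \in corner A t j & b \notin above A t.
Proof.
move=> jt.
have gtE l : (vertex_ideal A (fun m => (l <= m)%O && (m != l)) = above A l)%VS.
  apply/eqP; rewrite eqEsubv; apply/andP; split; apply: vertex_idealS => m.
    by rewrite lt_def andbC.
  by rewrite lt_def andbC.
(* A vector spanning [U] modulo [T], set to 0 when [U] lies in [T]. A representative inside [T] is
   thus 0, and its products drop out of the count. *)
have line (U T : {vspace A}) : (forall b x, b \in U -> b \notin T -> x \in U ->
    exists c, x - c *: b \in T) ->
    exists b, [/\ b \in U, forall x, x \in U -> x \in (<[b]> + T)%VS
                & b != 0 -> b \notin T].
  move=> h; have [UT|/subvPn[b bU bT]] := boolP (U <= T)%VS.
    exists 0; rewrite mem0v eqxx; split=> // x /(subvP UT) xT.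
    exact: (subvP (addvSr _ _)).
  exists b; split=> // x xU; have [c cE] := h b x bU bT xU.
  by rewrite -[x](subrK (c *: b)) addrC memv_add // memvZ // memv_line.
have [b bE] := @choice _ _ (fun l b => [/\ b \in corner A l j,
    forall x, x \in corner A l j -> x \in (<[b]> + above A l)%VS & b != 0 -> b \notin above A l])
    (fun l => line _ _ (fun u x => @corner_left_line _ _ _ _ _ hA l j u x)).
have [a aE] : exists a : Q0 -> Q0 -> A, forall k l, [/\ a k l \in corner A k l,
    forall x, x \in corner A k l -> x \in (<[a k l]> + above A l)%VS & a k l != 0 -> a k l \notin above A l].
  have [a aE] := @choice _ _ (fun kl a => [/\ a \in corner A kl.1 kl.2,
    forall x, x \in corner A kl.1 kl.2 -> x \in (<[a]> + above A kl.2)%VS & a != 0 -> a \notin above A kl.2])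
    (fun kl => line _ _ (fun u x => @corner_right_line _ _ _ _ _ hA kl.1 kl.2 u x)).
  by exists (fun k l => a (k, l)) => k l; apply: (aE (k, l)).
have sub : (corner A j j <= cellspan (fun l m => l <= m)%O a b j j)%VS.
  apply: (@corner_cellspan _ _ _ A (fun l m => (l <= m)%O) _ _ _ j a b).
  - by move=> y x z; apply: le_trans.
  - exact: lexx.
  - by move=> x y /le_anti.
  - by move=> k l; have [] := aE k l.
  - by move=> l; have [] := bE l.
  - by move=> k l x xk; rewrite gtE; have [_ h _] := aE k l; apply: h.
  - by move=> l x xl; rewrite gtE; have [_ h _] := bE l; apply: h.
exists (b t); first by have [] := bE t.
have [_ _ h] := bE t; apply: h; apply/eqP => bt0.
have := dimvS sub; rewrite dim_corner_card // leqNgt => /negP; apply.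
apply: leq_ltn_trans (dimv_leq_sum _ _ _) _.
rewrite (bigD1 t) //= bt0 mulr0 dim_vline eqxx add0n.
apply: (@leq_ltn_trans (\sum_(l | (j <= l)%O && (l != t)) 1)%N).
  by apply: leq_sum => l _; rewrite dim_vline leq_b1.
rewrite sum1_card [X in (_ < X)%N](cardD1 t) !inE jt /= add1n ltnS; apply: eq_leq.
by apply: eq_card => l; rewrite !inE andbb andbC.
Qed.

End DualGenerators.

(** * Vectors that detect the order *)

Section Generators.
Variables (K : fieldType) (d : Order.disp_t) (Q0 : finPOrderType d).
Variables (Q : quiver Q0) (A : boundQuiverAlgebra K Q).
Hypothesis hA : one_quasi_hereditary A.
Local Notation module := (module A).
Local Notation e := (@videm K Q0 Q A).
Local Notation P := (projective A).
Local Notation I := (injective_at A).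
Local Notation D := (@standard K d Q0 Q A).
Implicit Types (M N : module) (i j k l t n : Q0) (a b : A).

(** [v] is the image of the generator [g] of $\Delta(t)$. By injectivity $av=0$ iff $ag=0$, so the
    vertices reached from [v] are those in the support of $\Delta(t)$. *)
Lemma left_generator t n : (forall i, (i <= n)%O) -> injects (D t) (D n) ->
  exists v, v \in corner A t n /\
    forall k, (k <= t)%O <-> exists2 x, x \in corner A k t & x * v != 0.
Proof.
move=> nT; have [U [-> _ min]] := standardP A n.
have U0 : (U <= sm_zero (P n))%VS by apply: min => k x; rewrite nT.
case=> f [fh f0]; have finj : injective f by apply/lker0P; rewrite f0.
have [g [eg gen z _]] := standard_univ A t.
pose x := vsval (f g); pose v := pval (mact (e t) x).
have v0 a : (a * v == 0) = (mact a g == 0).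
  have qa : quo_pi U (mact a (mact (e t) x)) = f (mact a g).
    apply: etrans (quo_act U a (mact (e t) x)) _.
    apply: etrans (congr1 (@mact _ _ (quotient U) a) (quo_act U (e t) x)) _.
    apply: etrans (congr1 (fun z : quotient U => mact a (mact (e t) z)) (quo_piK (f g))) _.
    apply: etrans (congr1 (@mact _ _ (quotient U) a) (esym (fh (e t) g))) _.
    by apply: etrans (esym (fh a (mact (e t) g))) _; rewrite eg.
  rewrite -[RHS](inj_eq finj) linear0 -qa quo_pi_eq0; apply/eqP/idP => [av|/(subvP U0)].
    have -> : mact a (mact (e t) x) = 0 by apply: pval_inj; rewrite pval_act av linear0.
    by rewrite mem0v.
  by rewrite memv0 => /eqP h; rewrite /v -pval_act h linear0.
exists v; split; first by apply/cornerP; rewrite /v pval_e pval_act videm_mulK.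
move=> k; split=> [kt|[y /cornerP[ey _]]]; last first.
  by rewrite v0 => y0; apply: contraNT y0 => /z kt; rewrite -ey mactM kt.
have : exists m : D t, mact (e k) m != 0.
  apply: contrapT => h; have := dim_at_standard hA t k; rewrite kt.
  have -> // : dim_at (D t) k = 0%N.
  by apply/dim_at_eq0 => m; apply/eqP/negPn/negP => hm; apply: h; exists m.
case=> m; have [a ->] := gen m => m0; exists (e k * a * e t); first exact: corner_proj.
by rewrite v0 mactM eg mactM.
Qed.

(* Composing with evaluation at [e_t] turns a homomorphism [I(n) -> I(t)] into an
   element of the double dual of [e_n A]. *)
Lemma right_generator t n : (forall i, (i <= n)%O) ->
  surjects (costandard A n) (costandard A t) ->
  exists w, w \in corner A n t /\
    forall k, (k <= t)%O <-> exists2 x, x \in corner A t k & w * x != 0.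
Proof.
move=> nT; have [Wn [-> WnP]] := costandardP A n; have [Wt [-> WtP]] := costandardP A t.
case=> F [Fh FT].
have WnT (f : I n) : f \in (Wn : {vspace _}) by apply/WnP => k a; rewrite nT.
have [G [Gl Gh GW Gs]] : exists G : I n -> I t, [/\ linear G,
    forall a f, G (mact a f) = mact a (G f), forall f, G f \in (Wt : {vspace _})
    & forall h, h \in (Wt : {vspace _}) -> exists f, G f = h].
  exists (fun f => vsval (F (Subvs (WnT f)))); split.
  - move=> c f g; have -> : Subvs (WnT (c *: f + g)) = c *: Subvs (WnT f) + Subvs (WnT g).
      exact: val_inj.
    by rewrite linearP.
  - move=> a f; have -> : Subvs (WnT (mact a f)) = mact a (Subvs (WnT f) : sm_module Wn).
      exact: val_inj.
    by rewrite Fh.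
  - by move=> f; apply: subvsP.
  - move=> h hW; have : Subvs hW \in limg F by rewrite FT memvf.
    case/memv_imgP => f _ /(congr1 vsval) /= fE; exists (vsval f).
    by rewrite fE; congr (vsval (F _)); apply: val_inj.
have thl : linear (fun f : I n => ev (G f) 1 : K^o).
  move=> c f g.
  exact: etrans (congr1 (fun z => ev z 1) (Gl c f g)) (@ev_linl _ _ _ A t 1 c (G f) (G g)).
have [w [ew wE]] := ev_rep thl.
(* The property of [w] at 1 spreads to every [x] because [G] commutes with the action. Hence $wx=0$
   iff all functionals in the image of [G] vanish at [x]. *)
have wx f x : ev f (w * x) = ev (G f) x by rewrite -ev_act -wE Gh ev_act mul1r.
have sep x : w * x = 0 <-> forall f, ev (G f) x = 0.
  split=> [h f|h]; first by rewrite -wx h ev0r.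
  by apply: (@ev_sep _ _ _ A n (w * x)) => [|f]; [rewrite mulrA ew | rewrite wx].
have we : w * e t = w.
  apply/eqP; rewrite -subr_eq0 -[X in _ - X]mulr1 -mulrBr; apply/eqP/sep => f.
  by rewrite evB -(ev_e (G f) 1) mulr1 subrr.
exists w; split; first by apply/cornerP.
move=> k; split=> [kt|[x /cornerP[_ xe]]]; last first.
  move=> wx0; apply: contraNT wx0 => kt; apply/eqP/sep => f.
  rewrite -xe -ev_act; have /WtP/(_ k 1 kt) := GW f.
  by rewrite mact1 => ->; rewrite ev0l.
have [b bk bT] := exists_left_line hA kt.
(* A functional vanishing on $T_t$ but not at [b]. It lies in $\nabla(t)$, hence in the image of
   [G], so $wb=0$ would force it to vanish at [b]. *)
have [phi [phi0 phib]] := dual_separates bT.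
have [h hE] := ev_fun t phi.
exists b => //; apply/eqP => /sep wb0.
have hW : h \in (Wt : {vspace _}).
  apply/WtP => m a mt; apply: ev_ext => x; rewrite !ev_act hE phi0; last first.
    by rewrite !mulrA; apply: vertex_ideal_mulr; apply: (corner_left_zero hA mt); apply: corner_proj.
  by rewrite ev0l.
have [f GE] := Gs h hW.
have := wb0 f; rewrite GE hE; have /cornerP[-> _] := bk.
by move/eqP; rewrite (negPf phib).
Qed.

Lemma generators : exists n (v w : Q0 -> A),
  [/\ forall i, (i <= n)%O,
      forall t, v t \in corner A t n /\
        forall k, (k <= t)%O <-> exists2 x, x \in corner A k t & x * v t != 0
    & forall t, w t \in corner A n t /\
        forall k, (k <= t)%O <-> exists2 x, x \in corner A t k & w t * x != 0].
Proof.
have [_ [bot [n [bn _ _ h]]]] := hA.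
have nT i : (i <= n)%O by have /andP[] := bn i.
have [v vE] := choice (fun t => left_generator nT (proj1 (h t))).
have [w wE] := choice (fun t => right_generator nT (proj2 (h t))).
by exists n, v, w.
Qed.

End Generators.

(** * Arrows along covering relations *)

Section CoverArrows.
Variables (Q0 : finType) (Q : quiver Q0) (r : rel Q0) (B : pred (arrow Q)).
Hypothesis r_refl : reflexive r.
Hypothesis r_trans : transitive r.
Hypothesis r_anti : antisymmetric r.
Hypothesis rB : forall i k, r i k <->
  exists s, [/\ walk (Q := Q) i s, walk_end i s = k & all B s].
Implicit Types (i j k m : Q0) (a : arrow Q).

(** The order is an abstract relation [r] because it is used twice: upwards with the arrows that [w]
    detects and downwards with those that [v] detects. *)
Definition cover i k := [&& i != k, r i k &
  [forall m, r i m && r m k ==> (m == i) || (m == k)]].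

(** All vertices on a walk in [B] lie between [i] and [k]; after possible loops at [i] the first
    proper arrow must go straight to [k]. *)
Lemma cover_arrow i k : cover i k -> exists a, [/\ B a, source a = i & target a = k].
Proof.
case/and3P=> ik rik /forallP co; have [s [ws es Bs]] := (rB i k).1 rik.
elim: s ws es Bs => [|a s IH] /=; first by move=> _ /eqP; rewrite (negPf ik).
case/andP=> /eqP sa hs ek /andP[Ba Bs].
have ram : r i (target a) by apply/rB; exists [:: a]; rewrite /= sa eqxx Ba.
have rmk : r (target a) k by apply/rB; exists s.
have := co (target a); rewrite ram rmk /= => /orP[/eqP h|/eqP h]; last by exists a.
by apply: IH; rewrite // -h.
Qed.

Definition pick_arrow i k := [pick b | [&& B b, source b == i & target b == k]].

Definition chosen a := cover (source a) (target a) &&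
  (pick_arrow (source a) (target a) == Some a).

Lemma chosen_cover a : chosen a -> cover (source a) (target a).
Proof. by case/andP. Qed.

Lemma chosenB a : chosen a -> B a.
Proof.
by case/andP => _; rewrite /pick_arrow; case: pickP => [b /and3P[Bb _ _] /eqP[<-]|_ /eqP].
Qed.

Lemma chosen_uniq a b : chosen a -> chosen b -> source a = source b ->
  target a = target b -> a = b.
Proof.
by case/andP=> _ /eqP h /andP[_ /eqP h'] E1 E2; apply: Some_inj; rewrite -h -h' E1 E2.
Qed.

Lemma chosen_exists i k : cover i k -> exists a, [/\ chosen a, source a = i & target a = k].
Proof.
move=> co; have [a [Ba sa ta]] := cover_arrow co.
case E : (pick_arrow i k) => [b|]; last first.
  by move: E; rewrite /pick_arrow; case: pickP => // /(_ a); rewrite Ba sa ta !eqxx.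
have [sb tb] : source b = i /\ target b = k.
  by move: E; rewrite /pick_arrow; case: pickP => // c /and3P[_ /eqP sc /eqP tc] [<-].
by exists b; rewrite /chosen sb tb co E eqxx.
Qed.

(** A pair that is not a cover is split at an intermediate vertex, and both halves span smaller
    intervals. *)
Lemma chosen_walk i k : r i k ->
  exists s, [/\ walk (Q := Q) i s, walk_end i s = k & all chosen s].
Proof.
have [n] := ubnP #|[pred m | r i m && r m k]|; elim: n i k => // n IH i k ln rik.
have [<-|ik] := eqVneq i k; first by exists [::].
have [co|] := boolP (cover i k).
  have [a [ca sa ta]] := chosen_exists co; exists [:: a]; split=> /=.
  - by rewrite sa eqxx.
  - exact: ta.
  - by rewrite ca.
rewrite /cover ik rik /= => /forallPn[m]; rewrite negb_imply negb_or.
case/andP=> /andP[rim rmk] /andP[mi mk].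
have [|s [ws es cs]] := IH i m _ rim.
  rewrite -ltnS; apply: leq_trans ln; rewrite ltnS; apply: proper_card; apply/properP; split.
    by apply/fintype.subsetP => x; rewrite !inE => /andP[-> /r_trans]; apply.
  exists k; rewrite !inE ?rik ?r_refl //=; apply: contra mk => rkm.
  by apply/eqP/r_anti; rewrite rmk.
have [|s' [ws' es' cs']] := IH m k _ rmk.
  rewrite -ltnS; apply: leq_trans ln; rewrite ltnS; apply: proper_card; apply/properP; split.
    by apply/fintype.subsetP => x; rewrite !inE => /andP[rmx ->]; rewrite (r_trans rim).
  exists i; rewrite !inE ?rik ?r_refl //=; apply: contra mi => /andP[rmi _].
  by apply/eqP/r_anti; rewrite rmi.
exists (s ++ s'); split.
- by rewrite walk_cat ws es.
- by rewrite walk_end_cat es.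
- by rewrite all_cat cs.
Qed.

End CoverArrows.

(** * Bases of the corners *)

(** If $c_t\ne0$, then [m t] is redundant, and the remaining $|S|-1$ lines cannot span a space
    containing [U]. *)
Lemma free_of_dim (K : fieldType) (V : vectType K) (I : finType) (S : pred I) (m : I -> V)
    (U : {vspace V}) (c : I -> K) :
  (U <= \sum_(t | S t) <[m t]>)%VS -> \dim U = #|S| ->
  \sum_(t | S t) c t *: m t = 0 -> forall t, S t -> c t = 0.
Proof.
move=> US dU c0 t St; apply/eqP/negPn/negP => ct.
have mt : m t \in (\sum_(s | S s && (s != t)) <[m s]>)%VS.
  move: c0; rewrite (bigD1 t) //= => /eqP; rewrite addr_eq0 => /eqP h.
  rewrite -[m t](scalerK ct) h memvZ // memvN memv_sumr // => s _.
  by rewrite memvZ // memv_line.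
have := dimvS US; rewrite dU leqNgt => /negP; apply.
rewrite (bigD1 t) //= (addv_idPr _); last by rewrite -memvE.
apply: leq_ltn_trans (dimv_leq_sum _ _ _) _.
apply: (@leq_ltn_trans (\sum_(s | S s && (s != t)) 1)%N).
  by apply: leq_sum => s _; rewrite dim_vline leq_b1.
rewrite sum1_card [X in (_ < X)%N](cardD1 t) [t \in S]St add1n ltnS; apply: eq_leq.
by apply: eq_card => s; rewrite !inE andbC.
Qed.

Section WalkImage.
Variables (K : fieldType) (Q0 : finType) (Q : quiver Q0).
Variable A : boundQuiverAlgebra K Q.
Local Notation e := (@videm K Q0 Q A).

(** Recursion on the bare list of arrows, so that inductions do not carry the proof of [walk i s]
    inside a path. *)
Fixpoint walk_image (i : Q0) (s : seq (arrow Q)) : A :=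
  if s is a :: s' then walk_image (target a) s' * path_image A (arrow_path a) else e i.

Lemma path_image_walk_image i s (h : walk i s) : path_image A (@QPath _ Q (i, s) h) = walk_image i s.
Proof.
elim: s i h => [|a s IH] i h /=; first by rewrite videmE; congr path_image; apply: qpath_eq.
have /= /andP[/eqP sa ws] := h; rewrite -(IH _ ws).
have pe : pend (arrow_path a) = pstart (@QPath _ Q (target a, s) ws) by [].
by rewrite -(path_image_concat _ pe); congr path_image; apply: qpath_eq.
Qed.

Lemma corner_walk_image i s : walk i s -> walk_image i s \in corner A (walk_end i s) i.
Proof. by move=> h; rewrite -(path_image_walk_image h); exact: corner_path_image. Qed.

Lemma corner_arrow a : path_image A (arrow_path a) \in corner A (target a) (source a).
Proof. exact: (corner_path_image A (arrow_path a)). Qed.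

Lemma corner_pathsub i k (U : {vspace A}) :
  (forall s, walk i s -> walk_end i s = k -> walk_image i s \in U) -> (corner A k i <= U)%VS.
Proof.
move=> h; have : fullv = ((amulr (e i) \o amull (e k)) @^-1: U)%VS.
  apply/esym/alg_mem => p; rewrite -memv_preim comp_lfunE !lfunE /=.
  have [pk|pk] := eqVneq (pend p) k; last by rewrite videm_path_image (negPf pk) scale0r mul0r mem0v.
  have [pi|pi] := eqVneq (pstart p) i; last first.
    have pe : path_image A p * e i = 0 by rewrite path_image_videm (negPf pi) scale0r.
    suff -> : e k * path_image A p * e i = 0 by rewrite mem0v.
    by apply: etrans (esym (mulrA _ _ _)) _; apply: etrans (congr1 ( *%R (e k)) pe) (mulr0 _).
  rewrite -pk -pi pend_path_image path_image_pstart.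
  have -> : p = @QPath _ Q (pstart p, parrows p) (pdata_walk p) by apply: qpath_eq.
  rewrite path_image_walk_image -pi in h *; apply: h => //; exact: pdata_walk.
move=> E; apply/subvP => x xk; have : x \in fullv by rewrite memvf.
by rewrite E -memv_preim comp_lfunE !lfunE /=; have /cornerP[-> ->] := xk.
Qed.

End WalkImage.

Section Basis.
Variables (K : fieldType) (d : Order.disp_t) (Q0 : finPOrderType d).
Variables (Q : quiver Q0) (A : boundQuiverAlgebra K Q).
Hypothesis hA : one_quasi_hereditary A.
Local Notation e := (@videm K Q0 Q A).
Variables (n : Q0) (v w : Q0 -> A).
Hypothesis nT : forall i, (i <= n)%O.
Hypothesis vP : forall t, v t \in corner A t n /\
  forall k, (k <= t)%O <-> exists2 x, x \in corner A k t & x * v t != 0.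
Hypothesis wP : forall t, w t \in corner A n t /\
  forall k, (k <= t)%O <-> exists2 x, x \in corner A t k & w t * x != 0.
Implicit Types (i j k l t : Q0) (x y : A).

Lemma v_corner t : v t \in corner A t n. Proof. by have [] := vP t. Qed.
Lemma w_corner t : w t \in corner A n t. Proof. by have [] := wP t. Qed.

Lemma v_neq0 t : v t != 0.
Proof.
have [_ /(_ t)[/(_ (lexx t))[x _ h] _]] := vP t.
by apply: contraNneq h => ->; rewrite mulr0.
Qed.

Lemma w_neq0 t : w t != 0.
Proof.
have [_ /(_ t)[/(_ (lexx t))[x _ h] _]] := wP t.
by apply: contraNneq h => ->; rewrite mul0r.
Qed.

Lemma line_of_dim1 (U : {vspace A}) x y : (\dim U <= 1)%N -> x \in U -> y \in U -> x != 0 ->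
  exists c, y = c *: x.
Proof.
move=> dU xU yU x0; apply/vlineP.
suff -> : <[x]>%VS = U by [].
by apply/eqP; rewrite eqEdim -memvE xU dim_vline x0.
Qed.

Lemma v_line k x : x \in corner A k n -> exists c, x = c *: v k.
Proof.
move=> xk; apply: (@line_of_dim1 (corner A k n)) => //; [|exact: v_corner|exact: v_neq0].
rewrite dim_corner_card // -(card1 n); apply/subset_leq_card/fintype.subsetP => l; rewrite !inE.
by case/andP=> nl _; rewrite eq_le nl nT.
Qed.

Lemma w_line k x : x \in corner A n k -> exists c, x = c *: w k.
Proof.
move=> xk; apply: (@line_of_dim1 (corner A n k)) => //; [|exact: w_corner|exact: w_neq0].
rewrite dim_corner_card // -(card1 n); apply/subset_leq_card/fintype.subsetP => l; rewrite !inE.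
by case/andP=> _ nl; rewrite eq_le nl nT.
Qed.

Definition lowers (a : arrow Q) := path_image A (arrow_path a) * v (source a) != 0.
Definition raises (a : arrow Q) := w (target a) * path_image A (arrow_path a) != 0.

(** By [v_line] each arrow sends the vector at its source to a multiple of the vector at its target,
    so a walk acts by a product of scalars in a field. *)
Lemma lowers_walk i s : walk i s -> all lowers s = (walk_image A i s * v i != 0).
Proof.
elim: s i => [|a s IH] i /=.
  by move=> _; have /cornerP[-> _] := v_corner i; rewrite v_neq0.
case/andP=> /eqP <- ws; rewrite (IH _ ws) -mulrA /lowers.
have [c ->] := v_line (cornerM (corner_arrow A a) (v_corner (source a))).
rewrite -scalerAr !scaler_eq0 (negPf (v_neq0 _)) orbF.
by rewrite negb_or.
Qed.

Lemma raises_walk i s : walk i s -> all raises s = (w (walk_end i s) * walk_image A i s != 0).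
Proof.
elim: s i => [|a s IH] i /=.
  by move=> _; have /cornerP[_ ->] := w_corner i; rewrite w_neq0.
case/andP=> /eqP <- ws; rewrite (IH _ ws) mulrA /raises.
have := corner_walk_image A ws; rewrite [walk_end (source a) _]/(walk_end (target a) s) => h.
have [c ->] := w_line (cornerM (w_corner _) h).
rewrite -scalerAl !scaler_eq0 (negPf (w_neq0 _)) orbF.
by rewrite negb_or andbC.
Qed.

(** The corner is spanned by walks, so if some element of $e_kAe_i$ does not kill $v_i$, then some
    walk does not. *)
Lemma lowersP i k : (k <= i)%O <->
  exists s, [/\ walk (Q := Q) i s, walk_end i s = k & all lowers s].
Proof.
have [_ h] := vP i; split=> [/h[x xk]|[s [ws es ls]]]; last first.
  by apply/h; exists (walk_image A i s); rewrite -?es ?corner_walk_image -?lowers_walk.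
apply: contraNP => no; have : (corner A k i <= lker (amulr (v i)))%VS.
  apply: corner_pathsub => s ws es; rewrite memv_ker lfunE /=; apply/negPn; rewrite -lowers_walk //.
  by apply/negP => ls; apply: no; exists s.
by move/subvP/(_ _ xk); rewrite memv_ker lfunE.
Qed.

Lemma raisesP i k : (i <= k)%O <->
  exists s, [/\ walk (Q := Q) i s, walk_end i s = k & all raises s].
Proof.
have [_ h] := wP k; split=> [/h[x xk]|[s [ws es ls]]]; last first.
  by apply/h; exists (walk_image A i s); rewrite -?es ?corner_walk_image -?raises_walk.
apply: contraNP => no; have : (corner A k i <= lker (amull (w k)))%VS.
  apply: corner_pathsub => s ws es; rewrite memv_ker lfunE /=; apply/negPn.
  rewrite -{1}es -raises_walk //.
  by apply/negP => ls; apply: no; exists s.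
by move/subvP/(_ _ xk); rewrite memv_ker lfunE.
Qed.

Lemma above_v t x : x \in above A t -> x * v t = 0.
Proof.
move=> xt; apply/eqP; suff : x \in lker (amulr (v t)) by rewrite memv_ker lfunE.
apply: (subvP _ _ xt); apply: vertex_ideal_sub => l a b tl; rewrite memv_ker lfunE /=.
have /cornerP[<- _] := v_corner t; rewrite -!mulrA [e l * _]mulrA [e l * _ * _]mulrA.
apply/eqP; suff -> : e l * b * e t * v t = 0 by rewrite mulr0.
apply/eqP/negPn/negP => h; have [_ /(_ l)[_ hl]] := vP t.
have /hl : exists2 x, x \in corner A l t & x * v t != 0 by exists (e l * b * e t); rewrite ?corner_proj.
by rewrite lt_geF.
Qed.

Lemma above_w t x : x \in above A t -> w t * x = 0.
Proof.
move=> xt; apply/eqP; suff : x \in lker (amull (w t)) by rewrite memv_ker lfunE.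
apply: (subvP _ _ xt); apply: vertex_ideal_sub => l a b tl; rewrite memv_ker lfunE /=.
have /cornerP[_ <-] := w_corner t; rewrite !mulrA.
apply/eqP; suff -> : w t * e t * a * e l = 0 by rewrite mul0r.
rewrite -!mulrA; apply/eqP/negPn/negP => h; have [_ /(_ l)[_ hl]] := wP t.
have /hl : exists2 x, x \in corner A t l & w t * x != 0 by exists (e t * a * e l); rewrite ?corner_proj // -!mulrA.
by rewrite lt_geF.
Qed.

Section Cells.
Variables (j : Q0) (a : Q0 -> Q0 -> A) (b : Q0 -> A).
Hypothesis aP : forall k t, (k <= t)%O -> a k t \in corner A k t /\ a k t * v t != 0.
Hypothesis a0 : forall k t, ~~ (k <= t)%O -> a k t = 0.
Hypothesis bP : forall t, (j <= t)%O -> b t \in corner A t j /\ w t * b t != 0.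
Hypothesis b0 : forall t, ~~ (j <= t)%O -> b t = 0.

(** Since $T_t$ kills $v_t$ and $w_t$, a representative that does not kill them lies outside $T_t$
    and so spans its line modulo $T_t$, which is what [cellspan_mul] asks for. *)
Lemma cell_mul k l x y : x \in corner A k l -> y \in corner A l j ->
  x * y \in (\sum_(t | (l <= t)%O) <[a k t * b t]>)%VS.
Proof.
have gtE t : (above A t <= vertex_ideal A (fun m => (t <= m)%O && (m != t)))%VS.
  by apply: vertex_idealS => m; rewrite lt_def andbC.
apply: (@cellspan_mul _ _ _ A (fun l m => (l <= m)%O)).
- by move=> t s u; apply: le_trans.
- exact: lexx.
- by move=> t s /le_anti.
- by move=> k' t; have [/aP[]//|/a0 ->] := boolP (k' <= t)%O; rewrite mem0v.
- by move=> t; have [/bP[]//|/b0 ->] := boolP (j <= t)%O; rewrite mem0v.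
- move=> k' t z zk; apply: (subvP (addvS (subvv _) (gtE t))).
  have [kt|kt] := boolP (k' <= t)%O; last first.
    by apply: (subvP (addvSr _ _)); apply: (corner_right_zero hA kt).
  have [ak av] := aP kt; have aT : a k' t \notin above A t by apply: contraNN av => /above_v ->.
  have [c cE] := corner_right_line hA ak aT zk.
  by rewrite -[z](subrK (c *: a k' t)) addrC memv_add // memvZ // memv_line.
- move=> t z zk; apply: (subvP (addvS (subvv _) (gtE t))).
  have [jt|jt] := boolP (j <= t)%O; last first.
    by apply: (subvP (addvSr _ _)); apply: (corner_left_zero hA jt).
  have [bk bw] := bP jt; have bT : b t \notin above A t by apply: contraNN bw => /above_w ->.
  have [c cE] := corner_left_line hA bk bT zk.
  by rewrite -[z](subrK (c *: b t)) addrC memv_add // memvZ // memv_line.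
Qed.

Lemma cell_span k : (corner A k j <= \sum_(t | (j <= t)%O && (k <= t)%O) <[a k t * b t]>)%VS.
Proof.
apply/subvP => x xk; have := cell_mul (corner_e A k) xk; have /cornerP[-> _] := xk.
apply: subvP; apply/subv_sumP => t kt; have [jt|/b0 ->] := boolP (j <= t)%O.
  by apply: (sumv_sup t); rewrite ?jt ?subvv.
by rewrite mulr0 -memvE mem0v.
Qed.

Lemma cell_free k (c : Q0 -> K) :
  \sum_(t | (j <= t)%O && (k <= t)%O) c t *: (a k t * b t) = 0 ->
  forall t, (j <= t)%O -> (k <= t)%O -> c t = 0.
Proof.
move=> h t jt kt; apply: (free_of_dim (cell_span k) _ h); last by rewrite jt.
exact: dim_corner_card.
Qed.

Lemma cell_coord k x : x \in corner A k j -> exists c : Q0 -> K,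
  x = \sum_(t | (j <= t)%O && (k <= t)%O) c t *: (a k t * b t).
Proof.
move/(subvP (cell_span k)) => /memv_sumP[m mE ->].
have mc t : exists c, (j <= t)%O && (k <= t)%O -> m t = c *: (a k t * b t).
  case: (boolP ((j <= t)%O && (k <= t)%O)) => [jkt|_]; last by exists 0.
  by have /vlineP[c ->] := mE t jkt; exists c.
by have [c cE] := choice mc; exists c; apply: eq_bigr => t /cE.
Qed.

End Cells.
End Basis.

(** * The quiver and the relations *)

Section QuiverRelations.
Variables (K : fieldType) (d : Order.disp_t) (Q0 : finPOrderType d).
Variables (Q : quiver Q0) (A : boundQuiverAlgebra K Q).
Hypothesis hA : one_quasi_hereditary A.
Local Notation KQ := (pathAlgebra K Q).
Local Notation e := (@videm K Q0 Q A).
Variables (n : Q0) (v w : Q0 -> A).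
Hypothesis nT : forall i, (i <= n)%O.
Hypothesis vP : forall t, v t \in corner A t n /\
  forall k, (k <= t)%O <-> exists2 x, x \in corner A k t & x * v t != 0.
Hypothesis wP : forall t, w t \in corner A n t /\
  forall k, (k <= t)%O <-> exists2 x, x \in corner A t k & w t * x != 0.
Implicit Types (i j k l t : Q0).

Definition descending := chosen (fun i k => k <= i)%O (lowers v).
Definition ascending := chosen (fun i k => i <= k)%O (raises w).

Lemma descending_cover g : descending g -> (target g < source g)%O.
Proof.
by case/chosen_cover/and3P => h h' _; rewrite lt_neqAle eq_sym h.
Qed.

Lemma ascending_cover g : ascending g -> (source g < target g)%O.
Proof.
by case/chosen_cover/and3P => h h' _; rewrite lt_neqAle h.
Qed.

Lemma down_path k t : (k <= t)%O -> exists p : qpath Q, [/\ pstart p = t, pend p = k,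
  all descending (parrows p) & path_image A p * v t != 0].
Proof.
move=> kt; have [|||s [ws es cs]] := chosen_walk _ _ _ (lowersP hA nT vP) kt.
- exact: lexx.
- by move=> x y z yx zy; apply: le_trans yx.
- by move=> x y; rewrite andbC => /le_anti.
exists (@QPath _ Q (t, s) ws); split=> //.
rewrite path_image_walk_image -(lowers_walk hA nT vP ws); apply: sub_all cs => g; exact: chosenB.
Qed.

Lemma up_path t j : (j <= t)%O -> exists p : qpath Q, [/\ pstart p = j, pend p = t,
  all ascending (parrows p) & w t * path_image A p != 0].
Proof.
move=> jt; have [|||s [ws es cs]] := chosen_walk _ _ _ (raisesP hA nT wP) jt.
- exact: lexx.
- by move=> x y z yx; apply: le_trans.
- by move=> x y /le_anti.
exists (@QPath _ Q (j, s) ws); split=> //.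
rewrite path_image_walk_image -{1}es -(raises_walk hA nT wP ws); apply: sub_all cs => g; exact: chosenB.
Qed.

(** The value 0 off the order lets sums over all $t\ge l$ be cut down to those [t] that are also at
    or above [j] and [k]. *)
Definition cell_families (a b : Q0 -> Q0 -> A) :=
  [/\ forall k t, (k <= t)%O -> a k t \in corner A k t /\ a k t * v t != 0,
      forall k t, ~~ (k <= t)%O -> a k t = 0,
      forall t j, (j <= t)%O -> b t j \in corner A t j /\ w t * b t j != 0
    & forall t j, ~~ (j <= t)%O -> b t j = 0].

Definition good_upd (a b : Q0 -> Q0 -> A) (upd : Q0 -> Q0 -> Q0 -> qpath Q) :=
  forall j i k, (j <= i)%O -> (k <= i)%O ->
    [/\ up_down_path j i k (upd j i k), pstart (upd j i k) = j, pend (upd j i k) = k,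
        all (fun g => descending g || ascending g) (parrows (upd j i k))
      & path_image A (upd j i k) = a k i * b i j].

Lemma upd_exists : exists a b upd, cell_families a b /\ good_upd a b upd.
Proof.
have dnx (kt : Q0 * Q0) : exists p : qpath Q, (kt.1 <= kt.2)%O -> [/\ pstart p = kt.2, pend p = kt.1,
  all descending (parrows p) & path_image A p * v kt.2 != 0].
  (* The trivial path at [n] is only a filler where nothing is asked. *)
  have [h|h] := boolP (kt.1 <= kt.2)%O; last by exists (trivial_path Q n).
  by have [p pP] := down_path h; exists p.
have upx (tj : Q0 * Q0) : exists p : qpath Q, (tj.2 <= tj.1)%O -> [/\ pstart p = tj.2, pend p = tj.1,
  all ascending (parrows p) & w tj.1 * path_image A p != 0].
  have [h|h] := boolP (tj.2 <= tj.1)%O; last by exists (trivial_path Q n).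
  by have [p pP] := up_path h; exists p.
have [dn dnP] := choice dnx; have [up upP] := choice upx.
pose a k t : A := if (k <= t)%O then path_image A (dn (k, t)) else 0.
pose b t j : A := if (j <= t)%O then path_image A (up (t, j)) else 0.
have updx (jik : Q0 * Q0 * Q0) : exists p : qpath Q,
   (jik.1.1 <= jik.1.2)%O -> (jik.2 <= jik.1.2)%O ->
    [/\ up_down_path jik.1.1 jik.1.2 jik.2 p, pstart p = jik.1.1, pend p = jik.2,
        all (fun g => descending g || ascending g) (parrows p)
      & path_image A p = a jik.2 jik.1.2 * b jik.1.2 jik.1.1].
  case: jik => [[j i] k] /=; have [ji|ji] := boolP (j <= i)%O; last by exists (trivial_path Q n).
  have [ki|ki] := boolP (k <= i)%O; last by exists (trivial_path Q n).
  have [d1 d2 d3 _] := dnP (k, i) ki; have [u1 u2 u3 _] := upP (i, j) ji.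
  have h : pend (up (i, j)) = pstart (dn (k, i)) by rewrite d1 u2.
  exists (concat h) => _ _; split=> //.
  - exists (up (i, j)), (dn (k, i)); split=> //.
      by apply: sub_all u3 => g; exact: ascending_cover.
    by apply: sub_all d3 => g; exact: descending_cover.
  - by rewrite /pend walk_end_cat -/(pend (up (i, j))) h.
  - rewrite /parrows /= all_cat; apply/andP; split.
      by apply: sub_all u3 => g ->; rewrite orbT.
    by apply: sub_all d3 => g ->.
  - by rewrite path_image_concat /a /b ki ji.
have [upd updP] := choice updx.
exists a, b, (fun j i k => upd (j, i, k)); split; last by move=> j i k; apply: (updP (j, i, k)).
split.
- move=> k t kt; have [d1 d2 _ d4] := dnP (k, t) kt; rewrite /a kt; split=> //.
  by have := corner_path_image A (dn (k, t)); rewrite d1 d2.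
- by move=> k t kt; rewrite /a (negPf kt).
- move=> t j jt; have [d1 d2 _ d4] := upP (t, j) jt; rewrite /b jt; split=> //.
  by have := corner_path_image A (up (t, j)); rewrite d1 d2.
- by move=> t j jt; rewrite /b (negPf jt).
Qed.

Section Fixed.
Variables (a b : Q0 -> Q0 -> A) (upd : Q0 -> Q0 -> Q0 -> qpath Q).
Hypothesis abP : cell_families a b.
Hypothesis updP : good_upd a b upd.

Definition upd_rel (p : qpath Q) (c : Q0 -> K) : KQ :=
  path_elt K p - \sum_(i | (pstart p <= i)%O && (pend p <= i)%O)
    c i *: path_elt K (upd (pstart p) i (pend p)).

Lemma path_reduce p : exists c, bqa_proj A (upd_rel p c) = 0.
Proof.
have [a1 a2 b1 b2] := abP.
have [c cE] := cell_coord hA vP wP (b := b^~ (pstart p)) a1 a2 (fun t => b1 t _) (fun t => b2 t _) (corner_path_image A p).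
exists c; rewrite rmorphB rmorph_sum -[bqa_proj A (path_elt K p)]/(path_image A p) cE.
apply/eqP; rewrite subr_eq0; apply/eqP; apply: eq_bigr => i /andP[ji ki].
by rewrite bqa_projZ; have [_ _ _ _ <-] := updP ji ki.
Qed.

(* An arrow minus its expansion in the basis lies in the admissible ideal, so the
   arrow itself has to occur among the paths of the expansion. *)
Lemma arrow_chosen g : descending g || ascending g.
Proof.
have [c /ker_min_length2 /(_ (arrow_path g) isT)] := path_reduce (arrow_path g).
rewrite /upd_rel mcoeffB mcoeff_path eqxx raddf_sum /= => /eqP; rewrite subr_eq0 => /eqP h.
apply: contraPP h => /negP ng; rewrite big1 ?mulr1n; first by apply/eqP; rewrite oner_eq0.
move=> i /andP[ji ki]; rewrite mcoeffZ mcoeff_path.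
have [_ _ _ al _] := updP ji ki; case: eqP => [E|_]; last by rewrite mulr0.
by move: al; rewrite E /parrows /= andbT (negPf ng).
Qed.

Lemma cover_neighbours i k : cover (fun i k => i <= k)%O i k <-> neighbours i k /\ (i <= k)%O.
Proof.
split=> [/and3P[ik lik /forallP co]|[[ik cmp btw] lik]].
  split=> //; split; [exact/eqP | by rewrite /Order.comparable lik|].
  move=> m; split; apply/negP => /andP[h1 h2].
    have := co m; rewrite !ltW //= => /orP[] /eqP h.
      by rewrite h ltxx in h1.
    by rewrite h ltxx in h2.
  by have := lt_geF (lt_trans h1 h2); rewrite lik.
rewrite /cover lik; apply/and3P; split=> //; first exact/eqP.
apply/forallP => m; apply/implyP => /andP[im mk]; have [h _] := btw m.
by move: h; rewrite !lt_neqAle im mk !andbT negb_and !negbK eq_sym.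
Qed.

Lemma cover_converse i k : cover (fun i k => k <= i)%O i k = cover (fun i k => i <= k)%O k i.
Proof.
rewrite /cover eq_sym; congr [&& _, _ & _]; apply: eq_forallb => m.
by rewrite andbC orbC.
Qed.

Lemma neighboursC i k : neighbours i k -> neighbours k i.
Proof.
case=> h1 h2 h3; split; [by move=> h; apply: h1 | by rewrite comparable_sym|].
by move=> m; have [] := h3 m.
Qed.

Lemma arrow_neighbours (g : arrow Q) : neighbours (source g) (target g).
Proof.
case/orP: (arrow_chosen g) => /chosen_cover; last by case/cover_neighbours.
by rewrite cover_converse => /cover_neighbours[] /neighboursC.
Qed.

Lemma one_arrow i j : neighbours i j -> #|arrows_from_to Q i j| = 1%N.
Proof.
move=> nb; suff [g gij guniq] : exists2 g : arrow Q, g \in arrows_from_to Q i j &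
    forall h, h \in arrows_from_to Q i j -> h = g.
  by apply/eqP/cards1P; exists g; apply/setP => h; rewrite inE; apply/idP/eqP => [/guniq|->].
have [_ cmp _] := nb; case/orP: cmp => [ij|ji].
  have /cover_neighbours := conj nb ij.
  case/(chosen_exists (raisesP hA nT wP)) => g [cg sg tg].
  exists g; first by rewrite inE sg tg !eqxx.
  move=> h; rewrite inE => /andP[/eqP sh /eqP th]; case/orP: (arrow_chosen h) => ch.
    have := descending_cover ch; rewrite sh th => h'.
    by have := lt_geF h'; rewrite ij.
  by apply: (chosen_uniq ch cg); rewrite ?sh ?th.
have /cover_neighbours := conj (neighboursC nb) ji; rewrite -cover_converse.
case/(chosen_exists (lowersP hA nT vP)) => g [cg sg tg].
exists g; first by rewrite inE sg tg !eqxx.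
move=> h; rewrite inE => /andP[/eqP sh /eqP th]; case/orP: (arrow_chosen h) => ch.
  by apply: (chosen_uniq ch cg); rewrite ?sh ?th.
have := ascending_cover ch; rewrite sh th => h'.
by have := lt_geF h'; rewrite ji.
Qed.

Lemma quiver_is_double i j :
  ((exists g : arrow Q, g \in arrows_from_to Q i j \/ g \in arrows_from_to Q j i)
     <-> neighbours i j) /\
  (neighbours i j -> #|arrows_from_to Q i j| = 1%N /\ #|arrows_from_to Q j i| = 1%N).
Proof.
split; last by move=> nb; split; apply: one_arrow => //; apply: neighboursC.
split=> [[g []]|nb].
- by rewrite inE => /andP[/eqP <- /eqP <-]; apply: arrow_neighbours.
- by rewrite inE => /andP[/eqP <- /eqP <-]; apply/neighboursC/arrow_neighbours.
have /eqP/cards1P[g E] := one_arrow nb; exists g; left.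
by rewrite E inE.
Qed.

(** Stated for any ideal containing the relations: it is applied to the ideal that they generate,
    before this is known to be the whole kernel. *)
Lemma upd_normal_form (I : classical_sets.set KQ) : is_ideal I ->
  (forall p c, bqa_proj A (upd_rel p c) = 0 -> I (upd_rel p c)) ->
  forall x : KQ, exists c : Q0 -> Q0 -> Q0 -> K,
    I (x - \sum_j \sum_k \sum_(i | (j <= i)%O && (k <= i)%O) c j k i *: path_elt K (upd j i k)).
Proof.
move=> Iid hI; have [I0 ID _ _] := Iid.
apply: kq_ind => [|c p x [f fI]].
  exists (fun _ _ _ => 0); rewrite big1 ?subr0 // => j _; rewrite big1 // => k _.
  by rewrite big1 // => i _; rewrite scale0r.
have [g gE] := path_reduce p.
pose h j k i : K := c * ((pstart p == j) && (pend p == k))%:R * g i + f j k i.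
exists h.
have -> : \sum_j \sum_k \sum_(i | (j <= i)%O && (k <= i)%O) h j k i *: path_elt K (upd j i k) =
   c *: (\sum_(i | (pstart p <= i)%O && (pend p <= i)%O) g i *: path_elt K (upd (pstart p) i (pend p))) +
   \sum_j \sum_k \sum_(i | (j <= i)%O && (k <= i)%O) f j k i *: path_elt K (upd j i k).
  have -> : c *: (\sum_(i | (pstart p <= i)%O && (pend p <= i)%O) g i *: path_elt K (upd (pstart p) i (pend p))) =
    \sum_j \sum_k \sum_(i | (j <= i)%O && (k <= i)%O)
      (c * ((pstart p == j) && (pend p == k))%:R * g i) *: path_elt K (upd j i k).
    rewrite [RHS](bigD1 (pstart p)) //= [X in X + _](bigD1 (pend p)) //= !eqxx.
    rewrite [X in _ + X]big1 ?addr0; last first.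
      move=> j /negPf jp; rewrite big1 // => k _; rewrite big1 // => i _.
      by rewrite eq_sym jp /= mulr0 mul0r scale0r.
    rewrite [X in _ + X]big1 ?addr0; last first.
      move=> k /negPf kp; rewrite big1 // => i _.
      by rewrite [_ == k]eq_sym kp /= mulr0 mul0r scale0r.
    by rewrite scaler_sumr; apply: eq_bigr => i _; rewrite scalerA mulr1.
  rewrite -big_split; apply: eq_bigr => j _; rewrite -big_split; apply: eq_bigr => k _.
  by rewrite -big_split; apply: eq_bigr => i _ /=; rewrite /h scalerDl.
rewrite opprD addrACA -scalerBr; apply: ID => //.
by apply: idealZ => //; apply: hI.
Qed.

(** [X] consists of all up-down relations that hold. Modulo these an element of the kernel becomes a
    combination of the paths [upd j i k]; it still maps to zero, and the bases of the corners make
    all its coefficients vanish. *)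
Lemma ideal_generated : exists X : classical_sets.set KQ,
  subset X (up_down_relations upd) /\ bqa_ideal A = ideal_gen X.
Proof.
pose X : classical_sets.set KQ := (fun x => up_down_relations upd x /\ bqa_ideal A x).
have [Iid _] := bqa_admissible A.
exists X; split; first by move=> x [].
apply/seteqP; split=> [x Ix|]; last by apply: ideal_gen_sub => // x [].
have Xid := ideal_gen_ideal X.
have [|c cI] := upd_normal_form Xid _ x.
  move=> p c h; apply: ideal_gen_in; split; last exact/bqa_proj_ker.
  by exists p, c.
set S := (X in x - X) in cI.
suff S0 : S = 0 by rewrite S0 subr0 in cI.
have /bqa_proj_ker IS : bqa_ideal A S.
  have : bqa_ideal A (x - S) by apply: (ideal_gen_sub Iid _ cI) => y [].
  move=> h; have [_ ID _ _] := Iid; rewrite -[S](subKr x); apply: ID => //.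
  by rewrite -scaleN1r; apply: idealZ.
have [a1 a2 b1 b2] := abP.
have IE : bqa_proj A S = \sum_j \sum_k \sum_(i | (j <= i)%O && (k <= i)%O) c j k i *: (a k i * b i j).
  rewrite rmorph_sum; apply: eq_bigr => j _; rewrite rmorph_sum; apply: eq_bigr => k _.
  rewrite rmorph_sum; apply: eq_bigr => i /andP[ji ki]; rewrite bqa_projZ.
  by have [_ _ _ _ <-] := updP ji ki.
have cor j k j' k' i : (j <= i)%O -> (k <= i)%O ->
    e k' * (a k i * b i j) * e j' = ((k == k') && (j == j'))%:R *: (a k i * b i j).
  move=> ji ki; have abk := cornerM (a1 k i ki).1 (b1 i j ji).1.
  have [<-|kk] := eqVneq k k'; last by rewrite (corner_l0 abk) 1?eq_sym // mul0r scale0r.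
  have [ek _] := (cornerP _ _ _).1 abk.
  have [<-|jj] := eqVneq j j'; last by rewrite ek (corner_r0 abk) // scale0r.
  by have [_ ej] := (cornerP _ _ _).1 abk; rewrite ek ej scale1r.
rewrite /S big1 // => j _; rewrite big1 // => k _; rewrite big1 // => i /andP[ji ki].
suff -> : c j k i = 0 by rewrite scale0r.
apply: (cell_free hA vP wP (b := b^~ j) a1 a2 (fun t => b1 t _) (fun t => b2 t _) (k := k)) => //.
(* Cutting by $e_k$ and $e_j$ isolates the part that runs from [j] to [k], where the cells are
   independent. *)
have : e k * bqa_proj A S * e j = 0 by rewrite IS mulr0 mul0r.
rewrite IE mulr_sumr mulr_suml (bigD1 j) //= mulr_sumr mulr_suml (bigD1 k) //=.
rewrite [X in _ + X]big1 ?addr0; last first.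
  move=> j' jj; rewrite mulr_sumr mulr_suml big1 // => k' _; rewrite mulr_sumr mulr_suml big1 // => m /andP[jm km].
  by rewrite -scalerAr -scalerAl cor // (negPf jj) andbF scale0r scaler0.
rewrite [X in _ + X]big1 ?addr0; last first.
  move=> k' kk; rewrite mulr_sumr mulr_suml big1 // => m /andP[jm km].
  by rewrite -scalerAr -scalerAl cor // (negPf kk) scale0r scaler0.
move=> h; rewrite -[RHS]h mulr_sumr mulr_suml; apply: eq_bigr => m /andP[jm km].
by rewrite -scalerAr -scalerAl cor // !eqxx scale1r.
Qed.

End Fixed.
End QuiverRelations.

Lemma all2_rev (T S : Type) (r : T -> S -> bool) s t : all2 r (rev s) (rev t) = all2 r s t.
Proof.
rewrite !all2E !size_rev; case: eqP => //= sz; rewrite -rev_zip // all_rev.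
by [].
Qed.

Lemma pairwise_rev (T : Type) (r : rel T) s :
  pairwise r (rev s) = pairwise (fun x y => r y x) s.
Proof.
by elim: s => //= x s IH; rewrite rev_cons pairwise_rcons all_rev IH.
Qed.

(** * Good filtrations *)

Section Filtrations.
Variables (K : fieldType) (d : Order.disp_t) (Q0 : finPOrderType d).
Variables (Q : quiver Q0) (A : boundQuiverAlgebra K Q).
Hypothesis hA : one_quasi_hereditary A.
Local Notation module := (module A).
Local Notation e := (@videm K Q0 Q A).
Local Notation D := (@standard K d Q0 Q A).
Local Notation corner := (corner A).
Implicit Types (i k l t x y : Q0).

(** A layer whose label is not above [k] is killed by $e_k$, so $e_kz$ slides down the whole
    chain. *)
Lemma chain_zero M (W : submodule M) s lb k : chain D W s lb ->
  all (fun l => ~~ (k <= l)%O) lb -> forall z, z \in (last W s : {vspace M}) ->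
  mact (e k) z \in (W : {vspace M}).
Proof.
elim: s W lb => [|V s IH] W [|l lb] //=; first by move=> _ _ z zW; apply: smP.
case=> WV lay ch /andP[kl al] z /(IH _ _ ch al) ez.
by rewrite -act_idem (layer_zero lay).
Qed.

Lemma chain_label_inj M (W : submodule M) s lb lb' :
  chain D W s lb -> chain D W s lb' -> lb = lb'.
Proof.
elim: s W lb lb' => [|V s IH] W [|l lb] [|l' lb'] //= [WV lay ch] [_ lay' ch'].
rewrite (IH _ _ _ ch ch'); congr (_ :: _).
apply: (standard_inj hA) => k; apply: (@addnI (subdim_at W k)).
exact: etrans (esym (layer_subdim k WV lay)) (layer_subdim k WV lay').
Qed.

Lemma subquo_standard M (W V : submodule M) y g :
  g \in (V : {vspace M}) -> mact (e y) g = g ->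
  (forall z, z \in (V : {vspace M}) -> exists a, z - mact a g \in (W : {vspace M})) ->
  (forall k z, ~~ (k <= y)%O -> z \in (V : {vspace M}) -> mact (e k) z \in (W : {vspace M})) ->
  (forall k, (k <= y)%O -> exists2 z, z \in (V : {vspace M}) & mact (e k) z \notin (W : {vspace M})) ->
  isomorphic (subquotient W V) (D y).
Proof.
move=> gV eg gen zero nz.
pose q (z : sm_module V) : subquotient W V := quo_pi (sm_inside V W) z.
have qE (u : subquotient W V) : exists z : sm_module V, u = q z.
  by exists (vsval u); rewrite /q quo_piK.
have q0 z : (q z == 0) = (vsval z \in (W : {vspace M})) by rewrite quo_pi_eq0 mem_inside.
have qa a z : q (mact a z) = mact a (q z) by exact: quo_act.
have qB z z' : q (z - z') = q z - q z' by exact: linearB.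
apply: (@standard_char _ _ _ _ _ y _ (q (Subvs gV))).
- move=> k; rewrite (dim_at_standard hA y k); have [ky|//] := boolP (k <= y)%O.
  have [z zV ez] := nz k ky; rewrite lt0n; apply/eqP => /dim_at_eq0 /(_ (q (Subvs zV))).
  by rewrite -qa => /eqP; rewrite q0 (negPf ez).
- by rewrite -qa; congr q; apply: val_inj.
- move=> u; have [z ->] := qE u; have [a aE] := gen _ (subvsP z); exists a.
  by rewrite -qa; apply/eqP; rewrite -subr_eq0 -qB q0.
- move=> k u ky; have [z ->] := qE u; apply/eqP; rewrite -qa q0.
  by apply: zero => //; apply: subvsP.
Qed.

Variables (n : Q0) (v w : Q0 -> A) (a b : Q0 -> Q0 -> A).
Hypothesis nT : forall i, (i <= n)%O.
Hypothesis vP : forall t, v t \in corner t n /\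
  forall k, (k <= t)%O <-> exists2 x, x \in corner k t & x * v t != 0.
Hypothesis wP : forall t, w t \in corner n t /\
  forall k, (k <= t)%O <-> exists2 x, x \in corner t k & w t * x != 0.
Hypothesis abP : cell_families v w a b.
Variable i : Q0.
Local Notation P := (projective A i).

(** Any [b t i] not killed by $w_t$ serves for a basis, so for $t\ge y$ it may be routed through
    [y]. In the resulting basis of $e_yAe_i$ every vector has [b y i] as its right factor. *)
Lemma corner_gen y z : (i <= y)%O -> z \in corner y i -> exists2 rho, rho \in corner y y & z = rho * b y i.
Proof.
move=> iy zy; have [a1 a2 b1 b2] := abP.
pose b' t := if (y <= t)%O then b t y * b y i else b t i.
have b'1 t : (i <= t)%O -> b' t \in corner t i /\ w t * b' t != 0.
  move=> it; rewrite /b'; case: ifP => yt; last exact: b1.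
  have [h1 h2] := b1 t y yt; have [h3 h4] := b1 y i iy; split; first exact: cornerM h1 h3.
  (* $w_tb_{ty}$ is a nonzero multiple of $w_y$, and $w_y$ does not kill [b y i]. *)
  have [c cE] := w_line hA nT wP (cornerM (wP t).1 h1).
  rewrite mulrA cE -scalerAl scaler_eq0 negb_or h4 andbT.
  by apply: contraNneq h2 => c0; rewrite cE c0 scale0r.
have b'2 t : ~~ (i <= t)%O -> b' t = 0.
  move=> it; rewrite /b'; case: ifP => yt; last exact: b2.
  by case/negP: it; apply: le_trans iy yt.
have [c ->] := cell_coord hA vP wP a1 a2 b'1 b'2 zy.
exists (\sum_(t | (i <= t)%O && (y <= t)%O) c t *: (a y t * b t y)).
  apply: memv_suml => t /andP[it yt]; apply: memvZ; apply: cornerM (b1 t y yt).1.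
  exact: (a1 y t yt).1.
by rewrite mulr_suml; apply: eq_bigr => t /andP[it yt]; rewrite /b' yt mulrA scalerAl.
Qed.

(** By [corner_gen] this vector generates $e_yP(i)$ over the local ring $e_yAe_y$. *)
Definition bvec y : P := mact (b y i) (pgen A i).

Lemma pval_bvec y : (i <= y)%O -> pval (bvec y) = b y i.
Proof.
move=> iy; have [_ _ b1 _] := abP; rewrite /bvec pval_act pval_gen.
by have [_ ->] := (cornerP _ _ _).1 (b1 y i iy).1.
Qed.

Lemma bvecE y : (i <= y)%O -> mact (e y) (bvec y) = bvec y.
Proof.
move=> iy; have [_ _ b1 _] := abP; rewrite /bvec -mactM.
by have [-> _] := (cornerP _ _ _).1 (b1 y i iy).1.
Qed.

Lemma pval_corner y (z : P) : pval (mact (e y) z) \in corner y i.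
Proof. by apply/cornerP; rewrite pval_e pval_act videm_mulK. Qed.

Lemma bvec_gen y (z : P) : (i <= y)%O -> exists rho, mact (e y) z = mact rho (bvec y).
Proof.
move=> iy; have [rho _ E] := corner_gen iy (pval_corner y z); exists rho.
by apply: pval_inj; rewrite E [RHS]pval_act pval_bvec.
Qed.

(* [w_y] kills the radical of the local ring [e_y A e_y], so it detects the units. *)
Lemma bvec_of_w y (z : P) : (i <= y)%O -> w y * pval z != 0 -> mact (e y) z = z ->
  exists c, bvec y = mact c z.
Proof.
move=> iy wz ez; have [rho rhoy E] := corner_gen iy (pval_corner y z).
rewrite ez in E; have [er re] := (cornerP _ _ _).1 rhoy.
have [c cE] := w_line hA nT wP (cornerM (wP y).1 rhoy).
have c0 : c != 0.
  by apply: contraNneq wz => c0; rewrite E mulrA cE c0 scale0r mul0r.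
have [f jf] := corner_local y rho; rewrite er re in jf.
have f0 : f != 0.
  (* Otherwise [rho] would be nilpotent, although $w_y$ is an eigenvector for it with the nonzero
     eigenvalue [c]. *)
  apply/eqP => f0; rewrite f0 scale0r subr0 in jf.
  have [m rm] := arrow_rad_nilp jf.
  have wr (q : nat) : w y * rho ^+ q = c ^+ q *: w y.
    elim: q => [|q IH]; first by rewrite !expr0 mulr1 scale1r.
    by rewrite exprSr mulrA IH -scalerAl cE scalerA exprSr.
  have /eqP := wr m; rewrite rm mulr0 eq_sym scaler_eq0 expf_eq0 (negPf c0) andbF /=.
  by rewrite (negPf (w_neq0 wP y)).
have [c' c'E] := @corner_inv _ _ _ A y rho f f0 (etrans (congr1 (fun z => z * e y) er) re) jf.
exists c'; apply: pval_inj; rewrite [RHS]pval_act E mulrA c'E pval_bvec //.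
by have [_ _ b1 _] := abP; have [-> _] := (cornerP _ _ _).1 (b1 y i iy).1.
Qed.

(* If [x > y], then modulo [W] the generator of [e_y P(i)] is a multiple of that of
   [e_x P(i)], hence killed by [w_y]; so some element of [W] is not killed by [w_y]. *)
Lemma layer_top (W V : submodule P) s2 (l2 : seq Q0) x y :
  layer W V (D x) -> chain D V s2 l2 -> last V s2 = sm_full P ->
  (i <= y)%O -> (y <= x)%O -> all (fun l => ~~ (y <= l)%O) l2 -> x = y.
Proof.
move=> lay ch la iy yx al; apply/eqP/negPn/negP => xy.
have ix : (i <= x)%O by apply: le_trans yx.
have full z : z \in (last V s2 : {vspace P}) by rewrite la memvf.
(* No later label is at or above [y], so all of $e_yP(i)$ lies in [V]. *)
have eyV z : mact (e y) z \in (V : {vspace P}) := chain_zero ch al (full z).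
have al' : all (fun l => ~~ (x <= l)%O) l2.
  by apply: sub_all al => l; apply: contra; apply: le_trans.
have exV z : mact (e x) z \in (V : {vspace P}) := chain_zero ch al' (full z).
(* The layer has a vector of $e_kV$ outside [W], and this vector is a multiple of [bvec k]. *)
have notW k : (i <= k)%O -> (k <= x)%O -> bvec k \notin (W : {vspace P}).
  move=> ik kx; apply/negP => bW; have [z [zV ez zW]] := layer_vect hA lay kx.
  by case/negP: zW; rewrite -ez; have [rho ->] := bvec_gen z ik; apply: smP.
have bxV : bvec x \in (V : {vspace P}) by rewrite -(bvecE ix); exact: exV.
have byV : bvec y \in (V : {vspace P}) by rewrite -(bvecE iy); exact: eyV.
have [c cW] := layer_gen hA lay bxV (bvecE ix) (notW x ix (lexx x)) byV.
pose m := mact (e y) (bvec y - mact c (bvec x)).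
have mW : m \in (W : {vspace P}) by apply: smP.
have [_ _ b1 _] := abP; have wm : w y * pval m != 0.
  have -> : pval m = b y i - (e y * c * e x) * b x i.
    have [ey _] := (cornerP _ _ _).1 (b1 y i iy).1; have [ex _] := (cornerP _ _ _).1 (b1 x i ix).1.
    rewrite /m pval_act pvalB pval_act (pval_bvec ix) (pval_bvec iy) mulrBr ey.
    congr (_ - _).
    exact: etrans (mulrA _ _ _) (etrans (congr1 ( *%R (e y * c)) (esym ex)) (mulrA _ _ _)).
  rewrite mulrBr mulrA; have -> : w y * (e y * c * e x) = 0.
    apply/eqP/negPn/negP => h; have [_ /(_ x)[_ hx]] := wP y.
    have xy' : (x <= y)%O by apply: hx; exists (e y * c * e x); rewrite ?corner_proj.
    by case/negP: xy; rewrite eq_le xy' yx.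
  rewrite mul0r subr0; exact: (b1 y i iy).2.
have [c' c'E] := bvec_of_w iy wm (act_idem _ _).
by case/negP: (notW y iy yx); rewrite c'E smP.
Qed.

Definition upper (F : seq Q0) : submodule P := vertex_submodule A (fun l => l \in F) i.

(* Labels are listed from bottom to top, the order opposite to [factor_labels]. *)
Fixpoint upper_filtration (F lb : seq Q0) : seq (submodule P) :=
  if lb is y :: lb' then upper (rcons F y) :: upper_filtration (rcons F y) lb' else [::].

Lemma upper_act F l (z : P) : l \in F -> mact (e l) z \in (upper F : {vspace P}).
Proof. by move=> lF; rewrite mem_vertex_submodule pval_act; apply: vertex_ideal_mulr; apply: vertex_ideal_e. Qed.

(** With [upper_act], this makes [upper F] the least submodule containing every $e_lP(i)$ with $l\in
    F$; all later comparisons of submodules rest on that. *)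
Lemma upper_min F (V : submodule P) :
  (forall l z, l \in F -> mact (e l) z \in (V : {vspace P})) -> (upper F <= V)%VS.
Proof.
move=> h; apply/subvP => z; rewrite mem_vertex_submodule => zF; rewrite -(pvalK z).
have fl : linear (fun c => mact c (pgen A i)) by move=> c x y; rewrite mactDl mactZl.
rewrite -(hom_ofE fl) memv_preim; apply: (subvP _ _ zF); apply: vertex_ideal_sub => l u u' lF.
by rewrite -memv_preim hom_ofE !mactM; apply: smP; apply: h.
Qed.

Definition up_order (lb : seq Q0) := pairwise (fun y x => ~~ (y <= x)%O) lb.

Lemma upper0 : upper [::] = sm_zero P.
Proof.
apply: sm_eq; rewrite ?sub0v //; exact: upper_min.
Qed.

Lemma upper_full F : i \in F -> upper F = sm_full P.
Proof.
move=> iF; apply: sm_eq; rewrite ?subvf //; apply/subvP => z _; rewrite -(pvalK z).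
by apply: smP; rewrite -pgenE; apply: upper_act.
Qed.

(** A product through $l\in F$ expands in cells with $t\ge l$. Those with $t\ge i$ stay in [F],
    which is closed upwards there, and the others are zero. *)
Lemma vertex_ideal_cells (F : seq Q0) k z : (forall l t, l \in F -> (l <= t)%O -> (i <= t)%O -> t \in F) ->
  z \in vertex_ideal A (fun l => l \in F) -> e k * z * e i \in (\sum_(t | t \in F) <[a k t * b t i]>)%VS.
Proof.
move=> upF zF; have [a1 a2 b1 b2] := abP.
have : z \in ((amulr (e i) \o amull (e k)) @^-1: \sum_(t | t \in F) <[a k t * b t i]>)%VS.
  apply: (subvP _ _ zF); apply: vertex_ideal_sub => l u u' lF.
  rewrite -memv_preim comp_lfunE !lfunE /=.
  rewrite corner_split.
  have := cell_mul hA vP wP a1 a2 (fun t => b1 t i) (fun t => b2 t i) (corner_proj k l u) (corner_proj l i u').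
  apply: subvP; apply/subv_sumP => t lt; have [it|/b2 ->] := boolP (i <= t)%O.
    by apply: (sumv_sup t); rewrite ?subvv //; apply: upF lt it.
  by rewrite mulr0 -memvE mem0v.
by rewrite -memv_preim comp_lfunE !lfunE.
Qed.

(** [bvec y] generates the layer because $e_yAe_i$ is a line modulo $T_y$. The layer is no smaller
    than $\Delta(y)$ because the cell [a k y * b y i] is independent of the cells with $t\in F$. *)
Lemma upper_layer F y : (i <= y)%O -> y \notin F -> (forall l, (y < l)%O -> l \in F) ->
  (forall l t, l \in F -> (l <= t)%O -> (i <= t)%O -> t \in F) ->
  isomorphic (subquotient (upper F) (upper (rcons F y))) (D y).
Proof.
move=> iy yF gtF upF; have [a1 a2 b1 b2] := abP.
have abF : (above A y <= vertex_ideal A (fun l => l \in F))%VS by apply: vertex_idealS => l; apply: gtF.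
have [by1 by2] := b1 y i iy; have [eb be] := (cornerP _ _ _).1 by1.
have gen (z : P) : z \in (upper (rcons F y) : {vspace P}) ->
    exists c, z - mact c (bvec y) \in (upper F : {vspace P}).
  rewrite mem_vertex_submodule => zF.
  have : pval z \in (amulr (e i) @^-1: (limg (amulr (b y i)) + vertex_ideal A (fun l => l \in F)))%VS.
    apply: (subvP _ _ zF); apply: vertex_ideal_sub => l u u'; rewrite mem_rcons inE -memv_preim lfunE /=.
    case/orP=> [/eqP ->|lF]; last first.
      by apply: (subvP (addvSr _ _)); apply: vertex_ideal_mulr; apply: vertex_ideal_gen.
    have bT : b y i \notin above A y by apply: contraNN by2 => /(above_w wP) ->.
    have [c cE] := corner_left_line hA by1 bT (corner_proj y i u').
    have -> : u * e y * u' * e i = u * (c *: b y i) + u * (e y * u' * e i - c *: b y i).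
      by rewrite -mulrDr addrC subrK !mulrA.
    apply: memv_add; last by apply: vertex_ideal_mull; apply: (subvP abF).
    by rewrite -scalerAr memvZ //; apply/memv_imgP; exists u; rewrite ?memvf // lfunE.
  rewrite -memv_preim lfunE => h.
  have {}h : pval z * e i \in (limg (amulr (b y i)) + vertex_ideal A (fun l => l \in F))%VS := h.
  rewrite pval_e in h; have /memv_addP[_ /memv_imgP[c _ ->] [u uF zE]] := h.
  exists c; rewrite mem_vertex_submodule pvalB pval_act (pval_bvec iy) zE lfunE.
  by rewrite addrAC subrr add0r.
have zero k c : ~~ (k <= y)%O -> mact (e k) (mact c (bvec y)) \in (upper F : {vspace P}).
  move=> ky; rewrite mem_vertex_submodule pval_act pval_act (pval_bvec iy) -[b y i]eb.
  suff -> : e k * (c * (e y * b y i)) = e k * c * e y * b y i.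
    by apply: vertex_ideal_mulr; apply: (subvP abF); apply: (corner_right_zero hA ky); apply: corner_proj.
  exact: etrans (mulrA _ _ _) (mulrA _ _ _).
apply: (@subquo_standard _ _ _ y (bvec y)).
- by rewrite -(bvecE iy); apply: upper_act; rewrite mem_rcons inE eqxx.
- exact: bvecE.
- exact: gen.
- move=> k z ky /gen[c cE]; rewrite -[z](subrK (mact c (bvec y))) linearD.
  by apply: memvD; [apply: smP cE | apply: zero].
move=> k ky; exists (mact (a k y) (bvec y)).
  by apply: smP; rewrite -(bvecE iy); apply: upper_act; rewrite mem_rcons inE eqxx.
have [ak av] := a1 k y ky; have [ea ae] := (cornerP _ _ _).1 ak.
rewrite -mactM ea mem_vertex_submodule pval_act pval_bvec //; apply/negP => h.
have := vertex_ideal_cells k upF h; have /cornerP[-> ->] := cornerM ak by1.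
case/memv_sumP => m mE E.
have mc t : exists c, t \in F -> m t = c *: (a k t * b t i).
  case: (boolP (t \in F)) => [tF|_]; last by exists 0.
  by have /vlineP[c ->] := mE t tF; exists c.
have [c cE] := choice mc.
(* The coefficients of the relation equating the cell at [y] with its supposed expansion over [F];
   the one at [y] is 1. *)
pose c' t : K := (t == y)%:R - (if t \in F then c t else 0).
suff /(_ y iy ky) : forall t, (i <= t)%O -> (k <= t)%O -> c' t = 0.
  by rewrite /c' eqxx (negPf yF) subr0 => /eqP; rewrite oner_eq0.
apply: (cell_free hA vP wP a1 a2 (fun t => b1 t i) (fun t => b2 t i) (k := k)).
have z0 t : ~~ ((i <= t)%O && (k <= t)%O) -> a k t * b t i = 0.
  by rewrite negb_and => /orP[/b2 ->|/a2 ->]; rewrite ?mulr0 ?mul0r.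
have -> : \sum_(t | (i <= t)%O && (k <= t)%O) c' t *: (a k t * b t i) = \sum_t c' t *: (a k t * b t i).
  by rewrite big_mkcond; apply: eq_bigr => t _; case: ifPn => // /z0 ->; rewrite scaler0.
rewrite /c' (eq_bigr (fun t => (t == y)%:R *: (a k t * b t i) - (if t \in F then m t else 0))).
  rewrite sumrB -big_mkcond -E (bigD1 y) //= eqxx scale1r big1 ?addr0 ?subrr // => t /negPf ->.
  by rewrite scale0r.
by move=> t _; rewrite scalerBl; case: ifP => [tF|_]; rewrite ?cE ?scale0r.
Qed.

(** The sequences of the theorem read from bottom to top. Repetitions are excluded since the
    relation in [up_order] is irreflexive. *)
Definition complete (lb : seq Q0) := up_order lb /\ lb =i [pred l | (i <= l)%O].

Lemma complete_step F y lb : complete (F ++ y :: lb) ->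
  [/\ (i <= y)%O, y \notin F, forall l, (y < l)%O -> l \in F,
      forall l t, l \in F -> (l <= t)%O -> (i <= t)%O -> t \in F
    & all (fun l => ~~ (y <= l)%O) lb].
Proof.
case=> po mem; move: po; rewrite /up_order pairwise_cat /= => /and4P[/allrelP Fy pF ylb plb].
have iy : (i <= y)%O by have := mem y; rewrite mem_cat !inE eqxx orbT => /esym.
split=> //.
- by apply/negP => yF; have := Fy y y yF (mem_head _ _); rewrite lexx.
- move=> l yl; have := mem l; rewrite mem_cat !inE (le_trans iy (ltW yl)).
  case/or3P=> // [/eqP ly|/(allP ylb)]; first by rewrite ly ltxx in yl.
  by rewrite ltW.
- move=> l t lF lt it; have := mem t; rewrite mem_cat [RHS]inE it => /orP[//|tlb].
  by have := Fy l t lF tlb; rewrite lt.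
Qed.

Lemma upper_filtration_last F lb : last (upper F) (upper_filtration F lb) = upper (F ++ lb).
Proof.
by elim: lb F => [|y lb IH] F /=; rewrite ?cats0 // IH cat_rcons.
Qed.

Lemma upper_filtration_chain F lb : complete (F ++ lb) ->
  chain D (upper F) (upper_filtration F lb) lb.
Proof.
elim: lb F => [|y lb IH] F //= co; have [iy yF gtF upF _] := complete_step co.
have sub : (upper F <= upper (rcons F y))%VS.
  by apply: upper_min => l z lF; apply: upper_act; rewrite mem_rcons inE lF orbT.
split; [exact: sub | exact/iso_layer/upper_layer | by apply: IH; rewrite cat_rcons].
Qed.

(** The labels determine the submodules: no later layer meets $e_yP(i)$, so [V] contains it, and
    modulo [upper F] the layer is generated by a vector of $e_yV$. *)
Lemma chain_upper F lb s : complete (F ++ lb) -> chain D (upper F) s lb ->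
  last (upper F) s = sm_full P -> s = upper_filtration F lb.
Proof.
elim: lb F s => [|y lb IH] F [|V s] //= co [FV lay ch] la.
have [iy yF gtF upF al] := complete_step co.
have eyV z : mact (e y) z \in (V : {vspace P}).
  by apply: (chain_zero ch al); rewrite la memvf.
have VE : V = upper (rcons F y).
  apply: sm_eq; last first.
    apply: upper_min => l z; rewrite mem_rcons inE => /orP[/eqP -> //|lF].
    by apply: (subvP FV); apply: upper_act.
  have [g [gV eg gF]] := layer_vect hA lay (lexx y).
  apply/subvP => z zV; have [c cE] := layer_gen hA lay gV eg gF zV.
  rewrite -[z](subrK (mact c g)) memvD //.
    have sub : (upper F <= upper (rcons F y))%VS.
      by apply: upper_min => l u lF; apply: upper_act; rewrite mem_rcons inE lF orbT.
    exact: (subvP sub).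
  by apply: smP; rewrite -eg; apply: upper_act; rewrite mem_rcons inE eqxx.
subst V; congr (_ :: _); apply: IH => //; by rewrite cat_rcons.
Qed.

Lemma chain_complete s lb : chain D (sm_zero P) s lb -> last (sm_zero P) s = sm_full P ->
  complete lb.
Proof.
move=> ch la; have [un mem] := chain_labels hA la ch; split=> //.
have top lb1 x lb2 y : lb = lb1 ++ x :: lb2 -> (i <= y)%O -> (y <= x)%O ->
    all (fun l => ~~ (y <= l)%O) lb2 -> x = y.
  move=> lbE iy yx al; have sz := chain_size ch.
  have szl : size lb1 = size (take (size lb1) s).
    by rewrite size_takel // sz lbE size_cat leq_addr.
  move: ch la; rewrite -(cat_take_drop (size lb1) s) lbE => /(chain_cat _ _ _ _ (esym szl))[_].
  case: (drop _ s) => [|V s2] //= [_ lay ch]; rewrite last_cat /= => la.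
  exact: (layer_top lay ch la iy yx al).
(* [layer_top] controls only the last label at or above [y], so the list is peeled from its end:
   that last label must be [y] itself, and hence does not occur in [lb2]. *)
have key lb1 lb2 y : lb = lb1 ++ lb2 -> (i <= y)%O -> y \notin lb2 -> all (fun l => ~~ (y <= l)%O) lb2.
  elim: lb2 lb1 => [|x lb2 IH] lb1 //= lbE iy; rewrite inE negb_or => /andP[yx ylb].
  have al : all (fun l => ~~ (y <= l)%O) lb2 by apply: (IH (rcons lb1 x)); rewrite // cat_rcons.
  rewrite al andbT; apply: contraNN yx => yx.
  by rewrite (top _ _ _ _ lbE iy yx al).
have pw lb1 lb2 : lb = lb1 ++ lb2 -> up_order lb2.
  elim: lb2 lb1 => [|x lb2 IH] lb1 // lbE; rewrite /up_order pairwise_cons.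
  apply/andP; split; last by apply: (IH (rcons lb1 x)); rewrite cat_rcons.
  apply: (key (rcons lb1 x)); rewrite ?cat_rcons //.
    by have := mem x; rewrite lbE mem_cat !inE eqxx orbT => /esym.
  by move: un; rewrite lbE cat_uniq /= => /and4P[].
exact: (pw [::]).
Qed.

Lemma complete_sequence (t : seq Q0) : complete (rev t) <-> filtration_sequences i t.
Proof.
rewrite /complete /up_order pairwise_rev; split=> [[pw mem]|[sz al pw]].
  have irr : irreflexive (fun x y : Q0 => ~~ (y <= x)%O).
    by move=> x; rewrite lexx.
  split=> //; last by apply/allP => x xt; have := mem x; rewrite mem_rev xt => /esym.
  rewrite cardE; apply: perm_size; apply: uniq_perm; rewrite ?enum_uniq //.
    exact: (pairwise_uniq irr pw).
  by move=> x; rewrite -mem_rev mem mem_enum.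
have irr : irreflexive (fun x y : Q0 => ~~ (y <= x)%O).
  by move=> x; rewrite lexx.
split=> // x; rewrite mem_rev.
have sub : {subset t <= enum [pred l : Q0 | (i <= l)%O]}.
  by move=> y yt; rewrite mem_enum inE (allP al).
(* Distinct vertices at or above [i], in the full number, are all of them; this is where the
   prescribed length enters. *)
have [_ E] := uniq_min_size (pairwise_uniq irr pw) sub (eq_leq (esym (etrans sz (cardE _)))).
by rewrite E mem_enum.
Qed.

(** [upper_filtration] inverts [f]; the reversals reconcile sequences read from the top with chains
    built from the bottom. *)
Lemma filtrations_correspond : exists f : seq (submodule P) -> seq Q0,
  set_bij (@good_filtration K d Q0 Q A P) (filtration_sequences i) f /\
  forall s, good_filtration s -> factor_labels s (f s).
Proof.
have ex (s : seq (submodule P)) : exists t : seq Q0, good_filtration s -> chain D (sm_zero P) s (rev t).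
  case: (pselect (good_filtration s)) => [gs|ngs]; last by exists [::].
  have /good_chain[lb [ch _]] := gs; by exists (rev lb); rewrite revK.
have [f fP] := choice ex.
have fco s : good_filtration s -> complete (rev (f s)).
  by move=> gs; apply: chain_complete (fP s gs) _; have [_ ->] := gs.
have fE s : good_filtration s -> s = upper_filtration [::] (rev (f s)).
  move=> gs; apply: chain_upper; rewrite ?upper0; [exact: fco | exact: fP |].
  by have [_ ->] := gs.
exists f; split; last first.
  move=> s gs; have /chainP[_ al] := fP s gs.
  by rewrite /factor_labels -[f s]revK all2_rev.
split.
- by move=> s gs; apply/complete_sequence/fco.
- move=> s s'; rewrite !inE => gs gs' ff.
  by rewrite (fE s gs) (fE s' gs') ff.
- move=> t /complete_sequence co; exists (upper_filtration [::] (rev t)).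
    apply/good_chain; exists (rev t); rewrite -upper0; split; first exact: upper_filtration_chain.
    rewrite upper_filtration_last upper_full //=.
    by have [_ ->] := co; rewrite inE lexx.
  have ch := upper_filtration_chain (F := [::]) co.
  rewrite upper0 in ch.
  have gs : good_filtration (upper_filtration [::] (rev t)).
    apply/good_chain; exists (rev t); split=> //; rewrite -upper0 upper_filtration_last upper_full //=.
    by have [_ ->] := co; rewrite inE lexx.
  by apply: (can_inj revK); apply: chain_label_inj (fP _ gs) ch.
Qed.

End Filtrations.

Theorem theoremA (K : closedFieldType) (d : Order.disp_t) (Q0 : finPOrderType d)
    (Q : quiver Q0) (A : boundQuiverAlgebra K Q) (hA : one_quasi_hereditary A) :
  (forall i j : Q0,
     ((exists a : arrow Q, a \in arrows_from_to Q i j \/ a \in arrows_from_to Q j i)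
        <-> neighbours i j) /\
     (neighbours i j ->
        #|arrows_from_to Q i j| = 1%N /\ #|arrows_from_to Q j i| = 1%N)) /\
  (exists upd : Q0 -> Q0 -> Q0 -> qpath Q,
     (forall j i k : Q0, (j <= i)%O -> (k <= i)%O -> up_down_path j i k (upd j i k)) /\
     exists X : set (pathAlgebra K Q),
       subset X (@up_down_relations K d Q0 Q upd) /\ bqa_ideal A = ideal_gen X) /\
  (forall i : Q0,
     exists f : seq (submodule (projective A i)) -> seq Q0,
       set_bij (@good_filtration K d Q0 Q A (projective A i))
               (filtration_sequences i) f /\
       forall s, @good_filtration K d Q0 Q A (projective A i) s ->
         factor_labels s (f s)).
Proof.
have [n [v [w [nT vP wP]]]] := generators hA.
have [a [b [upd [abP updP]]]] := upd_exists hA nT vP wP.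
split; first exact: (quiver_is_double hA nT vP wP abP updP).
split; last by move=> i; apply: (filtrations_correspond hA nT vP wP abP).
exists upd; split; first by move=> j i k ji ki; have [] := updP j i k ji ki.
exact: (ideal_generated hA vP wP abP updP).
Qed.
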